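(* Let $\Gamma$ be a non-abelian group without torsion, $G=PSL(2,\mathbb R)$, and $\rho=(\rho_L,\rho_R):\Gamma\to G\times G$ a faithful representation. Then $\rho$ is admissible if and only if the left and right representations $\rho_L,\rho_R:\Gamma\to G$ are faithful discrete representations with the same bounded Euler cohomology class (in $H^2_b(\Gamma,\mathbb Z)$).
   Context: The bounded Euler class of a representation $\Gamma\to G$ is that of the associated action of $\Gamma$ on the circle $\mathbb RP^1$ by orientation-preserving (projective) homeomorphisms. Let $E=\mathbb R^4$ with coordinates $(u,v,x_1,x_2)$ and $Q=-u^2-v^2+x_1^2+x_2^2$; $(E,Q)$ is isometric to $(\mathfrak{gl}(2,\mathbb R),-\det)$. Thus $\mathrm{AdS}=\{Q=-1\}$ is identified with $SL(2,\mathbb R)$ and $\mathrm{AdS}/\{\pm1\}$ with $G$; $G\times G$ acts on it isometrically by $(g_L,g_R)\cdot A=g_LAg_R^{-1}$. Let $\widetilde G$ be the universal covering of $G$, $Z$ its center, $\mathcal Z\subset\widetilde G\times\widetilde G$ the image of $Z$ under the diagonal embedding. The universal covering $\widetilde{\mathrm{AdS}}$ is identified with $\widetilde G$, and $(\widetilde G\times\widetilde G)/\mathcal Z$, acting by left and right translations, is the group of isometries of $\widetilde{\mathrm{AdS}}$ preserving orientation and time-orientation. Let $S(E)$ be the space of rays in $E$, in which $\mathrm{AdS}$ embeds as $\{Q<0\}$ with boundary $\mathrm{Ein}_2=\{[x]:Q(x)=0\}$. Let $\mathbb D^2=\{p\in S^2: p_3>0\}$ and $d$ the spherical distance. The map $\overline{\mathbb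 D}^2\times\mathbb R\to S(E)$, $(p,\theta)\mapsto[(\cos\theta,\sin\theta,p_1,p_2)]$ identifies $\mathbb D^2\times\mathbb R$ with $\widetilde{\mathrm{AdS}}$ and $\partial\mathbb D^2\times\mathbb R$ with the infinite cyclic covering $\widehat{\mathrm{Ein}}_2$ of $\mathrm{Ein}_2$, on which $(\widetilde G\times\widetilde G)/\mathcal Z$ also acts (by continuous extension). A subset $\widetilde\Lambda\subset\widehat{\mathrm{Ein}}_2=\partial\mathbb D^2\times\mathbb R$ is achronal if $d(x,y)\ge|\theta-\theta'|$ for all $(x,\theta),(y,\theta')\in\widetilde\Lambda$. Opposite points are pairs $(x,\theta),(-x,\theta+\pi)$. An achronal subset is pure lightlike if it contains two opposite points and is contained in the past lightcone of one and the future lightcone of the other (for achronal subsets, it is enough that it contains two opposite points); otherwise it is generic. Definition: $\rho$ is admissible if it is faithful, has discrete image, and lifts to a representation $\tilde\rho:\Gamma\to(\widetilde G\times\widetilde G)/\mathcal Z$ preserving a generic closed achronal subset of $\widehat{\mathrm{Ein}}_2$ containing at least two points. *)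

(* Defs.v *)
From HB Require Import structures.
From mathcomp Require Import all_boot all_order all_algebra.
From mathcomp Require Import all_classical all_reals all_analysis.

Set Implicit Arguments.
Unset Strict Implicit.
Unset Printing Implicit Defensive.
Import Order.TTheory GRing.Theory Num.Theory.
Import numFieldNormedType.Exports.

Local Open Scope classical_set_scope.
Local Open Scope ring_scope.
Local Open Scope quotient_scope.

Definition abelian_group (G : groupType) := forall x y : G, (x * y = y * x)%g.

Definition torsion_free (G : groupType) :=
  forall (x : G) (n : nat), (0 < n)%N -> (x ^+ n = 1)%g -> x = 1%g.

Definition center (G : groupType) : set G :=
  [set z | forall x : G, (z * x = x * z)%g].

Record normalSubgroup (G : groupType) := NormalSubgroup {
  nsg_set : set G;
  nsg1 : nsg_set 1%g;
  nsgM : forall x y, nsg_set x -> nsg_set y -> nsg_set (x * y)%g;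
  nsgV : forall x, nsg_set x -> nsg_set x^-1%g;
  nsgJ : forall x y, nsg_set x -> nsg_set (y^-1 * (x * y))%g
}.

Section QuotientGroup.
Variables (G : groupType) (N : normalSubgroup G).
Implicit Types x y z : G.

Definition coset_rel x y : bool := `[< nsg_set N (x^-1 * y)%g >].

Lemma coset_rel_refl : reflexive coset_rel.
Proof. by move=> x; apply/asboolP; rewrite mulVg; exact: nsg1. Qed.

Lemma coset_rel_sym : symmetric coset_rel.
Proof.
suff H x y : coset_rel x y -> coset_rel y x by move=> x y; apply/idP/idP; apply: H.
by move=> /asboolP h; apply/asboolP; rewrite -[x]invgK -invgM; exact: nsgV.
Qed.

Lemma coset_rel_trans : transitive coset_rel.
Proof.
move=> y x z /asboolP xy /asboolP yz; apply/asboolP.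
have -> : (x^-1 * z = (x^-1 * y) * (y^-1 * z))%g by rewrite mulgA mulgK.
exact: nsgM.
Qed.

Canonical coset_equiv :=
  EquivRel coset_rel coset_rel_refl coset_rel_sym coset_rel_trans.

Definition quotient_group := {eq_quot coset_equiv}.

HB.instance Definition _ := EqQuotient.on quotient_group.
HB.instance Definition _ := Choice.on quotient_group.

Lemma coset_eqP x y :
  reflect (nsg_set N (x^-1 * y)%g) (\pi_quotient_group x == \pi_quotient_group y).
Proof. by apply: (iffP idP); rewrite eqmodE => /asboolP. Qed.

Definition quotient_one : quotient_group := \pi_quotient_group 1%g.
Definition quotient_inv (x : quotient_group) : quotient_group :=
  \pi_quotient_group (repr x)^-1%g.
Definition quotient_mul (x y : quotient_group) : quotient_group :=
  \pi_quotient_group (repr x * repr y)%g.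

Lemma pi_repr_coset x : nsg_set N ((repr (\pi_quotient_group x))^-1 * x)%g.
Proof. by apply/coset_eqP; rewrite reprK. Qed.

Lemma quotient_mulE x y :
  quotient_mul (\pi_quotient_group x) (\pi_quotient_group y) = \pi_quotient_group (x * y)%g.
Proof.
apply/eqP/coset_eqP.
set x' := repr _; set y' := repr _.
have hx : nsg_set N (x'^-1 * x)%g by exact: pi_repr_coset.
have hy : nsg_set N (y'^-1 * y)%g by exact: pi_repr_coset.
have -> : ((x' * y')^-1 * (x * y) =
  (y'^-1 * y) * (y^-1 * ((x'^-1 * x) * y)))%g.
  by rewrite invgM !mulgA mulgK.
by apply: nsgM => //; exact: nsgJ.
Qed.

Lemma quotient_invE x :
  quotient_inv (\pi_quotient_group x) = \pi_quotient_group (x^-1)%g.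
Proof.
apply/eqP/coset_eqP.
set x' := repr _.
have hx : nsg_set N (x'^-1 * x)%g by exact: pi_repr_coset.
have -> : ((x'^-1)^-1 * x^-1 = (x^-1)^-1 * ((x'^-1 * x)^-1 * x^-1))%g.
  by rewrite invgM !invgK !mulgA mulgV mul1g.
apply: nsgJ; apply: nsgV; exact: hx.
Qed.

Lemma quotient_mulA : associative quotient_mul.
Proof.
elim/quotW=> x; elim/quotW=> y; elim/quotW=> z.
rewrite (quotient_mulE y z) (quotient_mulE x y).
by rewrite (quotient_mulE x) (quotient_mulE _ z) mulgA.
Qed.

Lemma quotient_mul1 : left_id quotient_one quotient_mul.
Proof. by elim/quotW=> x; rewrite quotient_mulE mul1g. Qed.

Lemma quotient_mulr1 : right_id quotient_one quotient_mul.
Proof. by elim/quotW=> x; rewrite quotient_mulE mulg1. Qed.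

Lemma quotient_mulV : left_inverse quotient_one quotient_inv quotient_mul.
Proof. by elim/quotW=> x; rewrite quotient_invE quotient_mulE mulVg. Qed.

Lemma quotient_mulrV : right_inverse quotient_one quotient_inv quotient_mul.
Proof. by elim/quotW=> x; rewrite quotient_invE quotient_mulE mulgV. Qed.

HB.instance Definition _ := isGroup.Build quotient_group
  quotient_mulA quotient_mul1 quotient_mulr1 quotient_mulV quotient_mulrV.

End QuotientGroup.

Section PSL2.
Variable R : realType.

Record SL2 := MkSL2 { SL2_mx :> 'M[R]_2; _ : \det SL2_mx == 1 }.

HB.instance Definition _ := [isSub for SL2_mx].
HB.instance Definition _ := [Choice of SL2 by <:].

Lemma det_SL2 (A : SL2) : \det A = 1.
Proof. by case: A => A /= /eqP. Qed.

Lemma SL2_unit (A : SL2) : (A : 'M[R]_2) \in unitmx.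
Proof. by rewrite unitmxE det_SL2 unitr1. Qed.

Lemma SL2_one_subproof : \det (1%:M : 'M[R]_2) == 1.
Proof. by rewrite det1. Qed.
Lemma SL2_mul_subproof (A B : SL2) : \det (A *m B) == 1.
Proof. by rewrite det_mulmx !det_SL2 mulr1. Qed.
Lemma SL2_inv_subproof (A : SL2) : \det (invmx A) == 1.
Proof. by rewrite det_inv det_SL2 invr1. Qed.
Lemma SL2_opp_subproof (A : SL2) : \det (- (A : 'M[R]_2)) == 1.
Proof. by rewrite -scaleN1r detZ sqrrN expr1n mul1r det_SL2. Qed.

Definition SL2_one := MkSL2 SL2_one_subproof.
Definition SL2_mul A B := MkSL2 (SL2_mul_subproof A B).
Definition SL2_inv A := MkSL2 (SL2_inv_subproof A).
Definition SL2_opp A := MkSL2 (SL2_opp_subproof A).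

Lemma SL2_mulA : associative SL2_mul.
Proof. by move=> A B C; apply/val_inj; rewrite /= mulmxA. Qed.
Lemma SL2_mul1 : left_id SL2_one SL2_mul.
Proof. by move=> A; apply/val_inj; rewrite /= mul1mx. Qed.
Lemma SL2_mulr1 : right_id SL2_one SL2_mul.
Proof. by move=> A; apply/val_inj; rewrite /= mulmx1. Qed.
Lemma SL2_mulV : left_inverse SL2_one SL2_inv SL2_mul.
Proof. by move=> A; apply/val_inj; rewrite /= mulVmx// SL2_unit. Qed.
Lemma SL2_mulrV : right_inverse SL2_one SL2_inv SL2_mul.
Proof. by move=> A; apply/val_inj; rewrite /= mulmxV// SL2_unit. Qed.

HB.instance Definition _ := isGroup.Build SL2
  SL2_mulA SL2_mul1 SL2_mulr1 SL2_mulV SL2_mulrV.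

HB.instance Definition _ := Topological.copy SL2 (initial_topology SL2_mx).

Definition pm1 : set SL2 := [set A | A = 1%g \/ A = SL2_opp 1%g].

Lemma SL2_oppM (A B : SL2) : (SL2_opp A * B = SL2_opp (A * B))%g.
Proof. by apply/val_inj; rewrite /= mulNmx. Qed.
Lemma SL2_mulN (A B : SL2) : (A * SL2_opp B = SL2_opp (A * B))%g.
Proof. by apply/val_inj; rewrite /= mulmxN. Qed.
Lemma SL2_oppK : involutive SL2_opp.
Proof. by move=> A; apply/val_inj; rewrite /= opprK. Qed.

Lemma pm1_1 : pm1 1%g. Proof. by left. Qed.
Lemma pm1_M x y : pm1 x -> pm1 y -> pm1 (x * y)%g.
Proof.
by case=> -> [] ->; rewrite ?SL2_oppM ?SL2_mulN !mul1g ?SL2_oppK; [left|right|right|left].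
Qed.
Lemma pm1_V x : pm1 x -> pm1 x^-1%g.
Proof.
case=> ->; first by left; rewrite invg1.
have h : (SL2_opp 1 * SL2_opp 1 = 1 :> SL2)%g by rewrite SL2_oppM mul1g SL2_oppK.
by right; rewrite -[LHS]mulg1 -{2}h mulKg.
Qed.
Lemma pm1_J x y : pm1 x -> pm1 (y^-1 * (x * y))%g.
Proof.
by case=> ->; rewrite ?SL2_oppM mul1g ?SL2_mulN mulVg; [left|right].
Qed.

Definition pm1_normal := NormalSubgroup pm1_1 pm1_M pm1_V pm1_J.

Definition PSL2 := quotient_group pm1_normal.
HB.instance Definition _ := Topological.copy PSL2
  (quotient_topology (quotient_group pm1_normal)).
HB.instance Definition _ := Group.on PSL2.

Definition PSL2_of (A : SL2) : PSL2 := \pi_(quotient_group pm1_normal) A.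

End PSL2.

Section CircleLifts.
Variable R : realType.

(* The circle is RP^1 = R / pi Z, where t represents the line spanned by
   (cos t, sin t).  These are the lifts to R of its orientation-preserving
   homeomorphisms. *)
Definition is_circle_lift (f : R -> R) : Prop :=
  [/\ continuous f, bijective f, {homo f : s t / s < t}
    & forall t, f (t + pi) = f t + pi].

Record circle_lift := MkCircleLift {
  circle_lift_fun :> R -> R;
  _ : `[< is_circle_lift circle_lift_fun >] }.

HB.instance Definition _ := [isSub for circle_lift_fun].
HB.instance Definition _ := [Choice of circle_lift by <:].

Lemma circle_liftP (f : circle_lift) : is_circle_lift f.
Proof. by case: f => f /= /asboolP. Qed.

Lemma increasing_bij_continuous (f : R -> R) :
  bijective f -> {homo f : s t / s < t} -> continuous f.
Proof.
move=> [g fK gK] fi x.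
have fm : {mono f : s t / s < t} by apply: leW_mono; apply: le_mono.
apply/cvgrPdist_lt => e e0.
have xI : x \in `]g (f x - e), g (f x + e)[.
  rewrite in_itv/= -fm gK -[X in _ && X]fm gK.
  by rewrite ltrBlDr ltrDl e0 /=.
near=> y.
have : y \in `]g (f x - e), g (f x + e)[.
  by near: y; exact: near_in_itvoo.
rewrite in_itv/= -fm gK -[X in _ && X]fm gK => /andP[h1 h2].
by rewrite ltr_distlC h1 h2.
Unshelve. all: by end_near. Qed.

Lemma circle_lift_id_subproof : `[< is_circle_lift (@id R) >].
Proof. by apply/asboolP; split => //; [move=> x; exact: cvg_id|exists id]. Qed.

Lemma circle_lift_comp_subproof (f g : circle_lift) :
  `[< is_circle_lift (f \o g) >].
Proof.
apply/asboolP; case: (circle_liftP f) => _ bf fi fT.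
case: (circle_liftP g) => _ bg gi gT.
have bfg : bijective (f \o g) by exact: bij_comp.
have fgi : {homo f \o g : s t / s < t} by move=> s t st; apply/fi/gi.
split => //; first exact: increasing_bij_continuous.
by move=> t; rewrite /= gT fT.
Qed.

Lemma circle_lift_inv_ex (f : circle_lift) :
  exists g : R -> R, cancel f g /\ cancel g f.
Proof. by case: (circle_liftP f) => _ [g fK gK] _ _; exists g. Qed.

Definition circle_lift_inv_fun (f : circle_lift) : R -> R :=
  sval (cid (circle_lift_inv_ex f)).

Lemma circle_lift_invK (f : circle_lift) : cancel f (circle_lift_inv_fun f).
Proof. by rewrite /circle_lift_inv_fun; case: cid => g /= []. Qed.
Lemma circle_lift_invVK (f : circle_lift) : cancel (circle_lift_inv_fun f) f.
Proof. by rewrite /circle_lift_inv_fun; case: cid => g /= []. Qed.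

Lemma circle_lift_inv_subproof (f : circle_lift) :
  `[< is_circle_lift (circle_lift_inv_fun f) >].
Proof.
apply/asboolP; case: (circle_liftP f) => _ bf fi fT.
have fm : {mono f : s t / s < t} by apply: leW_mono; apply: le_mono.
have bg : bijective (circle_lift_inv_fun f).
  by exists f; [exact: circle_lift_invVK|exact: circle_lift_invK].
have gi : {homo circle_lift_inv_fun f : s t / s < t}.
  by move=> s t st; rewrite -fm !circle_lift_invVK.
split => //; first exact: increasing_bij_continuous.
move=> t; apply: (bij_inj bf).
by rewrite fT !circle_lift_invVK.
Qed.

Definition circle_lift_one := MkCircleLift circle_lift_id_subproof.
Definition circle_lift_mul f g := MkCircleLift (circle_lift_comp_subproof f g).
Definition circle_lift_inv f := MkCircleLift (circle_lift_inv_subproof f).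

Lemma circle_lift_mulA : associative circle_lift_mul.
Proof. by move=> f g h; apply/val_inj. Qed.
Lemma circle_lift_mul1 : left_id circle_lift_one circle_lift_mul.
Proof. by move=> f; apply/val_inj. Qed.
Lemma circle_lift_mulr1 : right_id circle_lift_one circle_lift_mul.
Proof. by move=> f; apply/val_inj. Qed.
Lemma circle_lift_mulV :
  left_inverse circle_lift_one circle_lift_inv circle_lift_mul.
Proof.
by move=> f; apply/val_inj/funext => t /=; rewrite circle_lift_invK.
Qed.
Lemma circle_lift_mulrV :
  right_inverse circle_lift_one circle_lift_inv circle_lift_mul.
Proof.
by move=> f; apply/val_inj/funext => t /=; rewrite circle_lift_invVK.
Qed.

HB.instance Definition _ := isGroup.Build circle_lift circle_lift_mulA
  circle_lift_mul1 circle_lift_mulr1 circle_lift_mulV circle_lift_mulrV.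

Definition dir (t : R) : 'cV[R]_2 := \col_i (if i == 0 then cos t else sin t).

(* [f] lifts the projective transformation [dir t] |-> [A *m dir t] *)
Definition lifts_mx (A : 'M[R]_2) (f : R -> R) : Prop :=
  forall t, exists2 c : R, c != 0 & A *m dir t = c *: dir (f t).

Definition lifts (g : PSL2 R) (f : R -> R) : Prop :=
  exists2 A : SL2 R, PSL2_of A = g & lifts_mx A f.

Definition is_PSL2_lift : {pred circle_lift} :=
  fun f => `[< exists g : PSL2 R, lifts g f >].

Lemma lifts_mx_mul (A B : SL2 R) (f g : circle_lift) :
  lifts_mx A f -> lifts_mx B g -> lifts_mx (A * B)%g (f * g)%g.
Proof.
move=> hA hB t; have [b b0 hb] := hB t; have [a a0 ha] := hA (g t).
exists (b * a); first by rewrite mulf_neq0.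
by rewrite -mulmxA hb -scalemxAr ha scalerA.
Qed.

Lemma lifts_mx_inv (A : SL2 R) (f : circle_lift) :
  lifts_mx A f -> lifts_mx (A^-1)%g (f^-1)%g.
Proof.
move=> hA t; have [a a0 ha] := hA ((f^-1)%g t).
have ft : f ((f^-1)%g t) = t by exact: circle_lift_invVK.
exists a^-1; first by rewrite invr_neq0.
rewrite ft in ha.
apply: (scalerI a0); rewrite scalerA divff// scale1r scalemxAr -ha.
by rewrite mulmxA mulVmx ?SL2_unit// mul1mx.
Qed.

Lemma is_PSL2_lift_group : group_closed is_PSL2_lift.
Proof.
split.
  apply/asboolP; exists (PSL2_of 1%g), 1%g => // t; exists 1 => //.
  by rewrite mul1mx scale1r.
move=> f g /asboolP[_ [A _ hA]] /asboolP[_ [B _ hB]]; apply/asboolP.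
exists (PSL2_of (A * B^-1)%g), (A * B^-1)%g => //.
by apply: lifts_mx_mul => //; exact: lifts_mx_inv.
Qed.

(* PSL(2,R) acts faithfully on RP^1 and deforms onto its rotation subgroup,
   whose elements lift to the translations of R: the lifts of all its elements
   form its universal covering group. *)
Record PSL2_cover := MkPSL2Cover {
  PSL2_cover_lift :> circle_lift;
  _ : PSL2_cover_lift \in is_PSL2_lift }.

HB.instance Definition _ := [isSub for PSL2_cover_lift].
HB.instance Definition _ := [Choice of PSL2_cover by <:].
HB.instance Definition _ :=
  SubChoice_isSubGroup.Build _ _ PSL2_cover is_PSL2_lift_group.

End CircleLifts.

Section AntiDeSitter.
Variable R : realType.
Local Notation cover := (PSL2_cover R).

Definition diag_center : set (cover * cover) :=
  [set w | exists2 z, center z & w = (z, z)].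

Lemma diag_center1 : diag_center 1%g.
Proof. by exists 1%g => // x; rewrite mul1g mulg1. Qed.
Lemma diag_centerM x y :
  diag_center x -> diag_center y -> diag_center (x * y)%g.
Proof.
move=> [z zc ->] [w wc ->]; exists (z * w)%g => // x0.
by rewrite -(mulgA z) (wc x0) (mulgA z) (zc x0) -mulgA.
Qed.
Lemma diag_centerV x : diag_center x -> diag_center x^-1%g.
Proof.
move=> [z zc ->]; exists (z^-1)%g => // x0.
by apply: (mulgI z); rewrite mulgA mulgV mul1g mulgA zc mulgK.
Qed.
Lemma diag_centerJ x y : diag_center x -> diag_center (y^-1 * (x * y))%g.
Proof.
move=> [z zc ->]; exists z => //.
by case: y => a b; congr pair; rewrite /= zc mulKg.
Qed.

Definition diag_center_normal :=
  NormalSubgroup diag_center1 diag_centerM diag_centerV diag_centerJ.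

Definition AdS_isom := quotient_group diag_center_normal.
HB.instance Definition _ := Group.on AdS_isom.

Definition AdS_isom_of (F : cover * cover) : AdS_isom :=
  \pi_(quotient_group diag_center_normal) F.

Definition isom_lifts (g : PSL2 R * PSL2 R) (x : AdS_isom) : Prop :=
  exists F : cover * cover,
    [/\ AdS_isom_of F = x, lifts g.1 F.1 & lifts g.2 F.2].

Definition dot3 (p q : 'rV[R]_3) : R := \sum_i p 0 i * q 0 i.

Definition sphere_dist (p q : 'rV[R]_3) : R := acos (dot3 p q).

Definition height (p : 'rV[R]_3) : R := p 0 ord_max.

Definition open_disc : set 'rV[R]_3 := [set p | dot3 p p = 1 /\ 0 < height p].
Definition closed_disc : set 'rV[R]_3 := [set p | dot3 p p = 1 /\ 0 <= height p].
Definition circle : set 'rV[R]_3 := [set p | dot3 p p = 1 /\ height p = 0].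

Definition AdS_cover : set ('rV[R]_3 * R) := open_disc `*` setT.
Definition AdS_cover_closure : set ('rV[R]_3 * R) := closed_disc `*` setT.
Definition Ein_cover : set ('rV[R]_3 * R) := circle `*` setT.

(* The isometry of (E, Q) onto (gl(2,R), -det). *)
Definition gl2_of (u v x1 x2 : R) : 'M[R]_2 := \matrix_(i, j)
  if i == 0 then (if j == 0 then u + x1 else v + x2)
  else (if j == 0 then x2 - v else u - x1).

Definition dev (q : 'rV[R]_3 * R) : 'M[R]_2 :=
  gl2_of (cos q.2) (sin q.2) (q.1 0 0) (q.1 0 1).

(* The identification of [AdS_cover] with the universal covering group.  The
   matrix [dev (p, theta)] has positive determinant [height p ^+ 2] and
   identifying R^2 with C it maps [dir t] to
   e^{i (t - theta)} (1 + (p_1 + i p_2) e^{- i (2 t - theta)}); as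
   |p_1 + i p_2| < 1, exactly one lift stays within pi / 2 of [t - theta],
   it depends continuously on (p, theta), and it is the identity at the point
   ((0, 0, 1), 0), whose matrix is 1. *)
Definition AdS_point (q : 'rV[R]_3 * R) (F : cover) : Prop :=
  lifts_mx (dev q) F /\ forall t, `|F t - (t - q.2)| < pi / 2.

(* [Phi] extends continuously to the boundary the left-right translation
   A |-> F.1 A F.2^-1; it is determined by [F] on [AdS_cover_closure]. *)
Definition extends_translation (F : cover * cover)
    (Phi : 'rV[R]_3 * R -> 'rV[R]_3 * R) : Prop :=
  {within AdS_cover_closure, continuous Phi} /\
  forall q, AdS_cover q -> exists A : cover,
    [/\ AdS_point q A, AdS_cover (Phi q)
      & AdS_point (Phi q) (F.1 * A * F.2^-1)%g].

Definition isom_acts (x : AdS_isom) (Phi : 'rV[R]_3 * R -> 'rV[R]_3 * R) :=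
  exists2 F : cover * cover, AdS_isom_of F = x & extends_translation F Phi.

Definition preserves (x : AdS_isom) (L : set ('rV[R]_3 * R)) : Prop :=
  exists2 Phi, isom_acts x Phi & Phi @` L = L.

Definition achronal (L : set ('rV[R]_3 * R)) : Prop :=
  forall q r, L q -> L r -> `|q.2 - r.2| <= sphere_dist q.1 r.1.

Definition opposite (q r : 'rV[R]_3 * R) : Prop :=
  r.1 = - q.1 /\ r.2 = q.2 + pi.

Definition future_lightcone (q : 'rV[R]_3 * R) : set ('rV[R]_3 * R) :=
  [set r | Ein_cover r /\ r.2 - q.2 = sphere_dist q.1 r.1].
Definition past_lightcone (q : 'rV[R]_3 * R) : set ('rV[R]_3 * R) :=
  [set r | Ein_cover r /\ q.2 - r.2 = sphere_dist q.1 r.1].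

Definition pure_lightlike (L : set ('rV[R]_3 * R)) : Prop :=
  exists q r, [/\ L q, L r, opposite q r,
    L `<=` future_lightcone q & L `<=` past_lightcone r].

Definition generic (L : set ('rV[R]_3 * R)) : Prop := ~ pure_lightlike L.

End AntiDeSitter.

Section BoundedCohomology.
Variable Gam : groupType.

Definition bounded_cochain1 (b : Gam -> int) : Prop :=
  exists M : int, forall x, `|b x| <= M.

Definition bounded_cochain2 (c : Gam -> Gam -> int) : Prop :=
  exists M : int, forall x y, `|c x y| <= M.

Definition coboundary1 (b : Gam -> int) (x y : Gam) : int :=
  b y - b (x * y)%g + b x.

Definition coboundary2 (c : Gam -> Gam -> int) (x y z : Gam) : int :=
  c y z - c (x * y)%g z + c x (y * z)%g - c x y.

Definition bounded_cocycle2 (c : Gam -> Gam -> int) : Prop :=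
  bounded_cochain2 c /\ forall x y z, coboundary2 c x y z = 0.

(* The class of [c] in H^2_b(Gam, Z), as a coset of the coboundaries of bounded
   1-cochains in the group of bounded 2-cocycles. *)
Definition bounded_class (c : Gam -> Gam -> int) : set (Gam -> Gam -> int) :=
  [set c' | bounded_cocycle2 c' /\ exists2 b, bounded_cochain1 b &
    forall x y, c' x y - c x y = coboundary1 b x y].

Variables (R : realType) (rho : {multiplicative Gam -> PSL2 R}).

(* The set-theoretic section defining the canonical Euler cocycle; [pi] is one
   full turn of RP^1. *)
Definition standard_lift (g : PSL2 R) : circle_lift R :=
  xget 1%g [set f : circle_lift R | lifts g f /\ 0 <= f 0 < pi].

Definition euler_cocycle (x y : Gam) : int :=
  xget 0 [set n : int | forall t,
    (standard_lift (rho x) * standard_lift (rho y))%g t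
      = standard_lift (rho (x * y)%g) t + n%:~R * pi].

Definition bounded_euler_class : set (Gam -> Gam -> int) :=
  bounded_class euler_cocycle.

End BoundedCohomology.

Definition discrete_subset (T : topologicalType) (A : set T) : Prop :=
  A `<=` isolated A.

Definition faithful_discrete (R : realType) (Gam : groupType)
    (rho : {multiplicative Gam -> PSL2 R}) : Prop :=
  injective rho /\ discrete_subset (range rho).

Definition admissible (R : realType) (Gam : groupType)
    (rho : {multiplicative Gam -> (PSL2 R * PSL2 R)%type}) : Prop :=
  [/\ injective rho, discrete_subset (range rho)
    & exists (rhot : {multiplicative Gam -> AdS_isom R})
             (L : set ('rV[R]_3 * R)),
      (forall x, isom_lifts (rho x) (rhot x)) /\
      [/\ L `<=` @Ein_cover R, closed L, achronal L & generic L] /\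
      (exists q r, [/\ L q, L r & q <> r]) /\
      forall x, preserves (rhot x) L].

(* Main.v *)
(* In the coordinates [ein xi ze] of the boundary, [xi] is a lift of the image and
   [ze] a lift of the kernel of the rank one matrix [dev (ein xi ze)], so that
   [(F_1, F_2)] acts by [(xi, ze) |-> (F_1 xi, F_2 ze)].  A generic closed achronal
   set becomes a closed subset of the plane, invariant under [(pi, pi)], monotone and
   without vertical or horizontal segments of length [pi]: a generalized graph
   semiconjugating the two projections of [rho].

   Given such an invariant curve, a pair of lifts of [rho_L x] and [rho_R x]
   preserving it is unique up to a common turn; comparing with the standard lifts
   gives a bounded cochain whose coboundary is the difference of the Euler cocycles.
   If some [rho_L x] is elliptic, it is an irrational rotation and the curve is the
   graph of an element of the universal covering, which conjugates [rho_L] to [rho_R],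
   so that [rho_L] is as faithful and discrete as [rho].  Otherwise, small elements of
   [rho_L(Gam)] or a kernel of [rho_L] would produce a common fixed point of [rho_L]
   or of [rho_R], hence (by a supremum along the curve) of both; but a nonabelian
   discrete group of pairs of triangular matrices contains a pair of unipotents
   moving points in opposite directions, which is incompatible with a monotone curve.

   Conversely, equality of the bounded Euler classes provides lifts [F_L], [F_R] with
   the same cocycle, and [t |-> sup_x F_R(x)^-1 (F_L(x) t)] is an equivariant monotone
   map; the closure of its graph is an invariant curve. *)
Require Import Defs.
From HB Require Import structures.
From mathcomp Require Import all_boot all_order all_algebra.
From mathcomp Require Import all_classical all_reals all_analysis.
From mathcomp Require Import ring lra zify.
Set Implicit Arguments.
Unset Strict Implicit.
Unset Printing Implicit Defensive.
Import Order.TTheory GRing.Theory Num.Theory.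
Import numFieldNormedType.Exports.
Local Open Scope classical_set_scope.
Local Open Scope ring_scope.
Local Open Scope quotient_scope.
Local Opaque pi.

(** * Plane geometry *)

Section PlaneGeometry.
Variable R : realType.
Implicit Types (s t k : R) (A B : 'M[R]_2) (u v w : 'cV[R]_2).

(** Two obstacles shape the proof. The boundary action is given only as a continuous extension from
    the interior, so translations need a formula valid on the closed disc. Matrices are written as
    $z\mapsto az+b\bar z$ on $\mathbb R^2=\mathbb C$; the time coordinate is minus the argument of
    $a$. Multiplying a boundary point by a matrix of determinant 1 keeps $a\ne0$, so the formula
    extends continuously. The other obstacle is that only the pair is known to be discrete, so
    nothing about discrete groups applies to one factor. Traces replace it: in a group without
    elliptic elements a trace near 2 is at least 2, and for a small [h] and a conjugate [k] of it
    the trace identities then make [h k - k h] singular, whence a common fixed direction. Genericity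
    is used as a bound: every vertical or horizontal section of the curve is shorter than [pi]. The
    exclusion of common fixed points serves the converse too, with the diagonal as curve: it rules
    out vertical segments of length [pi] in the curve constructed there. *)

Lemma dirE0 t : dir t 0 0 = cos t.
Proof. by rewrite mxE. Qed.

Lemma dirE1 t : dir t 1 0 = sin t.
Proof. by rewrite mxE. Qed.

Lemma mulmx2E m n (A : 'M[R]_(m, 2)) (B : 'M[R]_(2, n)) i j :
  (A *m B) i j = A i 0 * B 0 j + A i 1 * B 1 j.
Proof.
rewrite mxE !big_ord_recl big_ord0 addr0.
by congr (_ + A i _ * B _ j); apply/val_inj.
Qed.

Lemma ord2_cases (i : 'I_2) : i = 0 \/ i = 1.
Proof.
by case: i => [[|[|//]] h]; [left|right]; apply/val_inj.
Qed.

Lemma det_mx22 A : \det A = A 0 0 * A 1 1 - A 0 1 * A 1 0.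
Proof.
rewrite (expand_det_row _ 0) !big_ord_recl big_ord0 addr0 /cofactor.
rewrite !det_mx11 !mxE /= expr0 mul1r expr1 mulN1r mulrN.
by congr (_ * A _ _ - A _ _ * A _ _); apply/val_inj.
Qed.

Lemma mx2P A B :
  [/\ A 0 0 = B 0 0, A 0 1 = B 0 1, A 1 0 = B 1 0 & A 1 1 = B 1 1] -> A = B.
Proof.
move=> [h1 h2 h3 h4]; apply/matrixP => i j.
by case: (ord2_cases i) => ->; case: (ord2_cases j) => ->.
Qed.

Lemma cv2P u v : u 0 0 = v 0 0 -> u 1 0 = v 1 0 -> u = v.
Proof.
move=> h1 h2; apply/matrixP => i j; rewrite (ord1 j).
by case: (ord2_cases i) => ->.
Qed.

Definition dotp u v := u 0 0 * v 0 0 + u 1 0 * v 1 0.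
Definition cross u v := u 0 0 * v 1 0 - u 1 0 * v 0 0.

Lemma cross_dir s t : cross (dir s) (dir t) = sin (t - s).
Proof. by rewrite /cross !dirE0 !dirE1 sinB; ring. Qed.

Lemma dotp_dir s t : dotp (dir s) (dir t) = cos (t - s).
Proof. by rewrite /dotp !dirE0 !dirE1 cosB; ring. Qed.

Lemma crossZ k u v : cross u (k *: v) = k * cross u v.
Proof. by rewrite /cross !mxE; ring. Qed.

Lemma crossZl k u v : cross (k *: u) v = k * cross u v.
Proof. by rewrite /cross !mxE; ring. Qed.

Lemma dotpZ k u v : dotp u (k *: v) = k * dotp u v.
Proof. by rewrite /dotp !mxE; ring. Qed.

Lemma crossvv u : cross u u = 0.
Proof. by rewrite /cross mulrC subrr. Qed.

Lemma cross_mulmx A u v : cross (A *m u) (A *m v) = \det A * cross u v.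
Proof. by rewrite /cross !mulmx2E det_mx22; ring. Qed.

Lemma dir_neq0 t : dir t != 0.
Proof.
apply/eqP => h; have := cos2Dsin2 t.
by rewrite -dirE0 -dirE1 h !mxE; move/eqP; rewrite expr0n addr0 eq_sym oner_eq0.
Qed.

Lemma frame_dir s v : v = dotp (dir s) v *: dir s + cross (dir s) v *: dir (s + pi / 2).
Proof.
have h := cos2Dsin2 s.
apply: cv2P; rewrite /dotp /cross !mxE /= ?dirE0 ?dirE1 ?cosDpihalf ?sinDpihalf.
  transitivity ((cos s ^+ 2 + sin s ^+ 2) * v 0 0); first by rewrite h mul1r.
  by ring.
transitivity ((cos s ^+ 2 + sin s ^+ 2) * v 1 0); first by rewrite h mul1r.
by ring.
Qed.

(** The argument of a point of the right half plane is an arctangent. Continuous angles are obtained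
    below by rotating a vector into this half plane. *)
Lemma atan_polar x y : 0 < x ->
  exists c : R, [/\ 0 < c, x = c * cos (atan (y / x)) & y = c * sin (atan (y / x))].
Proof.
move=> x0; have h : 0 < cos (atan (y / x)).
  by apply: cos_gt0_pihalf; rewrite atan_gtNpi2 atan_ltpi2.
exists (x / cos (atan (y / x))); split; first exact: divr_gt0.
  by rewrite divfK ?gt_eqF.
rewrite -mulrA [_^-1 * _]mulrC.
have := atanK (y / x); rewrite /tan => ->.
by rewrite mulrC divfK ?gt_eqF.
Qed.

Lemma dir_of_frame s a c v : dotp (dir s) v = c * cos a -> cross (dir s) v = c * sin a ->
  v = c *: dir (s + a).
Proof.
move=> h1 h2; rewrite (frame_dir s v) h1 h2.
by apply: cv2P; rewrite !mxE /= ?cosD ?sinD ?cos_pihalf ?sin_pihalf; ring.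
Qed.

Lemma nonzero_dir v : v != 0 -> exists t c, 0 < c /\ v = c *: dir t.
Proof.
move=> v0.
have pos w : 0 < w 0 0 -> exists t c, 0 < c /\ w = c *: dir t.
  move=> w0; have [c [c0 h1 h2]] := atan_polar (w 1 0) w0.
  exists (atan (w 1 0 / w 0 0)), c; split=> //.
  by apply: cv2P; rewrite mxE ?dirE0 ?dirE1.
have [h|h|h] := ltgtP (v 0 0) 0.
- have [|t [c [c0 e]]] := pos (- v); first by rewrite mxE oppr_gt0.
  exists (t + pi), c; split=> //.
  rewrite -[v]opprK e; apply: cv2P; rewrite !mxE /= ?cosDpi ?sinDpi; ring.
- exact: pos.
- have v1 : v 1 0 != 0.
    by apply: contra v0 => /eqP e; apply/eqP/cv2P; rewrite ?h ?e mxE.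
  have [h1|h1] := orP (lt_total v1).
    exists (- (pi / 2)), (- v 1 0); rewrite oppr_gt0; split=> //.
    by apply: cv2P; rewrite !mxE /= ?cosN ?sinN ?cos_pihalf ?sin_pihalf ?h ?mulr0 //; ring.
  exists (pi / 2), (v 1 0); split=> //.
  by apply: cv2P; rewrite !mxE /= ?cos_pihalf ?sin_pihalf ?h ?mulr0 // mulr1.
Qed.

Lemma sin_eq0 t : sin t = 0 -> exists k : int, t = k%:~R * pi.
Proof.
move=> t0; exists (Num.floor (t / pi)); set k := Num.floor _.
have p0 := @pi_gt0 R.
have per (n : nat) s : sin (s + n%:R * pi) = 0 -> sin s = 0.
  elim: n s => [|n IH] s; first by rewrite mul0r addr0.
  rewrite -natr1 mulrDl mul1r addrA sinDpi => /eqP; rewrite oppr_eq0 => /eqP.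
  exact: IH.
have per' (n : nat) s : sin (s - n%:R * pi) = 0 -> sin s = 0.
  elim: n s => [|n IH] s; first by rewrite mul0r subr0.
  rewrite -natr1 mulrDl mul1r opprD addrA => h.
  by apply: IH; rewrite -[_ - _](subrK pi) sinDpi h oppr0.
have h : sin (t - k%:~R * pi) = 0.
  case: (k) => n; first by apply: (per n); rewrite subrK.
  by apply: (per' n.+1); rewrite NegzE mulrNz mulNr opprK addrK.
have /andP[l1 l2] := floor_itv (t / pi); rewrite -/k in l1 l2.
have d0 : 0 <= t - k%:~R * pi by rewrite subr_ge0 -ler_pdivlMr.
have d1 : t - k%:~R * pi < pi.
  rewrite ltrBlDl -[X in _ + X]mul1r -mulrDl -ltr_pdivrMr //.
  by rewrite intrD in l2.
apply/eqP; rewrite -subr_eq0 eq_le d0 andbT leNgt; apply/negP => d2.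
by have := sin_gt0_pi; move=> /(_ R (t - k%:~R * pi)); rewrite d1 d2 h ltxx => /(_ isT).
Qed.

Lemma dir_addpi t : dir (t + pi) = - dir t.
Proof. by apply: cv2P; rewrite !mxE /= ?cosDpi ?sinDpi. Qed.

Lemma dir_addz (k : int) t : dir (t + k%:~R * pi) = (-1) ^+ `|k|%N *: dir t.
Proof.
have pos (n : nat) s : dir (s + n%:R * pi) = (-1) ^+ n *: dir s.
  elim: n => [|n IH]; first by rewrite mul0r addr0 expr0 scale1r.
  by rewrite -natr1 mulrDl mul1r addrA dir_addpi IH exprS mulN1r scaleNr.
case: k => n; first exact: pos.
rewrite NegzE mulrNz mulNr abszN.
rewrite -[X in _ = _ *: dir X](subrK (n.+1%:~R * pi) t) [X in _ = _ *: X]pos.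
by rewrite scalerA -expr2 sqrr_sign scale1r.
Qed.

Lemma dir_par s t : cross (dir s) (dir t) = 0 -> exists k : int, t = s + k%:~R * pi.
Proof.
by rewrite cross_dir => /sin_eq0[k e]; exists k; rewrite -e addrC subrK.
Qed.

Lemma par_dir s t c : dir s = c *: dir t -> exists k : int, s = t + k%:~R * pi.
Proof.
move=> h; apply: dir_par; rewrite h crossZ cross_dir subrr sin0 mulr0 //.
Qed.

Lemma dir_eq_cos s t c : dir s = c *: dir t -> c = 1 \/ c = - 1.
Proof.
move=> /[dup] h /par_dir[k e]; move: h; rewrite e dir_addz => h.
have : ((-1) ^+ `|k|%N - c) *: dir t = 0 by rewrite scalerBl h subrr.
move/eqP; rewrite scaler_eq0 (negbTE (dir_neq0 t)) orbF subr_eq0 => /eqP <-.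
by rewrite -signr_odd; case: odd; [right|left].
Qed.

End PlaneGeometry.

(** * Lifts of projective transformations to the line *)

Section CircleLiftTheory.
Variable R : realType.
Implicit Types (f g : circle_lift R) (s t c : R) (A B : SL2 R).

Lemma circle_lift_lt f : {mono f : s t / s < t}.
Proof. by case: (circle_liftP f) => _ _ fi _; apply: leW_mono; apply: le_mono. Qed.

Lemma circle_lift_le f : {mono f : s t / s <= t}.
Proof. by case: (circle_liftP f) => _ _ fi _; apply: le_mono. Qed.

Lemma circle_lift_inj f : injective f.
Proof. exact: inc_inj (circle_lift_le f). Qed.

Lemma circle_lift_cts f : continuous f.
Proof. by case: (circle_liftP f). Qed.

Lemma circle_lift_addpi f t : f (t + pi) = f t + pi.
Proof. by case: (circle_liftP f). Qed.

Lemma circle_lift_addz f (k : int) t : f (t + k%:~R * pi) = f t + k%:~R * pi.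
Proof.
have pos (n : nat) s : f (s + n%:R * pi) = f s + n%:R * pi.
  elim: n => [|n IH]; first by rewrite !mul0r !addr0.
  by rewrite -natr1 mulrDl mul1r addrA circle_lift_addpi IH -addrA.
case: k => n; first exact: pos.
rewrite NegzE mulrNz mulNr -[in RHS](subrK (n.+1%:~R * pi) t).
by rewrite [in RHS]pos addrK.
Qed.

Lemma circle_lift_mulE f g t : (f * g)%g t = f (g t).
Proof. by []. Qed.

Lemma circle_lift_mulVE f t : (f^-1)%g (f t) = t.
Proof. exact: circle_lift_invK. Qed.

Lemma circle_lift_mulEV f t : f ((f^-1)%g t) = t.
Proof. exact: circle_lift_invVK. Qed.

Lemma circle_liftP_eq f g : f =1 g -> f = g.
Proof. by move=> h; apply/val_inj/funext. Qed.

Lemma shift_subproof c : `[< is_circle_lift (fun t : R => t + c) >].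
Proof.
have b : bijective (fun t : R => t + c).
  by exists (fun t => t - c) => t; rewrite ?addrK ?subrK.
have m : {homo (fun t : R => t + c) : s t / s < t} by move=> s t; rewrite ltrD2r.
apply/asboolP; split => //; first exact: increasing_bij_continuous.
by move=> t; rewrite addrAC.
Qed.

Definition shift c : circle_lift R := MkCircleLift (shift_subproof c).

Lemma shiftE c t : shift c t = t + c.
Proof. by []. Qed.

(** The deck transformations of the line over $\mathbb{RP}^1$; they also form the center of the
    universal covering group. *)
Definition turn (k : int) : circle_lift R := shift (k%:~R * pi).

Lemma turnE k t : turn k t = t + k%:~R * pi.
Proof. by []. Qed.

Lemma turnC k f : (turn k * f = f * turn k)%g.
Proof.
by apply: circle_liftP_eq => t; rewrite !circle_lift_mulE !turnE circle_lift_addz.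
Qed.

Lemma turnD k l : turn (k + l) = (turn k * turn l)%g.
Proof.
by apply: circle_liftP_eq => t; rewrite !circle_lift_mulE !turnE intrD mulrDl; ring.
Qed.

Lemma turn0 : turn 0 = 1%g.
Proof. by apply: circle_liftP_eq => t; rewrite turnE mul0r addr0. Qed.

Lemma turnN k : turn (- k) = (turn k)^-1%g.
Proof. by apply: (mulgI (turn k)); rewrite mulgV -turnD subrr turn0. Qed.

Lemma intpi_lt (k l : int) : (k%:~R * pi < l%:~R * pi :> R) = (k < l).
Proof. by rewrite ltr_pM2r ?pi_gt0 // ltr_int. Qed.

Lemma intpi_le (k l : int) : (k%:~R * pi <= l%:~R * pi :> R) = (k <= l).
Proof. by rewrite ler_pM2r ?pi_gt0 // ler_int. Qed.

Lemma intpi_small (k : int) : `|k%:~R * pi : R| < pi -> k = 0.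
Proof.
have p0 := @pi_gt0 R.
rewrite normrM (gtr0_norm p0) -[X in _ < X]mul1r ltr_pM2r //.
by rewrite -intr_norm -[1]/(1%:~R) ltr_int; lia.
Qed.

Lemma turn_inj : injective turn.
Proof.
move=> k l /(congr1 (fun f : circle_lift R => f 0)); rewrite !turnE !add0r.
by move/eqP; rewrite eq_le !intpi_le; lia.
Qed.

Lemma mod_pi t : exists k : int, 0 <= t - k%:~R * pi < pi.
Proof.
have p0 := @pi_gt0 R.
exists (Num.floor (t / pi)); have /andP[l1 l2] := floor_itv (t / pi).
rewrite subr_ge0 -ler_pdivlMr // l1 /= ltrBlDl -[X in _ + X]mul1r -mulrDl.
by rewrite -ltr_pdivrMr // intrD in l2 *.
Qed.

Lemma circle_lift_gap f s t : 0 < t - s < pi -> 0 < f t - f s < pi.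
Proof.
rewrite subr_gt0 => /andP[st ts]; rewrite subr_gt0 circle_lift_lt st /=.
by rewrite ltrBlDl -circle_lift_addpi circle_lift_lt -ltrBlDl.
Qed.

(** The difference is everywhere a multiple of [pi]. Between points less than [pi] apart both lifts
    increase by less than [pi], so the difference changes by less than [pi] and hence not at all. *)
Lemma circle_lift_sin_eq f g : (forall t, sin (f t - g t) = 0) ->
  exists k, f = (turn k * g)%g.
Proof.
move=> h; have e t : exists k : int, f t - g t = k%:~R * pi by apply: sin_eq0.
have near s t : 0 < t - s < pi -> f t - g t = f s - g s.
  move=> d; have := circle_lift_gap f d; have := circle_lift_gap g d.
  have [k ek] := e t; have [l el] := e s; rewrite ek el => /andP[a1 a2] /andP[b1 b2].
  suff -> : k = l by [].
  apply/eqP; rewrite -subr_eq0; apply/eqP/intpi_small.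
  by rewrite intrB mulrBl -ek -el ltr_norml; apply/andP; split; lra.
have [k ek] := e 0; exists k; apply: circle_liftP_eq => t.
rewrite circle_lift_mulE turnE; apply/eqP; rewrite addrC -subr_eq -ek; apply/eqP.
have [l /andP[l0 l1]] := mod_pi t.
have -> : t = (t - l%:~R * pi) + l%:~R * pi by rewrite subrK.
set s := t - _ in l0 l1 *.
rewrite !circle_lift_addz opprD addrACA subrr addr0.
by move: l0; rewrite le_eqVlt => /predU1P[<-//|l0]; apply: near; rewrite subr0 l0.
Qed.

Lemma lifts_mx_unique (M : 'M[R]_2) f g : lifts_mx M f -> lifts_mx M g ->
  exists k, f = (turn k * g)%g.
Proof.
move=> hf hg; apply: circle_lift_sin_eq => t.
have [c c0 e] := hf t; have [d d0 e'] := hg t.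
have : c * d * sin (f t - g t) = 0.
  by rewrite -cross_dir -mulrA -crossZl -crossZ -e -e' crossvv.
by move/eqP; rewrite !mulf_eq0 (negbTE c0) (negbTE d0) => /eqP.
Qed.

Lemma lifts_mx_par (M N : 'M[R]_2) (f : R -> R) : \det M != 0 ->
  lifts_mx M f -> lifts_mx N f -> exists2 c, c != 0 & N = c *: M.
Proof.
move=> dM hM hN.
have par t : exists2 c, c != 0 & N *m dir t = c *: (M *m dir t).
  have [c c0 e] := hM t; have [d d0 e'] := hN t.
  exists (d / c); first by rewrite mulf_neq0 ?invr_eq0.
  by rewrite e e' scalerA divfK.
(* Projective maps of the line agreeing at three points are equal. One radian gives a third
   direction besides the axes, since its sine and cosine are positive. *)
have [c c0 e0] := par 0; have [d d0 e1] := par (pi / 2); have [b b0 e2] := par 1.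
exists c => //.
have s1 : (dir 1 : 'cV[R]_2) = cos 1 *: dir 0 + sin 1 *: dir (pi / 2).
  by apply: cv2P; rewrite !mxE /= ?cos0 ?sin0 ?cos_pihalf ?sin_pihalf; ring.
have cd : c = d.
  have : cross (M *m dir 1) (N *m dir 1) = 0 by rewrite e2 crossZ crossvv mulr0.
  have -> : cross (M *m dir 1) (N *m dir 1) =
      cos 1 * sin 1 * (d - c) * cross (M *m dir 0) (M *m dir (pi / 2)).
    rewrite s1 !mulmxDr -!scalemxAr e0 e1; rewrite /cross !mxE; ring.
  rewrite cross_mulmx cross_dir subr0 sin_pihalf mulr1 => /eqP.
  have c1 := @cos1_gt0 R; have s1' : 0 < sin (1 : R) by apply: sin2_gt0; lra.
  by rewrite !mulf_eq0 (negbTE dM) (gt_eqF c1) (gt_eqF s1') orbF /= subr_eq0 => /eqP->.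
have col (i : 'I_2) (K : 'M[R]_2) :
    (K *m dir 0) i 0 = K i 0 /\ (K *m dir (pi / 2)) i 0 = K i 1.
  by rewrite !mulmx2E !mxE /= cos0 sin0 cos_pihalf sin_pihalf; split; ring.
rewrite -cd in e1; have E i : N i 0 = c * M i 0 /\ N i 1 = c * M i 1.
  have [<- <-] := col i N; have [<- <-] := col i M.
  by rewrite e0 e1 !mxE.
have [a1 a2] := E 0; have [a3 a4] := E 1.
by apply: mx2P; rewrite !mxE.
Qed.

End CircleLiftTheory.

(** * Angular part of a planar matrix and existence of lifts *)

Section ProjectiveLifts.
Variable R : realType.
Implicit Types (f g : circle_lift R) (s t c r k : R) (A B : SL2 R) (M : 'M[R]_2).

Lemma PSL2_of_eq A B : PSL2_of A = PSL2_of B <-> B = A \/ B = SL2_opp A.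
Proof.
have E := @coset_eqP _ (pm1_normal R) A B.
split=> [h|h].
  have := elimT E; move: h; rewrite /PSL2_of => ->; rewrite eqxx => /(_ isT)[] h.
  - by left; rewrite -[B](mulVKg A) h mulg1.
  - by right; rewrite -[B](mulVKg A) h SL2_mulN mulg1.
suff /(introT E)/eqP : nsg_set (pm1_normal R) (A^-1 * B)%g by [].
case: h => ->; first by left; rewrite mulVg.
by right; rewrite SL2_mulN mulVg.
Qed.

Lemma PSL2_ofM A B : PSL2_of (A * B)%g = (PSL2_of A * PSL2_of B)%g.
Proof. exact/esym/(@quotient_mulE _ (pm1_normal R)). Qed.

Lemma PSL2_of1 : PSL2_of (1%g : SL2 R) = 1%g.
Proof. by []. Qed.

Lemma PSL2_ofV A : PSL2_of A^-1%g = (PSL2_of A)^-1%g.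
Proof. by apply: (mulgI (PSL2_of A)); rewrite -PSL2_ofM !mulgV. Qed.

Lemma PSL2_of_opp A : PSL2_of (SL2_opp A) = PSL2_of A.
Proof. by apply/PSL2_of_eq; right; rewrite SL2_oppK. Qed.

Lemma PSL2_of_surj (x : PSL2 R) : exists A, PSL2_of A = x.
Proof. by exists (repr x); exact: reprK. Qed.

Lemma SL2_det A : A 0 0 * A 1 1 - A 0 1 * A 1 0 = 1.
Proof. by rewrite -det_mx22 det_SL2. Qed.

Lemma lifts_mx_opp A f : lifts_mx A f -> lifts_mx (SL2_opp A) f.
Proof.
move=> h t; have [c c0 e] := h t.
by exists (- c); rewrite ?oppr_eq0 //= mulNmx e scaleNr.
Qed.

Lemma lifts_of A f : lifts (PSL2_of A) f -> lifts_mx A f.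
Proof.
move=> [B /PSL2_of_eq[] ->] //; exact: lifts_mx_opp.
Qed.

Lemma ofP_lifts A f : lifts_mx A f -> lifts (PSL2_of A) f.
Proof. by exists A. Qed.

Lemma lifts_mul (x y : PSL2 R) f g : lifts x f -> lifts y g -> lifts (x * y)%g (f * g)%g.
Proof.
move=> [A <- hA] [B <- hB]; exists (A * B)%g; first exact: PSL2_ofM.
exact: lifts_mx_mul.
Qed.

Lemma lifts_turn (k : int) : lifts (1%g : PSL2 R) (turn R k).
Proof.
exists 1%g => // t; exists ((-1) ^+ `|k|%N); first by rewrite signr_eq0.
by rewrite mul1mx turnE dir_addz scalerA -expr2 sqrr_sign scale1r.
Qed.

Lemma lifts_turn_mul (x : PSL2 R) (k : int) f : lifts x f -> lifts x (turn R k * f)%g.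
Proof. by rewrite -{2}[x]mul1g; apply: lifts_mul; exact: lifts_turn. Qed.

Lemma lifts_uniq (x : PSL2 R) f g : lifts x f -> lifts x g ->
  exists k : int, f = (turn R k * g)%g.
Proof.
move=> [A <- hA] /lifts_of hB; exact: lifts_mx_unique hA hB.
Qed.

Lemma lifts_mx_SL2_par A B f : lifts_mx A f -> lifts_mx B f -> B = A \/ B = SL2_opp A.
Proof.
move=> hA hB; have dA : \det A != 0 by rewrite det_SL2 oner_eq0.
have [c c0 e] := lifts_mx_par dA hA hB.
have : c ^+ 2 = 1.
  by have := det_SL2 B; rewrite e detZ det_SL2 mulr1.
move/eqP; rewrite sqrf_eq1 => /orP[] /eqP c1; [left|right]; apply/val_inj => /=.
  by rewrite e c1 scale1r.
by rewrite e c1 scaleN1r.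
Qed.

Lemma lifts_fun (x y : PSL2 R) f : lifts x f -> lifts y f -> x = y.
Proof.
by move=> [A <- hA] [B <- hB]; apply/PSL2_of_eq; apply: lifts_mx_SL2_par hA hB.
Qed.

(** On $\mathbb C=\mathbb R^2$ the matrix is $z\mapsto az+b\bar z$, and $a=re^{-ik}$. As
    $|b|^2=r^2-\det M$ ([polar_norm]), a positive determinant makes the first term dominate, so
    [M *m dir t] stays within a right angle of [dir (t - k)]. *)
Definition polar M r k :=
  [/\ 0 < r, M 0 0 + M 1 1 = 2 * r * cos k & M 0 1 - M 1 0 = 2 * r * sin k].

Lemma polar_exists M : 0 < \det M -> exists r k, polar M r k.
Proof.
rewrite det_mx22 => d.
pose v : 'cV[R]_2 := \col_i (if i == 0 then (M 0 0 + M 1 1) / 2 else (M 0 1 - M 1 0) / 2).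
have v0 : v != 0.
  apply/eqP => e; have := congr1 (fun w : 'cV[R]_2 => w 0 0) e.
  have := congr1 (fun w : 'cV[R]_2 => w 1 0) e; rewrite !mxE /= => a b.
  have {}a : M 0 1 = M 1 0 by lra.
  have {}b : M 0 0 = - M 1 1 by lra.
  by move: d; rewrite a b; nra.
have [k [r [r0 e]]] := nonzero_dir v0; exists r, k; split => //.
  have := congr1 (fun w : 'cV[R]_2 => w 0 0) e; rewrite !mxE /=; lra.
have := congr1 (fun w : 'cV[R]_2 => w 1 0) e; rewrite !mxE /=; lra.
Qed.

Lemma polar_dot M r k t : polar M r k ->
  dotp (dir (t - k)) (M *m dir t) = r + (M 0 0 - M 1 1) / 2 * cos (t - k + t)
    + (M 0 1 + M 1 0) / 2 * sin (t - k + t).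
Proof.
move=> [r0 hu hv].
have -> : r = (M 0 0 + M 1 1) / 2 * cos (t - (t - k)) + (M 0 1 - M 1 0) / 2 * sin (t - (t - k)).
  have h := cos2Dsin2 k; rewrite hu hv.
  have -> : t - (t - k) = k by rewrite opprB addrC subrK.
  transitivity (r * (cos k ^+ 2 + sin k ^+ 2)); first by rewrite h mulr1.
  by field.
by set a := t - k; rewrite /dotp !mulmx2E !dirE0 !dirE1 cosB sinB cosD sinD; field.
Qed.

Lemma polar_norm M r k : polar M r k ->
  ((M 0 0 - M 1 1) / 2) ^+ 2 + ((M 0 1 + M 1 0) / 2) ^+ 2 = r ^+ 2 - \det M.
Proof.
move=> [r0 hu hv]; rewrite det_mx22.
have -> : r ^+ 2 = ((M 0 0 + M 1 1) / 2) ^+ 2 + ((M 0 1 - M 1 0) / 2) ^+ 2.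
  have h := cos2Dsin2 k; rewrite hu hv.
  transitivity (r ^+ 2 * (cos k ^+ 2 + sin k ^+ 2)); first by rewrite h mulr1.
  by field.
by field.
Qed.

Lemma rotation_bound x y t : (x * cos t + y * sin t) ^+ 2 <= x ^+ 2 + y ^+ 2.
Proof.
have h := cos2Dsin2 t.
have -> : x ^+ 2 + y ^+ 2 = (x * cos t + y * sin t) ^+ 2 + (x * sin t - y * cos t) ^+ 2.
  transitivity ((x ^+ 2 + y ^+ 2) * (cos t ^+ 2 + sin t ^+ 2)); first by rewrite h mulr1.
  by ring.
by rewrite lerDl sqr_ge0.
Qed.

Lemma sqr_lt_add_gt0 x r : 0 < r -> x ^+ 2 < r ^+ 2 -> 0 < r + x.
Proof.
move=> r0 h; rewrite -ltrBlDl sub0r.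
have : `|x| < r by rewrite -(ltr_pXn2r (n := 2)) ?nnegrE ?(ltW r0) // real_normK ?num_real.
by rewrite ltr_norml => /andP[].
Qed.

Lemma polar_dot_gt0 M r k t : 0 < \det M -> polar M r k ->
  0 < dotp (dir (t - k)) (M *m dir t).
Proof.
move=> d p; rewrite (polar_dot t p) -addrA; apply: sqr_lt_add_gt0.
  by case: p.
by apply: le_lt_trans (rotation_bound _ _ _) _; rewrite (polar_norm p) ltrBlDr ltrDl.
Qed.

Lemma cos_gt0_small t : 0 < cos t -> `|t| < 3 * pi / 2 -> `|t| < pi / 2.
Proof.
have p0 := @pi_gt0 R.
move=> h b; rewrite ltNge; apply/negP => l.
have : 0 <= cos (`|t| - pi) by apply: cos_ge0_pihalf; apply/andP; split; lra.
by rewrite -oppr_le0 -cosDpi subrK cos_norm leNgt h.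
Qed.

Lemma polar_lift M r k : 0 < \det M -> polar M r k ->
  exists f, forall t, `|f t - (t - k)| < pi / 2 /\
    exists c, 0 < c /\ M *m dir t = c *: dir (f t).
Proof.
move=> d p; have p0 := @pi_gt0 R.
pose re t := dotp (dir (t - k)) (M *m dir t).
pose im t := cross (dir (t - k)) (M *m dir t).
pose F t := t - k + atan (im t / re t).
have re0 t : 0 < re t by exact: (polar_dot_gt0 t d p).
have Fb t : `|F t - (t - k)| < pi / 2.
  by rewrite /F addrC addrA addNr add0r ltr_norml atan_gtNpi2 atan_ltpi2.
have Fd t : exists c, 0 < c /\ M *m dir t = c *: dir (F t).
  have [c [c0 h1 h2]] := atan_polar (im t) (re0 t).
  by exists c; split=> //; apply: dir_of_frame.
have Fp t : F (t + pi) = F t + pi.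
  have e : t + pi - k = t - k + pi by rewrite addrAC.
  rewrite /F /im /re e !dir_addpi mulmxN.
  have -> : cross (- dir (t - k)) (- (M *m dir t)) = cross (dir (t - k)) (M *m dir t).
    by rewrite /cross !mxE; ring.
  have -> : dotp (- dir (t - k)) (- (M *m dir t)) = dotp (dir (t - k)) (M *m dir t).
    by rewrite /dotp !mxE; ring.
  by rewrite addrAC.
(* For [t - s >= pi] the bound [Fb] suffices. Otherwise the positive determinant gives [F t - F s] a
   positive sine, and [Fb] keeps it above [- pi]. *)
have Fi : {homo F : s t / s < t}.
  move=> s t st; have := Fb s; have := Fb t; rewrite !ltr_norml => /andP[a1 a2] /andP[b1 b2].
  have [h|h] := leP pi (t - s); first by lra.
  have : 0 < sin (F t - F s).
    have [c [c0 e]] := Fd s; have [c' [c'0 e']] := Fd t.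
    have : 0 < cross (M *m dir s) (M *m dir t).
      by rewrite cross_mulmx cross_dir mulr_gt0 // sin_gt0_pi // subr_gt0 st.
    by rewrite e e' crossZ crossZl cross_dir !pmulr_rgt0.
  move=> sp; rewrite -subr_gt0 ltNge; apply/negP => D.
  have : 0 <= sin (- (F t - F s)) by apply: sin_ge0_pi; apply/andP; split; lra.
  by rewrite sinN oppr_ge0 leNgt sp.
have cmd i : continuous (fun t => (M *m dir t) i 0).
  move=> t; have -> : (fun t => (M *m dir t) i 0) = (fun t => M i 0 * cos t + M i 1 * sin t).
    by apply/funext => s; rewrite mulmx2E !mxE.
  apply: cvgD; apply: cvgM; try exact: cvg_cst; [exact: continuous_cos|exact: continuous_sin].
have cdk (h : R -> R) : continuous h -> continuous (fun t => h (t - k)).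
  move=> ch t; apply: (@continuous_comp _ _ _ (fun t => t - k) h); last exact: ch.
  by apply: cvgB; [exact: cvg_id|exact: cvg_cst].
have cre : continuous re.
  move=> t; rewrite /re /dotp; under eq_fun do rewrite dirE0 dirE1.
  by apply: cvgD; apply: cvgM; try exact: cmd; apply: cdk;
    [exact: continuous_cos|exact: continuous_sin].
have cim : continuous im.
  move=> t; rewrite /im /cross; under eq_fun do rewrite dirE0 dirE1.
  by apply: cvgB; apply: cvgM; try exact: cmd; apply: cdk;
    [exact: continuous_cos|exact: continuous_sin].
have cF : continuous F.
  move=> t; apply: cvgD; first by apply: cvgB; [exact: cvg_id|exact: cvg_cst].
  apply: (@continuous_comp _ _ _ (fun t => im t / re t) atan); last exact: continuous_atan.
  by apply: cvgM; [exact: cim|apply: cvgV; [rewrite gt_eqF|exact: cre]].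
have Fs y : exists x, F x = y.
  have h1 := Fb (y + k - pi / 2); have h2 := Fb (y + k + pi / 2).
  have le1 : y + k - pi / 2 <= y + k + pi / 2 by lra.
  have cw : {within `[y + k - pi / 2, y + k + pi / 2], continuous F}.
    by apply: continuous_subspaceT; exact: cF.
  have [|x _ e] := @IVT R F _ _ y le1 cw; last by exists x.
  have : F (y + k - pi / 2) <= y <= F (y + k + pi / 2).
    by move: h1 h2; rewrite !ltr_norml => /andP[? ?] /andP[? ?]; apply/andP; split; lra.
  by move=> /andP[? ?]; rewrite ge_min le_max; apply/andP; split; apply/orP; [left|right].
have bF : bijective F.
  pose G y := sval (cid (Fs y)); have FG : cancel G F by move=> y; rewrite /G; case: cid.
  exists G => //; apply: inj_can_sym => //.
  have Fm : {mono F : s t / s < t} by apply: leW_mono; apply: le_mono.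
  exact: inc_inj (le_mono Fi).
have Fl : `[< is_circle_lift F >] by apply/asboolP; split.
by exists (MkCircleLift Fl) => t; split; [exact: Fb|exact: Fd].
Qed.

Lemma lifts_mx_exists A : exists f, lifts_mx A f.
Proof.
have d : 0 < \det A by rewrite det_SL2.
have [r [k p]] := polar_exists d; have [f h] := polar_lift d p.
exists f => t; have [_ [c [c0 e]]] := h t; exists c => //; exact: lt0r_neq0.
Qed.

Lemma lifts_exists (x : PSL2 R) : exists f, lifts x f.
Proof.
have [A <-] := PSL2_of_surj x; have [f h] := lifts_mx_exists A.
by exists f; apply: ofP_lifts.
Qed.

(** Composing a lift with a turn moves [k] by a multiple of [pi] and may change the sign of the
    matrix, so the representative [B] has to be chosen together with [k]. *)
Lemma lifts_mx_polar A f : lifts_mx A f -> exists B r k,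
  [/\ PSL2_of B = PSL2_of A, polar B r k, forall t, `|f t - (t - k)| < pi / 2
    & forall t, exists c, 0 < c /\ B *m dir t = c *: dir (f t)].
Proof.
move=> hf; have d : 0 < \det A by rewrite det_SL2.
have [r [k [r0 hu hv]]] := polar_exists d.
have [f0 h0] := polar_lift d (And3 r0 hu hv).
have l0 : lifts_mx A f0.
  move=> t; have [_ [c [c0 e]]] := h0 t; exists c => //; exact: lt0r_neq0.
have [n en] := lifts_mx_unique hf l0.
pose sg : R := (-1) ^+ `|n|%N.
have sg2 : sg * sg = 1 by rewrite -expr2 sqrr_sign.
have [B [eB eM]] : exists B, PSL2_of B = PSL2_of A /\ (B : 'M[R]_2) = sg *: (A : 'M[R]_2).
  rewrite /sg -signr_odd; case: odd.
    by exists (SL2_opp A); rewrite PSL2_of_opp /= expr1 scaleN1r.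
  by exists A; rewrite expr0 scale1r.
have dk := dir_addz (R := R) n; rewrite -/sg in dk.
exists B, r, (k - n%:~R * pi); split => //.
- have dk' : dir (k - n%:~R * pi) = sg *: dir k.
    by rewrite -[in RHS](subrK (n%:~R * pi) k) dk scalerA sg2 scale1r.
  have ck : cos (k - n%:~R * pi) = sg * cos k by rewrite -!dirE0 dk' mxE.
  have sk : sin (k - n%:~R * pi) = sg * sin k by rewrite -!dirE1 dk' mxE.
  by split=> //; rewrite ?ck ?sk eM !mxE -?mulrDr -?mulrBr ?hu ?hv; ring.
- by move=> t; have [h _] := h0 t; rewrite en circle_lift_mulE turnE; move: h; congr (`|_| < _);
  ring.
- move=> t; have [_ [c [c0 e]]] := h0 t; exists c; split=> //.
  by rewrite eM -scalemxAl e en circle_lift_mulE turnE dk !scalerA mulrC.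
Qed.

End ProjectiveLifts.

(** * Translations of the universal covering of AdS *)

Section LeftTranslation.
Variable R : realType.
Local Notation pt := ('rV[R]_3 * R)%type.
Implicit Types (q : pt) (F A : PSL2_cover R) (M N : 'M[R]_2) (t r k x y z : R).

Lemma ord3_cases (i : 'I_3) : [\/ i = 0, i = 1 | i = ord_max].
Proof.
case: i => [[|[|[|//]]] h]; [apply: Or31|apply: Or32|apply: Or33]; exact/val_inj.
Qed.

Lemma rV3P (p p' : 'rV[R]_3) : p 0 0 = p' 0 0 -> p 0 1 = p' 0 1 ->
  p 0 ord_max = p' 0 ord_max -> p = p'.
Proof.
move=> h0 h1 h2; apply/matrixP => i j; rewrite (ord1 i).
by case: (ord3_cases j) => ->.
Qed.

Lemma dot3E (p p' : 'rV[R]_3) :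
  dot3 p p' = p 0 0 * p' 0 0 + p 0 1 * p' 0 1 + p 0 ord_max * p' 0 ord_max.
Proof.
rewrite /dot3 !big_ord_recl big_ord0 addr0 addrA.
by congr (_ + p 0 _ * p' 0 _ + p 0 _ * p' 0 _); apply/val_inj.
Qed.

Definition row3 x y z : 'rV[R]_3 := \row_i (if i == 0 then x else if i == 1 then y else z).

Lemma row3E x y z : ((row3 x y z 0 0 = x) * (row3 x y z 0 1 = y) *
  (row3 x y z 0 ord_max = z))%type.
Proof. by rewrite !mxE. Qed.

(** The time coordinate is the angle of the matrix, so the condition in [AdS_point] selects exactly
    the lift built by [polar_lift]. *)
Lemma dev_polar q : polar (dev q) 1 q.2.
Proof. by split=> //; rewrite !mxE /=; ring. Qed.

Lemma det_dev q : AdS_cover_closure q -> \det (dev q) = height q.1 ^+ 2.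
Proof.
move=> [[h _] _]; rewrite det_mx22 !mxE /= /height; move: h; rewrite dot3E => h.
have c := cos2Dsin2 q.2.
have -> : q.1 0 ord_max ^+ 2 = cos q.2 ^+ 2 + sin q.2 ^+ 2 - q.1 0 0 * q.1 0 0 - q.1 0 1 * q.1 0 1.
  by rewrite c; lra.
by ring.
Qed.

Lemma open_AdS_closure q : AdS_cover q -> AdS_cover_closure q.
Proof. by move=> [[h1 h2] _]; split=> //; split=> //; apply: ltW. Qed.

Lemma Ein_AdS_closure q : Ein_cover q -> AdS_cover_closure q.
Proof. by move=> [[h1 h2] _]; split=> //; split=> //; rewrite h2. Qed.

Lemma det_dev_gt0 q : AdS_cover q -> 0 < \det (dev q).
Proof.
move=> h; rewrite det_dev; last exact: open_AdS_closure.
by apply: exprn_gt0; case: h => [[]].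
Qed.

Lemma polar_entries M r k : polar M r k -> exists x y,
  [/\ (M 0 0 - M 1 1) / 2 = x, (M 0 1 + M 1 0) / 2 = y &
   [/\ M 0 0 = r * cos k + x, M 0 1 = r * sin k + y, M 1 0 = y - r * sin k
     & M 1 1 = r * cos k - x]].
Proof.
move=> [r0 hu hv]; exists ((M 0 0 - M 1 1) / 2), ((M 0 1 + M 1 0) / 2).
by split=> //; split; lra.
Qed.

Section Formula.
Variables (B : 'M[R]_2) (k : R).

Definition left_re q :=
  let N := B *m dev q in
  (N 0 0 + N 1 1) / 2 * cos (q.2 + k) + (N 0 1 - N 1 0) / 2 * sin (q.2 + k).
Definition left_im q :=
  let N := B *m dev q in
  (N 0 1 - N 1 0) / 2 * cos (q.2 + k) - (N 0 0 + N 1 1) / 2 * sin (q.2 + k).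
Definition left_arg q := atan (left_im q / left_re q).
Definition left_abs q := left_re q / cos (left_arg q).

(* The point [q'] over [dev q' = B *m dev q / left_abs q]; in complex notation the
   C-linear part of [B *m dev q] is
   [e^{- i (q.2 + k)} (left_re q - i left_im q)]. *)
Definition left_mul q : pt :=
  let N := B *m dev q in
  (row3 ((N 0 0 - N 1 1) / 2 / left_abs q) ((N 0 1 + N 1 0) / 2 / left_abs q)
     (height q.1 / left_abs q),
   q.2 + k + left_arg q).

End Formula.

(** With [B] as $z\mapsto az+b\bar z$ and [dev q] as $z\mapsto a'z+b'\bar z$, the product has linear
    part $aa'+b\bar b'$, where $|b|<|a|$ and $|b'|\le1=|a'|$. The strict inequality comes from [B]
    alone, so the boundary, where [dev q] is singular, is included. *)
Lemma left_re_gt0 (B : 'M[R]_2) r k q : polar B r k -> \det B = 1 ->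
  AdS_cover_closure q -> 0 < left_re B k q.
Proof.
move=> p d qc; have [r0 _ _] := p.
have [x [y [ex ey [e00 e01 e10 e11]]]] := polar_entries p.
set p1 := q.1 0 0; set p2 := q.1 0 1.
have -> : left_re B k q = r + ((x * p1 + y * p2) * cos (q.2 + k)
    + (x * p2 - y * p1) * sin (q.2 + k)).
  rewrite /left_re !mulmx2E.
  have h := cos2Dsin2 (q.2 + k).
  transitivity (r * (cos (q.2 + k) ^+ 2 + sin (q.2 + k) ^+ 2)
    + ((x * p1 + y * p2) * cos (q.2 + k) + (x * p2 - y * p1) * sin (q.2 + k))); last first.
    by rewrite h mulr1.
  have -> : r * (cos (q.2 + k) ^+ 2 + sin (q.2 + k) ^+ 2) =
     r * (cos q.2 * cos k - sin q.2 * sin k) * cos (q.2 + k) +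
     r * (sin q.2 * cos k + cos q.2 * sin k) * sin (q.2 + k).
    by rewrite -cosD -sinD; ring.
  by rewrite !mxE /= -/p1 -/p2 e00 e01 e10 e11; field.
apply: sqr_lt_add_gt0 => //.
apply: le_lt_trans (rotation_bound _ _ _) _.
have n := polar_norm p; rewrite d ex ey in n.
have : p1 ^+ 2 + p2 ^+ 2 <= 1.
  case: qc => [[+ _] _]; rewrite dot3E -/p1 -/p2 => <-.
  by rewrite -!expr2 lerDl sqr_ge0.
have x2 := sqr_ge0 x; have y2 := sqr_ge0 y.
have -> : (x * p1 + y * p2) ^+ 2 + (x * p2 - y * p1) ^+ 2 = (x ^+ 2 + y ^+ 2) * (p1 ^+ 2 + p2 ^+
    2) by ring.
rewrite n; move: n => n; nra.
Qed.

Lemma left_abs_polar (B : 'M[R]_2) r k q : polar B r k -> \det B = 1 ->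
  AdS_cover_closure q ->
  [/\ 0 < left_abs B k q, `|left_arg B k q| < pi / 2
    & polar (B *m dev q) (left_abs B k q) (q.2 + k + left_arg B k q)].
Proof.
move=> p d qc; have re0 := left_re_gt0 p d qc.
have a0 : `|left_arg B k q| < pi / 2.
  by rewrite ltr_norml atan_gtNpi2 atan_ltpi2.
have c0 : 0 < cos (left_arg B k q) by apply: cos_gt0_pihalf; rewrite -ltr_norml.
have abs0 : 0 < left_abs B k q by exact: divr_gt0.
have e1 : left_re B k q = left_abs B k q * cos (left_arg B k q).
  by rewrite /left_abs divfK // gt_eqF.
have e2 : left_im B k q = left_abs B k q * sin (left_arg B k q).
  have := atanK (left_im B k q / left_re B k q); rewrite -/(left_arg B k q) /tan => h.
  rewrite /left_abs -mulrA [_^-1 * _]mulrC h mulrC divfK // gt_eqF //.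
split=> //; split=> //.
all: have h := cos2Dsin2 (q.2 + k).
all: rewrite ?[cos (_ + left_arg _ _ _)]cosD ?[sin (_ + left_arg _ _ _)]sinD.
  transitivity (2 * (left_re B k q * cos (q.2 + k) - left_im B k q * sin (q.2 + k))); last first.
    by rewrite e1 e2; ring.
  rewrite /left_re /left_im /=; set N := B *m dev q.
  transitivity ((N 0 0 + N 1 1) * (cos (q.2 + k) ^+ 2 + sin (q.2 + k) ^+ 2));
    first by rewrite h mulr1.
  by field.
transitivity (2 * (left_re B k q * sin (q.2 + k) + left_im B k q * cos (q.2 + k))); last first.
  by rewrite e1 e2; ring.
rewrite /left_re /left_im /=; set N := B *m dev q.
transitivity ((N 0 1 - N 1 0) * (cos (q.2 + k) ^+ 2 + sin (q.2 + k) ^+ 2));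
  first by rewrite h mulr1.
by field.
Qed.

Lemma left_mul_dev (B : 'M[R]_2) r k q : polar B r k -> \det B = 1 ->
  AdS_cover_closure q ->
  dev (left_mul B k q) = (left_abs B k q)^-1 *: (B *m dev q).
Proof.
move=> p d qc; have [a0 _ pol] := left_abs_polar p d qc.
have an : left_abs B k q != 0 by rewrite gt_eqF.
have [x [y]] := polar_entries pol; rewrite /left_mul.
set N := B *m dev q; move=> [ex ey [e00 e01 e10 e11]].
have ZE (c : R) i j : (c *: N) i j = c * N i j by rewrite mxE.
rewrite ex ey; apply: mx2P; rewrite !ZE e00 e01 e10 e11.
by split; rewrite !mxE ?row3E /=; field; rewrite an.
Qed.

Lemma left_mul_sphere (B : 'M[R]_2) r k q : polar B r k -> \det B = 1 ->
  AdS_cover_closure q -> dot3 (left_mul B k q).1 (left_mul B k q).1 = 1.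
Proof.
move=> p d qc; have [a0 _ pol] := left_abs_polar p d qc.
have an : left_abs B k q != 0 by rewrite gt_eqF.
have n := polar_norm pol; rewrite det_mulmx d mul1r (det_dev qc) in n.
rewrite dot3E /= !row3E.
set N := B *m dev q in n *.
transitivity ((((N 0 0 - N 1 1) / 2) ^+ 2 + ((N 0 1 + N 1 0) / 2) ^+ 2 + height q.1 ^+ 2) /
    left_abs B k q ^+ 2).
  by field.
by rewrite n subrK divff // expf_neq0.
Qed.

Lemma left_mul_closure (B : 'M[R]_2) r k q : polar B r k -> \det B = 1 ->
  AdS_cover_closure q -> AdS_cover_closure (left_mul B k q).
Proof.
move=> p d qc; split=> //; split; first exact: left_mul_sphere p d qc.
have [a0 _ _] := left_abs_polar p d qc.
by rewrite /height row3E divr_ge0 ?(ltW a0) //; case: qc => [[]].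
Qed.

Lemma left_mul_AdS (B : 'M[R]_2) r k q : polar B r k -> \det B = 1 ->
  AdS_cover q -> AdS_cover (left_mul B k q).
Proof.
move=> p d qo; have qc := open_AdS_closure qo.
split=> //; split; first exact: left_mul_sphere p d qc.
have [a0 _ _] := left_abs_polar p d qc.
by rewrite /height row3E divr_gt0 //; case: qo => [[]].
Qed.

Lemma continuous_row3 (T : topologicalType) (f g h : T -> R) (a : T) :
  {for a, continuous f} -> {for a, continuous g} -> {for a, continuous h} ->
  {for a, continuous (fun b => row3 (f b) (g b) (h b))}.
Proof.
move=> cf cg ch U [P PU sPU]; rewrite /= in PU sPU.
have Pf := PU 0 0; have Pg := PU 0 1; have Ph := PU 0 ord_max.
rewrite !row3E in Pf Pg Ph.
have {}cf : \forall b \near a, P 0 0 (f b) by exact: cf.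
have {}cg : \forall b \near a, P 0 1 (g b) by exact: cg.
have {}ch : \forall b \near a, P 0 ord_max (h b) by exact: ch.
suff : \forall b \near a, U (row3 (f b) (g b) (h b)) by [].
apply: filterS3 cf cg ch => b a1 a2 a3; apply: sPU => i j.
by rewrite (ord1 i); case: (ord3_cases j) => ->; rewrite row3E.
Qed.

Lemma continuous_coord q i : {for q, continuous (fun x : pt => x.1 0 i)}.
Proof.
apply: (@continuous_comp _ _ _ fst (fun p : 'rV[R]_3 => p 0 i)); first exact: cvg_fst.
exact: coord_continuous.
Qed.

Lemma continuous_left_mul (B : 'M[R]_2) r k q : polar B r k -> \det B = 1 ->
  AdS_cover_closure q -> {for q, continuous (left_mul B k)}.
Proof.
move=> p d qc; have [a0 _ _] := left_abs_polar p d qc.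
have re0 := left_re_gt0 p d qc.
have c2 : {for q, continuous (fun x : pt => x.2)} by exact: cvg_snd.
have cc (h : R -> R) (g : pt -> R) : continuous h -> {for q, continuous g} ->
    {for q, continuous (fun x : pt => h (g x))}.
  by move=> ch cg; apply: (@continuous_comp _ _ _ g h) => //; apply: ch.
have cD (f g : pt -> R) : {for q, continuous f} -> {for q, continuous g} ->
    {for q, continuous (fun x : pt => f x + g x)} by move=> cf cg; apply: cvgD.
have cB (f g : pt -> R) : {for q, continuous f} -> {for q, continuous g} ->
    {for q, continuous (fun x : pt => f x - g x)} by move=> cf cg; apply: cvgB.
have cM (f g : pt -> R) : {for q, continuous f} -> {for q, continuous g} ->
    {for q, continuous (fun x : pt => f x * g x)} by move=> cf cg; apply: cvgM.
have cst (c : R) : {for q, continuous (fun _ : pt => c)} by exact: cvg_cst.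
have cV (f : pt -> R) : f q != 0 -> {for q, continuous f} ->
    {for q, continuous (fun x : pt => (f x)^-1)} by move=> fn cf; apply: cvgV.
have ceq (f g : pt -> R) : f =1 g -> {for q, continuous f} -> {for q, continuous g}.
  by move=> /funext->.
have ccos2 : {for q, continuous (fun x : pt => cos x.2)}.
  by apply: (cc cos) => //; exact: continuous_cos.
have csin2 : {for q, continuous (fun x : pt => sin x.2)}.
  by apply: (cc sin) => //; exact: continuous_sin.
have cdev i j : {for q, continuous (fun x : pt => dev x i j)}.
  case: (ord2_cases i) => ->; case: (ord2_cases j) => ->.
  - apply: (ceq (fun x : pt => cos x.2 + x.1 0 0)); first by move=> u; rewrite !mxE.
    by apply: (cD) => //; exact: continuous_coord.
  - apply: (ceq (fun x : pt => sin x.2 + x.1 0 1)); first by move=> u; rewrite !mxE.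
    by apply: (cD) => //; exact: continuous_coord.
  - apply: (ceq (fun x : pt => x.1 0 1 - sin x.2)); first by move=> u; rewrite !mxE.
    by apply: (cB) => //; exact: continuous_coord.
  - apply: (ceq (fun x : pt => cos x.2 - x.1 0 0)); first by move=> u; rewrite !mxE.
    by apply: (cB) => //; exact: continuous_coord.
have cN i j : {for q, continuous (fun x : pt => (B *m dev x) i j)}.
  apply: (ceq (fun x : pt => B i 0 * dev x 0 j + B i 1 * dev x 1 j)).
    by move=> u; rewrite mulmx2E.
  by apply: (cD); apply: (cM).
have ck : {for q, continuous (fun x : pt => x.2 + k)} by apply: (cD).
have ccos : {for q, continuous (fun x : pt => cos (x.2 + k))} by apply: (cc cos) => //;
  exact: continuous_cos.
have csin : {for q, continuous (fun x : pt => sin (x.2 + k))} by apply: (cc sin) => //;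
  exact: continuous_sin.
have cre : {for q, continuous (left_re B k)}.
  by apply: (cD); apply: (cM) => //; apply: (cM) => //; [apply: (cD)|apply: (cB)].
have cim : {for q, continuous (left_im B k)}.
  by apply: (cB); apply: (cM) => //; apply: (cM) => //; [apply: (cB)|apply: (cD)].
have carg : {for q, continuous (left_arg B k)}.
  apply: (cc atan); first by move=> t; exact: continuous_atan.
  by apply: (cM) => //; apply: (cV) => //; rewrite gt_eqF.
have cabs : {for q, continuous (fun x : pt => (left_abs B k x)^-1)}.
  apply: (cV); first by rewrite gt_eqF.
  apply: (cM) => //; apply: (cV); last by apply: (cc cos) => //; exact: continuous_cos.
  by rewrite gt_eqF // cos_gt0_pihalf // atan_gtNpi2 atan_ltpi2.
have c1 : {for q, continuous (fun b : pt => (left_mul B k b).1)}.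
  apply: continuous_row3.
  - by apply: (cM) => //; apply: (cM) => //; apply: (cB).
  - by apply: (cM) => //; apply: (cM) => //; apply: (cD).
  - by apply: (cM) => //; exact: continuous_coord.
have c3 : {for q, continuous (fun b : pt => (left_mul B k b).2)} by apply: (cD).
exact: (cvg_pair c1 c3).
Qed.

End LeftTranslation.

(** * Left translations and the coordinates of the boundary *)

Section Translations.
Variable R : realType.
Local Notation pt := ('rV[R]_3 * R)%type.
Implicit Types (q : pt) (F A : PSL2_cover R) (xi ze t k : R).

Lemma cover_lifts F : exists x, lifts x F.
Proof. by case: F => f /= /asboolP. Qed.

Lemma cover_of_lift (x : PSL2 R) (f : circle_lift R) : lifts x f ->
  exists F : PSL2_cover R, F = f :> circle_lift R.
Proof.
move=> h; have fP : f \in @is_PSL2_lift R by apply/asboolP; exists x.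
by exists (MkPSL2Cover fP).
Qed.

Lemma coverP F A : F =1 A -> F = A.
Proof. by move=> h; apply/val_inj/circle_liftP_eq. Qed.

Lemma cover_polar_ex F : exists Z : SL2 R * R * R,
  [/\ lifts (PSL2_of Z.1.1) F, polar Z.1.1 Z.1.2 Z.2,
      forall t, `|F t - (t - Z.2)| < pi / 2
    & forall t, exists c, 0 < c /\ Z.1.1 *m dir t = c *: dir (F t)].
Proof.
have [x [A _ hA]] := cover_lifts F.
have [B [r [k [eB p b d]]]] := lifts_mx_polar hA.
by exists (B, r, k); split => //=; rewrite eB; exact: ofP_lifts.
Qed.

Definition cover_mx F : SL2 R := (sval (cid (cover_polar_ex F))).1.1.
Definition cover_abs F : R := (sval (cid (cover_polar_ex F))).1.2.
Definition cover_arg F : R := (sval (cid (cover_polar_ex F))).2.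

Lemma cover_mxP F : [/\ lifts (PSL2_of (cover_mx F)) F,
    polar (cover_mx F) (cover_abs F) (cover_arg F),
    forall t, `|F t - (t - cover_arg F)| < pi / 2
  & forall t, exists c, 0 < c /\ cover_mx F *m dir t = c *: dir (F t)].
Proof. exact: (svalP (cid (cover_polar_ex F))). Qed.

Definition cover_left F := left_mul (cover_mx F) (cover_arg F).

Lemma AdS_point_pos q A t : AdS_cover q -> AdS_point q A ->
  exists c, 0 < c /\ dev q *m dir t = c *: dir (A t).
Proof.
move=> qo [l b]; have [c c0 e] := l t; exists c; split=> //.
have := polar_dot_gt0 t (det_dev_gt0 qo) (dev_polar q).
rewrite e dotpZ dotp_dir pmulr_lgt0 //.
by apply: cos_gt0_pihalf; rewrite -ltr_norml; exact: b.
Qed.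

Lemma AdS_point_exists q : AdS_cover q -> exists A, AdS_point q A.
Proof.
move=> qo; have dq := det_dev_gt0 qo.
have [f hf] := polar_lift dq (dev_polar q).
have h0 : 0 < height q.1 by case: qo => [[]].
have dB : \det ((height q.1)^-1 *: dev q) == 1.
  by rewrite detZ (det_dev (open_AdS_closure qo)) exprVn mulVf // expf_neq0 // gt_eqF.
have l : lifts_mx (MkSL2 dB) f.
  move=> t; have [_ [c [c0 e]]] := hf t.
  exists ((height q.1)^-1 * c); first by rewrite mulf_neq0 ?invr_neq0 ?gt_eqF.
  by rewrite /= -scalemxAl e scalerA.
have [A eA] := cover_of_lift (ofP_lifts l).
exists A; rewrite /AdS_point eA; split=> [t|t]; last by have [] := hf t.
by have [_ [c [c0 e]]] := hf t; exists c; rewrite // gt_eqF.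
Qed.

(** A lift determines [dev q] up to a factor. The linear parts have modulus 1 and angles less than
    [pi] apart, so the factor is 1; the positive height is then given by the equation of the
    sphere. *)
Lemma AdS_point_inj q q' A : AdS_cover q -> AdS_cover q' ->
  AdS_point q A -> AdS_point q' A -> q = q'.
Proof.
move=> qo qo' [l b] [l' b'].
have d : \det (dev q) != 0 by rewrite gt_eqF // det_dev_gt0.
have [c c0 e] := lifts_mx_par d l l'.
have [_ pu pv] := dev_polar q; have [_ pu' pv'] := dev_polar q'.
have ez i j : dev q' i j = c * dev q i j by rewrite e mxE.
have th : dir q'.2 = c *: dir q.2.
  apply: cv2P; rewrite !mxE /=.
    by move: pu'; rewrite !ez -mulrDr pu; lra.
  by move: pv'; rewrite !ez -mulrBr pv; lra.
have tq : `|q'.2 - q.2| < pi.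
  have := b 0; have := b' 0; rewrite !ltr_norml => /andP[? ?] /andP[? ?].
  by apply/andP; split; lra.
have [n en] := par_dir th.
have n0 : n = 0 by apply: (@intpi_small R); move: tq; rewrite en addrAC subrr add0r.
have e2 : q'.2 = q.2 by rewrite en n0 mul0r addr0.
have c1 : c = 1.
  have : (1 - c) *: dir q.2 = 0 by rewrite scalerBl -th e2 scale1r subrr.
  by move/eqP; rewrite scaler_eq0 (negbTE (dir_neq0 _)) orbF subr_eq0 => /eqP.
have p0 : q'.1 0 0 = q.1 0 0.
  by have := ez 0 0; rewrite c1 mul1r !mxE /= e2 => /addrI.
have p1 : q'.1 0 1 = q.1 0 1.
  by have := ez 0 1; rewrite c1 mul1r !mxE /= e2 => /addrI.
have p2 : q'.1 0 ord_max = q.1 0 ord_max.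
  case: qo => [[s h] _]; case: qo' => [[s' h'] _].
  move: s s'; rewrite !dot3E p0 p1 => s s'.
  have : q'.1 0 ord_max ^+ 2 = q.1 0 ord_max ^+ 2 by lra.
  by move/eqP; rewrite eqrXn2 ?ltW // => /eqP.
by apply/esym; case: q q' e2 p0 p1 p2 {qo qo' l b l' b' d e ez th tq en pu pv pu' pv'} =>
  [p a] [p' a'] /= -> ? ? ?; congr pair; exact: rV3P.
Qed.

Lemma dev00 q : dev q 0 0 = cos q.2 + q.1 0 0.
Proof. by rewrite mxE. Qed.

Lemma dev01 q : dev q 0 1 = sin q.2 + q.1 0 1.
Proof. by rewrite mxE. Qed.

Lemma cover_left_closure F q : AdS_cover_closure q -> AdS_cover_closure (cover_left F q).
Proof.
by have [_ p _ _] := cover_mxP F; exact: (left_mul_closure p (det_SL2 _)).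
Qed.

Lemma cover_left_AdS F q : AdS_cover q -> AdS_cover (cover_left F q).
Proof.
by have [_ p _ _] := cover_mxP F; exact: (left_mul_AdS p (det_SL2 _)).
Qed.

Lemma continuous_cover_left F q : AdS_cover_closure q ->
  {for q, continuous (cover_left F)}.
Proof.
by have [_ p _ _] := cover_mxP F; exact: (continuous_left_mul p (det_SL2 _)).
Qed.

Lemma cover_left_AdS_point F q A : AdS_cover q -> AdS_point q A ->
  AdS_point (cover_left F q) (F * A)%g.
Proof.
move=> qo hA; have qc := open_AdS_closure qo.
have [_ p b d] := cover_mxP F.
have ld := left_mul_dev p (det_SL2 _) qc.
have [a0 ab pol] := left_abs_polar p (det_SL2 _) qc.
have E t : exists c, 0 < c /\ dev (cover_left F q) *m dir t = c *: dir ((F * A)%g t).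
  have [c [c0 e]] := AdS_point_pos t qo hA; have [c' [c'0 e']] := d (A t).
  exists ((left_abs (cover_mx F) (cover_arg F) q)^-1 * c * c'); split.
    by rewrite !mulr_gt0 // invr_gt0.
  by rewrite ld -scalemxAl -mulmxA e -scalemxAr e' !scalerA.
split=> t.
  by have [c [c0 e]] := E t; exists c => //; rewrite gt_eqF.
have [c [c0 e]] := E t.
(* The three angular errors, of [F], of [A] and of [left_arg], only add up to [3 * pi / 2];
   positivity of the cosine brings the bound back to [pi / 2]. *)
apply: cos_gt0_small.
  have qo' : AdS_cover (cover_left F q) by exact: cover_left_AdS.
  have := polar_dot_gt0 t (det_dev_gt0 qo') (dev_polar _).
  by rewrite e dotpZ dotp_dir pmulr_rgt0.
have [_ b'] := hA.
move: (b (A t)) (b' t) ab; rewrite !ltr_norml /= => /andP[? ?] /andP[? ?] /andP[? ?].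
by have p0 := @pi_gt0 R; apply/andP; split; rewrite ?[(F * A)%g t]/(F (A t)); lra.
Qed.

(* [dev (ein xi ze)] has image spanned by [dir xi] and kernel spanned by [dir ze]. *)
Definition ein xi ze : pt := (row3 (sin (xi + ze)) (- cos (xi + ze)) 0, ze - xi - pi / 2).

Lemma ein_cover xi ze : Ein_cover (ein xi ze).
Proof.
split=> //; split; rewrite /= ?dot3E /height row3E // row3E.
by rewrite !row3E mulr0 addr0 mulrNN -!expr2 addrC cos2Dsin2.
Qed.

Lemma dev_ein xi ze t : dev (ein xi ze) *m dir t = (2 * sin (ze - t)) *: dir xi.
Proof.
by apply: cv2P; rewrite mulmx2E !mxE /= ?cosBpihalf ?sinBpihalf cosB !sinB sinD cosD; ring.
Qed.

Lemma ein_addz (n : int) xi ze : ein (xi + n%:~R * pi) (ze + n%:~R * pi) = ein xi ze.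
Proof.
have e : xi + n%:~R * pi + (ze + n%:~R * pi) = xi + ze + n%:~R * pi + n%:~R * pi by ring.
have d : dir (xi + ze + n%:~R * pi + n%:~R * pi) = dir (xi + ze).
  by rewrite !dir_addz scalerA -expr2 sqrr_sign scale1r.
have c : cos (xi + ze + n%:~R * pi + n%:~R * pi) = cos (xi + ze) by rewrite -!dirE0 d.
have s : sin (xi + ze + n%:~R * pi + n%:~R * pi) = sin (xi + ze) by rewrite -!dirE1 d.
by rewrite /ein e c s; congr pair; ring.
Qed.

(** The sum of the coordinates is known modulo [2 * pi] and their difference exactly. *)
Lemma ein_inj xi ze xi' ze' : ein xi ze = ein xi' ze' ->
  exists n : int, xi' = xi + n%:~R * pi /\ ze' = ze + n%:~R * pi.
Proof.
move=> [/matrixP e1 e2].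
have s := e1 0 0; have c := e1 0 1; rewrite !row3E in s c.
have d : dir (xi' + ze') = 1 *: dir (xi + ze).
  by rewrite scale1r; apply: cv2P; rewrite !mxE /= ?s //; apply: oppr_inj.
have [k ek] := par_dir d.
have ezx : ze' - xi' = ze - xi by move: e2 => /addIr.
have p0 := @pi_gt0 R.
have : exists n : int, k = n * 2.
  move: d; rewrite ek dir_addz -signr_odd; case: (boolP (odd _)) => o.
    rewrite expr1 => h.
    have : ((-1) - 1 : R) *: dir (xi + ze) = 0 by rewrite scalerBl h subrr.
    by move/eqP; rewrite scaler_eq0 (negbTE (dir_neq0 _)) orbF => /eqP; lra.
  by move=> _; exists (k %/ 2)%Z; move: o; lia.
move=> [n en]; exists n; rewrite en intrM in ek.
by split; lra.
Qed.

Lemma ein_surj q : Ein_cover q -> exists xi ze, q = ein xi ze.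
Proof.
move=> [[s h] _].
pose v : 'cV[R]_2 := \col_i (if i == 0 then - q.1 0 1 else q.1 0 0).
have h' : q.1 0 ord_max = 0 by exact: h.
rewrite dot3E h' mulr0 addr0 in s.
have v0 : v != 0.
  apply/eqP => e; have := congr1 (fun w : 'cV[R]_2 => w 0 0) e.
  have := congr1 (fun w : 'cV[R]_2 => w 1 0) e; rewrite !mxE /= => a.
  by move/eqP; rewrite oppr_eq0 => /eqP b; move: s; rewrite a b; lra.
have [a [c [c0 e]]] := nonzero_dir v0.
have e0 := congr1 (fun w : 'cV[R]_2 => w 0 0) e.
have e1 := congr1 (fun w : 'cV[R]_2 => w 1 0) e; rewrite !mxE /= in e0 e1.
have c1 : c = 1.
  have t := cos2Dsin2 a.
  have : c ^+ 2 = 1.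
    rewrite -s e1; have -> : q.1 0 1 = - (c * cos a) by rewrite -e0 opprK.
    by rewrite -[LHS]mulr1 -t; ring.
  by move/eqP; rewrite sqrf_eq1 => /orP[] /eqP // cN; move: c0; rewrite cN; lra.
rewrite c1 !mul1r in e0 e1.
exists ((a - (q.2 + pi / 2)) / 2), ((a + (q.2 + pi / 2)) / 2).
have -> : q = (q.1, q.2) by case: (q).
congr pair; last by field.
have -> : (a - (q.2 + pi / 2)) / 2 + (a + (q.2 + pi / 2)) / 2 = a by field.
by apply: rV3P; rewrite row3E // -e0 opprK.
Qed.

(** Left multiplication moves the image of a rank one matrix and keeps its kernel. The two matrices
    are thus positively proportional, and equal because their linear parts have modulus 1. *)
Lemma cover_left_ein F xi ze : cover_left F (ein xi ze) = ein (F xi) ze.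
Proof.
have [_ p b d] := cover_mxP F.
have qc := Ein_AdS_closure (ein_cover xi ze).
have ld := left_mul_dev p (det_SL2 _) qc; rewrite -/(cover_left F _) in ld.
have [a0 ab pol] := left_abs_polar p (det_SL2 _) qc.
set a := left_abs _ _ _ in ld a0 pol.
have [c [c0 e]] := d xi.
have E : dev (cover_left F (ein xi ze)) = (a^-1 * c) *: dev (ein (F xi) ze).
  have H t : dev (cover_left F (ein xi ze)) *m dir t =
      ((a^-1 * c) *: dev (ein (F xi) ze)) *m dir t.
    rewrite ld -!scalemxAl -mulmxA !dev_ein -scalemxAr e !scalerA; congr (_ *: _); ring.
  have H0 := H 0; have H1 := H (pi / 2).
  have col (i : 'I_2) (K : 'M[R]_2) :
      (K *m dir 0) i 0 = K i 0 /\ (K *m dir (pi / 2)) i 0 = K i 1.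
    by rewrite !mulmx2E !mxE /= cos0 sin0 cos_pihalf sin_pihalf; split; ring.
  have G i (K K' : 'M[R]_2) : K *m dir 0 = K' *m dir 0 ->
      K *m dir (pi / 2) = K' *m dir (pi / 2) -> K i 0 = K' i 0 /\ K i 1 = K' i 1.
    by move=> h1 h2; have [<- <-] := col i K; have [<- <-] := col i K'; rewrite h1 h2.
  by have [? ?] := G 0 _ _ H0 H1; have [? ?] := G 1 _ _ H0 H1; apply: mx2P.
have x0 : 0 < a^-1 * c by rewrite mulr_gt0 // invr_gt0.
have [_ pu pv] := dev_polar (cover_left F (ein xi ze)).
have [_ pu' pv'] := dev_polar (ein (F xi) ze).
have ez i j : dev (cover_left F (ein xi ze)) i j = (a^-1 * c) * dev (ein (F xi) ze) i j.
  by rewrite E mxE.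
have th : dir (cover_left F (ein xi ze)).2 = (a^-1 * c) *: dir (ein (F xi) ze).2.
  apply: cv2P; rewrite !mxE.
    by rewrite /=; move: pu; rewrite !ez -mulrDr pu'; lra.
  by rewrite /=; move: pv; rewrite !ez -mulrBr pv'; lra.
have x1 : a^-1 * c = 1.
  by have [->//|xN] := dir_eq_cos th; move: x0; rewrite xN oppr_gt0 ltNge ler01.
have [n en] := par_dir th.
have e2 : (cover_left F (ein xi ze)).2 = (ein (F xi) ze).2.
  (* The two time coordinates differ by the errors of [F] at [xi] and of [left_arg], each below
     [pi / 2]. *)
  have n0 : n = 0.
    apply: (@intpi_small R).
    have -> : n%:~R * pi = (cover_left F (ein xi ze)).2 - (ein (F xi) ze).2.
      by rewrite en addrAC subrr add0r.
    have := b xi; move: ab; rewrite /cover_left /left_mul /= !ltr_norml.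
    by move=> /andP[? ?] /andP[? ?]; apply/andP; split; lra.
  by rewrite en n0 mul0r addr0.
have {}e1 : (cover_left F (ein xi ze)).1 = (ein (F xi) ze).1.
  apply: rV3P.
  - by have := ez 0 0; rewrite x1 mul1r !dev00 e2 => /addrI.
  - by have := ez 0 1; rewrite x1 mul1r !dev01 e2 => /addrI.
  - by rewrite /cover_left /left_mul /= !row3E /height row3E mul0r.
by rewrite [LHS]surjective_pairing e1 e2.
Qed.

End Translations.

(** * Two-sided translations and their extension to the boundary *)

Section BoundaryAction.
Variable R : realType.
Local Notation pt := ('rV[R]_3 * R)%type.
Implicit Types (q : pt) (A : PSL2_cover R) (F : PSL2_cover R * PSL2_cover R) (xi ze t : R).

(** Inversion of the group: [dev (inv_pt q)] is the adjugate of [dev q]. It conjugates right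
    translations to left ones, so one explicit formula serves both sides. *)
Definition inv_pt q : pt := (row3 (- q.1 0 0) (- q.1 0 1) (q.1 0 ord_max), - q.2).

Lemma inv_pt_sphere q : dot3 (inv_pt q).1 (inv_pt q).1 = dot3 q.1 q.1.
Proof. by rewrite !dot3E !row3E !mulrNN. Qed.

Lemma inv_pt_height q : height (inv_pt q).1 = height q.1.
Proof. by rewrite /height row3E. Qed.

Lemma inv_pt_closure q : AdS_cover_closure q -> AdS_cover_closure (inv_pt q).
Proof.
by move=> [[s h] _]; split=> //; split; rewrite ?inv_pt_sphere ?inv_pt_height.
Qed.

Lemma inv_pt_AdS q : AdS_cover q -> AdS_cover (inv_pt q).
Proof.
by move=> [[s h] _]; split=> //; split; rewrite ?inv_pt_sphere ?inv_pt_height.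
Qed.

Lemma continuous_inv_pt q : {for q, continuous inv_pt}.
Proof.
have c1 : {for q, continuous (fun b : pt => (inv_pt b).1)}.
  by apply: continuous_row3; try apply: cvgN; exact: continuous_coord.
have c2 : {for q, continuous (fun b : pt => (inv_pt b).2)}.
  by apply: cvgN; exact: cvg_snd.
exact: (cvg_pair c1 c2).
Qed.

Lemma dev_inv_pt q : AdS_cover_closure q ->
  dev (inv_pt q) *m dev q = (height q.1 ^+ 2)%:M.
Proof.
move=> qc; rewrite -(det_dev qc) det_mx22.
apply: mx2P; rewrite !mulmx2E !mxE /= ?row3E cosN sinN.
by split; ring.
Qed.

Lemma inv_pt_AdS_point q A : AdS_cover q -> AdS_point q A -> AdS_point (inv_pt q) A^-1%g.
Proof.
move=> qo [l b]; have h0 : 0 < height q.1 by case: qo => [[]].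
have E (s : R) : A ((A^-1)%g s) = s by exact: circle_lift_mulEV.
split=> s.
  have [c c0 e] := l ((A^-1)%g s); rewrite E in e.
  exists (c^-1 * height q.1 ^+ 2).
    by rewrite mulf_neq0 ?invr_neq0 // expf_neq0 // gt_eqF.
  rewrite -[dir s]scale1r -(mulVf c0) -scalerA -e -scalemxAr mulmxA.
  by rewrite dev_inv_pt ?mul_scalar_mx ?scalerA //; exact: open_AdS_closure.
have := b ((A^-1)%g s); rewrite E -normrN; congr (`|_| < _).
by rewrite /inv_pt /=; ring.
Qed.

(** The adjugate of a rank one matrix has image and kernel exchanged; the [pi] makes the time
    coordinate change sign. *)
Lemma inv_pt_ein xi ze : inv_pt (ein xi ze) = ein ze (xi + pi).
Proof.
have e : ze + (xi + pi) = xi + ze + pi by ring.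
by rewrite /inv_pt /ein /= !row3E e cosDpi sinDpi opprK; congr pair; field.
Qed.

Definition translate F q := inv_pt (cover_left F.2 (inv_pt (cover_left F.1 q))).

Lemma ein_addpi xi ze : ein (xi + pi) (ze + pi) = ein xi ze.
Proof. by have := ein_addz 1 xi ze; rewrite -[1%:~R]/(1 : R) !mul1r. Qed.

Lemma translate_ein F xi ze : translate F (ein xi ze) = ein (F.1 xi) (F.2 ze).
Proof.
by rewrite /translate cover_left_ein inv_pt_ein cover_left_ein inv_pt_ein ein_addpi.
Qed.

Lemma translate_AdS F q : AdS_cover q -> AdS_cover (translate F q).
Proof.
by move=> qo; apply/inv_pt_AdS/cover_left_AdS/inv_pt_AdS/cover_left_AdS.
Qed.

Lemma translate_AdS_point F q A : AdS_cover q -> AdS_point q A ->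
  AdS_point (translate F q) (F.1 * A * F.2^-1)%g.
Proof.
move=> qo h.
have -> : (F.1 * A * F.2^-1 = (F.2 * (F.1 * A)^-1)^-1)%g by rewrite invgM invgK.
have h1 := cover_left_AdS_point F.1 qo h.
have o1 := cover_left_AdS F.1 qo.
have h2 := inv_pt_AdS_point o1 h1; have o2 := inv_pt_AdS o1.
have h3 := cover_left_AdS_point F.2 o2 h2; have o3 := cover_left_AdS F.2 o2.
exact: inv_pt_AdS_point o3 h3.
Qed.

Lemma continuous_translate F q : AdS_cover_closure q -> {for q, continuous (translate F)}.
Proof.
move=> qc.
have c1 : {for q, continuous (cover_left F.1)} by exact: continuous_cover_left.
have q1 := cover_left_closure F.1 qc.
have c2 : {for q, continuous (inv_pt \o cover_left F.1)}.
  by apply: continuous_comp => //; exact: continuous_inv_pt.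
have q2 := inv_pt_closure q1.
have c3 : {for q, continuous (cover_left F.2 \o (inv_pt \o cover_left F.1))}.
  by apply: continuous_comp => //; exact: continuous_cover_left.
by apply: (@continuous_comp _ _ _ _ inv_pt _ c3); exact: continuous_inv_pt.
Qed.

Lemma translate_extends F : extends_translation F (translate F).
Proof.
split.
  by apply: continuous_in_subspaceT => q /set_mem qc; exact: continuous_translate.
move=> q qo; have [A hA] := AdS_point_exists qo; exists A; split=> //.
  exact: translate_AdS.
exact: translate_AdS_point.
Qed.

Lemma extends_translation_AdS F Phi q : extends_translation F Phi -> AdS_cover q ->
  Phi q = translate F q.
Proof.
move=> [_ h] qo; have [A [h1 h2 h3]] := h q qo.
apply: AdS_point_inj h2 _ h3 _; first exact: translate_AdS.
exact: translate_AdS_point.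
Qed.

Lemma radial_approach q : Ein_cover q -> exists g : R -> pt,
  [/\ g 1 = q, {for 1, continuous g} & forall s, 0 < s < 1 -> AdS_cover (g s)].
Proof.
move=> [[s0 h0] _]; have h' : q.1 0 ord_max = 0 by exact: h0.
exists (fun s => (row3 (s * q.1 0 0) (s * q.1 0 1) (Num.sqrt (1 - s ^+ 2)), q.2)); split.
- rewrite [RHS]surjective_pairing; congr pair; apply: rV3P; rewrite row3E ?mul1r //.
  by rewrite expr1n subrr sqrtr0 h'.
- have cid1 : {for 1 : R, continuous (fun s : R => s)} by exact: cvg_id.
  have c1 : {for 1 : R, continuous (fun s : R =>
      row3 (s * q.1 0 0) (s * q.1 0 1) (Num.sqrt (1 - s ^+ 2)))}.
    apply: continuous_row3; try by apply: cvgM; [exact: cid1|exact: cvg_cst].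
    apply: (@continuous_comp _ _ _ (fun s : R => 1 - s ^+ 2) Num.sqrt); last exact: sqrt_continuous.
    by apply: cvgB; [exact: cvg_cst|apply: cvgM; exact: cid1].
  have c2 : {for 1 : R, continuous (fun=> q.2)} by exact: cvg_cst.
  exact: (cvg_pair c1 c2).
- move=> s /andP[sp s1].
  have s2 : 0 < 1 - s ^+ 2 by rewrite subr_gt0 expr_lt1 // ltW.
  split=> //; split; last by rewrite /height row3E sqrtr_gt0.
  rewrite dot3E !row3E -[Num.sqrt _ * _]expr2 sqr_sqrtr ?(ltW s2) //.
  move: s0; rewrite dot3E h' mulr0 addr0 => s0.
  transitivity (s ^+ 2 * (q.1 0 0 * q.1 0 0 + q.1 0 1 * q.1 0 1) + (1 - s ^+ 2)); first by ring.
  by rewrite s0; ring.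
Qed.

(** [Phi] is prescribed only in the interior, where it agrees with [translate F]. Both are
    continuous along a radial path ending at the boundary point, and limits are unique. *)
Lemma extends_translation_ein F Phi xi ze : extends_translation F Phi ->
  Phi (ein xi ze) = ein (F.1 xi) (F.2 ze).
Proof.
move=> hF; have [cP _] := hF; rewrite -translate_ein.
have qe := ein_cover xi ze; have qc := Ein_AdS_closure qe.
have [g [g1 cg go]] := radial_approach qe.
have gc : g s @[s --> 1^'-] --> nbhs (ein xi ze).
  by rewrite -g1; apply: cvg_at_left_filter; exact: cg.
have near_go : \forall s \near 1^'-, AdS_cover (g s).
  near=> s; apply: go; apply/andP; split; near: s.
    by apply: nbhs_left_gt; rewrite ltr01.
  exact: nbhs_left_lt.
have cPq : Phi x @[x --> within (@AdS_cover_closure R) (nbhs (ein xi ze))] --> Phi (ein xi ze).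
  by move/subspace_continuousP: cP; apply.
have l1 : Phi (g s) @[s --> 1^'-] --> Phi (ein xi ze).
  apply: cvg_comp cPq => U UU; have := gc _ UU => /= H.
  have H' : \forall s \near 1^'-, AdS_cover_closure (g s) -> U (g s) by exact: H.
  suff : \forall s \near 1^'-, U (g s) by [].
  by apply: filterS2 H' near_go => s h1 h2; apply: h1; exact: open_AdS_closure.
have l2 : translate F (g s) @[s --> 1^'-] --> translate F (ein xi ze).
  by apply: cvg_comp gc _; exact: continuous_translate.
have l2' : Phi (g s) @[s --> 1^'-] --> translate F (ein xi ze).
  apply: cvg_trans l2; apply: near_eq_cvg.
  by apply: filterS near_go => s h; rewrite (extends_translation_AdS hF h).
exact: (cvg_unique (@norm_hausdorff _ pt) l1 l2').
Unshelve. all: by end_near. Qed.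

End BoundaryAction.

(** * Achronal sets as monotone curves *)

Section AchronalCurves.
Variable R : realType.
Local Notation pt := ('rV[R]_3 * R)%type.
Implicit Types (L : set pt) (D : set (R * R)) (q r : pt) (z w : R * R) (n : int).

(* In the coordinates of [ein], achronality becomes monotonicity, and [mc_jump] says
   that there are no opposite points. *)
Record monotone_curve D : Prop := MonotoneCurve {
  mc_closed : closed D;
  mc_addz : forall n x y, D (x, y) -> D (x + n%:~R * pi, y + n%:~R * pi);
  mc_mono : forall x y x' y', D (x, y) -> D (x', y') -> x < x' -> y <= y';
  mc_jump : forall x y, D (x, y) -> D (x, y + pi) -> False }.

Definition chart L : set (R * R) := [set z | L (ein z.1 z.2)].
Definition cochart D : set pt := [set q | exists2 z, D z & q = ein z.1 z.2].

Lemma sphere_dist_ein (x y x' y' : R) :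
  sphere_dist (ein x y).1 (ein x' y').1 = acos (cos (x' + y' - (x + y))).
Proof.
by rewrite /sphere_dist dot3E !row3E cosB; congr acos; ring.
Qed.

Lemma acos_cos_norm (t : R) : `|t| <= pi -> acos (cos t) = `|t|.
Proof.
move=> h; rewrite -cos_norm cosK // in_itv /= normr_ge0 //.
Qed.

Lemma acos_cos_le (t : R) : acos (cos t) <= `|t|.
Proof.
have [h|h] := leP `|t| pi; first by rewrite acos_cos_norm.
by apply: le_trans (ltW h); apply: acos_lepi; rewrite cos_geN1 cos_le1.
Qed.

Lemma mod_2pi (t : R) : exists n, `|t - 2 * (n%:~R * pi)| <= pi.
Proof.
have [n /andP[h1 h2]] := mod_pi ((t + pi) / 2); exists n.
by rewrite ler_norml; apply/andP; split; lra.
Qed.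

Lemma continuous_ein : continuous (fun z : R * R => ein z.1 z.2).
Proof.
move=> z.
have cs (h : R -> R) : continuous h -> {for z, continuous (fun w : R * R => h (w.1 + w.2))}.
  move=> ch; apply: (@continuous_comp _ _ _ (fun w : R * R => w.1 + w.2) h); last exact: ch.
  by apply: cvgD; [exact: cvg_fst|exact: cvg_snd].
have c1 : {for z, continuous (fun w : R * R => (ein w.1 w.2).1)}.
  apply: continuous_row3; last exact: cvg_cst.
    exact: (cs sin (@continuous_sin R)).
  by apply: cvgN; exact: (cs cos (@continuous_cos R)).
have c2 : {for z, continuous (fun w : R * R => (ein w.1 w.2).2)}.
  apply: cvgB; last exact: cvg_cst.
  by apply: cvgB; [exact: cvg_snd|exact: cvg_fst].
exact: (cvg_pair c1 c2).
Qed.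

Lemma chart_addz L n (x y : R) : chart L (x, y) -> chart L (x + n%:~R * pi, y + n%:~R * pi).
Proof. by rewrite /chart /= ein_addz. Qed.

(** Time differences are differences of [ze - xi], and distances are at most those of [xi + ze].
    Coordinates moving in opposite directions would make the former strictly larger. *)
Lemma achronal_mono L (x y x' y' : R) : achronal L -> chart L (x, y) -> chart L (x', y') ->
  x < x' -> y <= y'.
Proof.
move=> aL h h' xx; rewrite leNgt; apply/negP => yy.
have := aL _ _ h h'; rewrite sphere_dist_ein /= => l.
have {l} := le_trans l (acos_cos_le _).
rewrite ler_norml; set t := x' + y' - (x + y) => /andP[_ l].
have : `|t| < y - x - (y' - x') by rewrite ltr_norml /t; apply/andP; split; lra.
by lra.
Qed.

Lemma acos_cos_gt_pi (t : R) : pi <= t <= 2 * pi -> acos (cos t) = 2 * pi - t.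
Proof.
move=> /andP[h1 h2].
have -> : cos t = cos (2 * pi - t).
  have -> : 2 * pi - t = - (t - pi - pi) by ring.
  by rewrite cosN -[t in LHS](subrK pi) cosDpi -[X in - cos X](subrK pi) cosDpi opprK.
by rewrite cosK // in_itv /=; apply/andP; split; lra.
Qed.

Lemma ein_opp (x y : R) : (ein x (y + pi)).1 = - (ein x y).1.
Proof.
by apply: rV3P; rewrite [RHS]mxE !row3E ?(addrA x y pi) ?sinDpi ?cosDpi ?oppr0.
Qed.

Lemma lightlike_jump L (x y : R) : L `<=` @Ein_cover R -> achronal L ->
  chart L (x, y) -> chart L (x, y + pi) -> pure_lightlike L.
Proof.
move=> LE aL h0 h1; have p0 := @pi_gt0 R.
have fut r : L r -> r.2 - (ein x y).2 = sphere_dist (ein x y).1 r.1.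
  move=> Lr; have [x' [y' er]] := ein_surj (LE _ Lr).
  have [n /andP[n0 n1]] := mod_pi (x' - x).
  pose xn := x' + (- n)%:~R * pi; pose yn := y' + (- n)%:~R * pi.
  have er' : r = ein xn yn by rewrite er ein_addz.
  have Dn : chart L (xn, yn) by rewrite /chart /= -er'.
  rewrite er' sphere_dist_ein /=.
  have xn0 : x <= xn by rewrite /xn mulrNz; lra.
  have xn1 : xn < x + pi by rewrite /xn mulrNz; lra.
  have hp : chart L (x + pi, y + pi) by rewrite /chart /= ein_addpi.
  have u : yn <= y + pi by exact: (achronal_mono aL Dn hp).
  (* Monotonicity squeezes the point onto the vertical segment over [x] or the horizontal one at
     height [y + pi]: the two lightlike segments joining the opposite points. *)
  move: xn0; rewrite le_eqVlt => /predU1P[exn|xn0].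
    have hm : chart L (x - pi, y).
      by rewrite /chart /= -ein_addpi subrK.
    have l : y <= yn by apply: (achronal_mono aL hm Dn); lra.
    have p : 0 <= xn + yn - (x + y) by lra.
    by rewrite acos_cos_norm ger0_norm //; lra.
  have l : y + pi <= yn by exact: (achronal_mono aL h1 Dn).
  by rewrite acos_cos_gt_pi; [|apply/andP; split]; lra.
exists (ein x y), (ein x (y + pi)); split => //.
- by split; [exact: ein_opp|rewrite /=; ring].
- by move=> r Lr; split; [exact: LE|exact: fut].
- move=> r Lr; split; first exact: LE.
  rewrite ein_opp /sphere_dist.
  have -> : dot3 (- (ein x y).1) r.1 = - dot3 (ein x y).1 r.1.
    have oppv (p : 'rV[R]_3) i : (- p) 0 i = - p 0 i by rewrite mxE.
    by rewrite !dot3E !oppv; ring.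
  have [x' [y' er]] := ein_surj (LE _ Lr).
  rewrite acosN; last first.
    rewrite er dot3E !row3E -[X in X + 0 * 0]/(_ + _).
    have -> : sin (x + y) * sin (x' + y') + - cos (x + y) * - cos (x' + y') + 0 * 0 = cos (x + y
        - (x' + y')) by rewrite cosB; ring.
    by rewrite cos_geN1 cos_le1.
  by rewrite -/(sphere_dist _ _) -(fut _ Lr) /=; ring.
Qed.

Lemma chart_curve L : L `<=` @Ein_cover R -> closed L -> achronal L -> generic L ->
  monotone_curve (chart L).
Proof.
move=> LE cL aL gL; split.
- apply: (@closed_comp _ _ (fun z : R * R => ein z.1 z.2)) => // z _.
  exact: continuous_ein.
- by move=> n x y; exact: chart_addz.
- by move=> x y x' y'; exact: achronal_mono.
- by move=> x y h h'; apply: gL; exact: lightlike_jump h h'.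
Qed.

Lemma chart_preserves L (F : PSL2_cover R * PSL2_cover R) Phi : L `<=` @Ein_cover R ->
  extends_translation F Phi -> Phi @` L = L ->
  forall x y, chart L (F.1 x, F.2 y) <-> chart L (x, y).
Proof.
move=> LE hF hL x y; rewrite /chart /=; split=> [|h]; last first.
  by rewrite -hL -(extends_translation_ein x y hF); exists (ein x y).
rewrite -{1}hL => -[q Lq]; have [x' [y' eq]] := ein_surj (LE _ Lq).
rewrite eq (extends_translation_ein _ _ hF) => /ein_inj[n [e1 e2]].
move: e1 e2; rewrite -!circle_lift_addz => /circle_lift_inj -> /circle_lift_inj ->.
by rewrite ein_addz -eq.
Qed.

(** [ein] is a covering of [Ein_cover] whose deck group preserves [D]. A section [s] near the limit
    point is built from an arctangent; it returns preimages of nearby points up to a common turn,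
    which [mc_addz] absorbs. *)
Lemma cochart_closed D : monotone_curve D -> closed (cochart D).
Proof.
move=> mD q qcl.
have cE : closed (@Ein_cover R).
  have -> : @Ein_cover R = (fun q : pt => dot3 q.1 q.1) @^-1` [set 1] `&`
      (fun q : pt => q.1 0 ord_max) @^-1` [set 0].
    by apply/seteqP; split=> [r [[? ?] _]|r [? ?]].
  have cdot (r : pt) : {for r, continuous (fun s : pt => dot3 s.1 s.1)}.
    have -> : (fun s : pt => dot3 s.1 s.1) = (fun s : pt =>
        s.1 0 0 * s.1 0 0 + s.1 0 1 * s.1 0 1 + s.1 0 ord_max * s.1 0 ord_max).
      by apply/funext => s; rewrite dot3E.
    by apply: cvgD; [apply: cvgD|]; apply: cvgM; exact: continuous_coord.
  apply: closedI; apply: closed_comp; try exact: closed_eq.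
    by move=> r _; exact: cdot.
  by move=> r _; exact: continuous_coord.
have qE : Ein_cover q.
  apply: cE; apply: closureS qcl => r [z _ ->]; exact: ein_cover.
have [x [y eq]] := ein_surj qE.
pose a0 := x + y.
pose v (r : pt) : 'cV[R]_2 := \col_i (if i == 0 then - r.1 0 1 else r.1 0 0).
pose re r := - r.1 0 1 * cos a0 + r.1 0 0 * sin a0.
pose im r := r.1 0 0 * cos a0 - (- r.1 0 1) * sin a0.
pose al r := a0 + atan (im r / re r).
pose s r : R * R := ((al r - (r.2 + pi / 2)) / 2, (al r + (r.2 + pi / 2)) / 2).
have req : re q = 1.
  by rewrite /re eq /= !row3E opprK -/a0 -!expr2 cos2Dsin2.
have imq : im q = 0 by rewrite /im eq /= !row3E -/a0; ring.
have sq : s q = (x, y).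
  by rewrite /s /al imq mul0r atan0 addr0 eq /= /a0; congr pair; field.
have cre : {for q, continuous re}.
  by apply: cvgD; apply: cvgM; try exact: cvg_cst; try apply: cvgN; exact: continuous_coord.
have cim : {for q, continuous im}.
  by apply: cvgB; apply: cvgM; try exact: cvg_cst; try apply: cvgN; exact: continuous_coord.
have cal : {for q, continuous al}.
  apply: cvgD; first exact: cvg_cst.
  apply: (@continuous_comp _ _ _ (fun r => im r / re r) atan); last exact: continuous_atan.
  by apply: cvgM; [exact: cim|apply: cvgV; [rewrite req oner_eq0|exact: cre]].
have c2 : {for q, continuous (fun r : pt => r.2 + pi / 2)}.
  by apply: cvgD; [exact: cvg_snd|exact: cvg_cst].
have cs1 : {for q, continuous (fun r => (s r).1)}.
  by apply: cvgM; [apply: cvgB|exact: cvg_cst].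
have cs2 : {for q, continuous (fun r => (s r).2)}.
  by apply: cvgM; [apply: cvgD|exact: cvg_cst].
have cs : {for q, continuous s} by exact: (cvg_pair cs1 cs2).
have sE r : Ein_cover r -> 0 < re r -> ein (s r).1 (s r).2 = r.
  move=> rE rp.
  have e1 : dotp (dir a0) (v r) = re r by rewrite /dotp /re !mxE /=; ring.
  have e2 : cross (dir a0) (v r) = im r by rewrite /cross /im !mxE /=; ring.
  have [c [c0 h1 h2]] := atan_polar (im r) rp.
  have hv : v r = c *: dir (al r) by apply: dir_of_frame; rewrite ?e1 ?e2.
  have [x' [y' er]] := ein_surj rE.
  have hv' : v r = dir (x' + y').
    by rewrite er; apply: cv2P; rewrite !mxE /= ?mxE /= ?opprK.
  have c1 : c = 1.
    by case: (dir_eq_cos (etrans (esym hv') hv)) => // cN; move: c0; rewrite cN; lra.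
  rewrite c1 scale1r in hv.
  have -> : ein (s r).1 (s r).2 = (row3 (sin (al r)) (- cos (al r)) 0, r.2).
    have e : (s r).1 + (s r).2 = al r by rewrite /s /=; field.
    by rewrite /ein e /s /=; congr pair; field.
  rewrite [RHS]surjective_pairing; congr pair.
  have ec : cos (al r) = - r.1 0 1 by rewrite -dirE0 -hv mxE.
  have es : sin (al r) = r.1 0 0 by rewrite -dirE1 -hv mxE.
  apply: rV3P; rewrite row3E ?ec ?es ?opprK //.
  by case: rE => [[_ h] _]; rewrite -[RHS]/(height r.1) h.
exists (x, y) => //; apply: (mc_closed mD) => U; rewrite -sq => nU.
have nre : nbhs q [set r | 0 < re r].
  have : nbhs (re q) [set t : R | 0 < t] 
    by apply: open_nbhs_nbhs; split; [exact: open_gt|rewrite /= req].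
  exact: cre.
have nsU : nbhs q [set r | U (s r)] by exact: cs.
have [r [[z Dz er] [Ur rp]]] := qcl _ (filterI nsU nre).
exists (s r); split => //.
have rE : Ein_cover r by rewrite er; exact: ein_cover.
have [n [e1 e2]] := ein_inj (etrans (esym er) (esym (sE r rE rp))).
rewrite [s r]surjective_pairing e1 e2; apply: (mc_addz mD).
by rewrite -surjective_pairing.
Qed.

Lemma cochart_achronal D : monotone_curve D -> achronal (cochart D).
Proof.
move=> mD q r [[x y] Dz ->] [[x' y'] Dw ->];
  rewrite [(x, y).1]/= [(x', y').1]/= [(x, y).2]/= [(x', y').2]/=.
(* A turn brings the coordinate sums within [pi] of each other, so that the spherical distance is
   the absolute value of their difference. *)
have [n hn] := mod_2pi (x' + y' - (x + y)).
pose xn := x' + (- n)%:~R * pi; pose yn := y' + (- n)%:~R * pi.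
have -> : (ein x' y') = ein xn yn by rewrite ein_addz.
have Dn : D (xn, yn) by exact: (mc_addz mD).
have t1 : `|xn + yn - (x + y)| <= pi.
  by move: hn; congr (`|_| <= _); rewrite /xn /yn mulrNz; ring.
rewrite sphere_dist_ein acos_cos_norm //=.
have -> : y - x - pi / 2 - (yn - xn - pi / 2) = (y - yn) - (x - xn) by ring.
have m1 := mc_mono mD Dz Dn; have m2 := mc_mono mD Dn Dz.
have := ler_norm (xn + yn - (x + y)); have := ler_norm (- (xn + yn - (x + y))).
rewrite normrN ler_norml => b1 b2.
have [h|h|h] := ltgtP x xn; [have := m1 h|have := m2 h|rewrite -h in b1 b2 *] => *.
all: by apply/andP; split; lra.
Qed.

Lemma cochart_generic D : monotone_curve D -> generic (cochart D).
Proof.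
move=> mD [q [r [[[x y] Dz ->] [[x' y'] Dw ->] [ e1 e2] _ _]]].
have {}e1 : (ein x' y').1 = - (ein x y).1 by [].
have {}e2 : (ein x' y').2 = (ein x y).2 + pi by [].
have e : ein x' y' = ein x (y + pi).
  rewrite [LHS]surjective_pairing [RHS]surjective_pairing e1 e2; congr pair.
    by rewrite ein_opp.
  by rewrite /=; ring.
have [n [ex ey]] := ein_inj e.
apply: (mc_jump mD Dz).
by rewrite ey ex; exact: (mc_addz mD).
Qed.

Lemma cochart_preserves D (F : PSL2_cover R * PSL2_cover R) :
  (forall x y, D (F.1 x, F.2 y) <-> D (x, y)) ->
  translate F @` cochart D = cochart D.
Proof.
move=> hD; apply/seteqP; split=> [_ [_ [[x y] Dz ->] <-]|_ [[x y] Dz ->]].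
  by exists (F.1 x, F.2 y); [exact/hD|rewrite translate_ein].
exists (ein ((F.1^-1)%g x) ((F.2^-1)%g y)); last by rewrite translate_ein /= !circle_lift_mulEV.
exists ((F.1^-1)%g x, (F.2^-1)%g y) => //; apply/hD.
by rewrite /= !circle_lift_mulEV.
Qed.

End AchronalCurves.

(** * Fixed points and discrete subgroups of SL(2, R) *)

Section FixedDirections.
Variable R : realType.
Implicit Types (A B g h : SL2 R) (M N : 'M[R]_2) (u v w x y : 'cV[R]_2).

(** A condition quadratic in [v] and blind to the sign of [M], so it makes sense for elements of
    [PSL2]. *)
Definition fixes M v := cross v (M *m v) = 0.

Definition tr2 M := M 0 0 + M 1 1.

Lemma SL2P A B : [/\ A 0 0 = B 0 0, A 0 1 = B 0 1, A 1 0 = B 1 0 & A 1 1 = B 1 1] -> A = B.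
Proof. by move=> /mx2P h; apply/val_inj. Qed.

Lemma SL2_mulE A B i j : (A * B)%g i j = A i 0 * B 0 j + A i 1 * B 1 j.
Proof. exact: mulmx2E. Qed.

Lemma SL2_oneE : [/\ (1%g : SL2 R) 0 0 = 1, (1%g : SL2 R) 0 1 = 0,
  (1%g : SL2 R) 1 0 = 0 & (1%g : SL2 R) 1 1 = 1].
Proof. by split; rewrite mxE. Qed.

Definition adj2 M : 'M[R]_2 := \matrix_(i, j)
  if i == 0 then (if j == 0 then M 1 1 else - M 0 1)
  else (if j == 0 then - M 1 0 else M 0 0).

Lemma adj2E M : [/\ adj2 M 0 0 = M 1 1, adj2 M 0 1 = - M 0 1,
  adj2 M 1 0 = - M 1 0 & adj2 M 1 1 = M 0 0].
Proof. by split; rewrite mxE. Qed.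

Lemma SL2_invE A : (A^-1)%g = adj2 A :> 'M[R]_2.
Proof.
have [e1 e2 e3 e4] := adj2E A.
have dB : \det (adj2 A) == 1.
  by rewrite det_mx22 e1 e2 e3 e4 -(SL2_det A); apply/eqP; ring.
suff -> : (A^-1)%g = MkSL2 dB by [].
apply: (mulgI A); rewrite mulgV; have [i1 i2 i3 i4] := SL2_oneE.
have d := SL2_det A.
by apply: SL2P; rewrite !SL2_mulE i1 i2 i3 i4 /= e1 e2 e3 e4; split; lra.
Qed.

Lemma SL2_invE4 A : [/\ (A^-1)%g 0 0 = A 1 1, (A^-1)%g 0 1 = - A 0 1,
  (A^-1)%g 1 0 = - A 1 0 & (A^-1)%g 1 1 = A 0 0].
Proof. by rewrite SL2_invE; exact: adj2E. Qed.

Lemma par_scale v w : v != 0 -> cross v w = 0 -> exists c, w = c *: v.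
Proof.
move=> v0 h; have [t [c [c0 ev]]] := nonzero_dir v0.
have cd : cross (dir t) w = 0.
  by move: h; rewrite ev crossZl => /eqP; rewrite mulf_eq0 gt_eqF //= => /eqP.
exists (dotp (dir t) w / c); rewrite ev scalerA divfK ?gt_eqF //.
by rewrite [LHS](frame_dir t w) cd scale0r addr0.
Qed.

Lemma cross_basis u v w : cross u v != 0 ->
  w = (cross w v / cross u v) *: u + (cross u w / cross u v) *: v.
Proof. by rewrite /cross => h; apply: cv2P; rewrite !mxE; field; exact: h. Qed.

Lemma crossC v w : cross v w = - cross w v.
Proof. by rewrite /cross; ring. Qed.

Lemma fixesZ M v c : fixes M v -> fixes M (c *: v).
Proof. by rewrite /fixes -scalemxAr crossZ crossZl => ->; rewrite !mulr0. Qed.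

Lemma fixes_par M v w : v != 0 -> cross v w = 0 -> fixes M v -> fixes M w.
Proof. by move=> v0 /(par_scale v0)[c ->]; exact: fixesZ. Qed.

Lemma fixesE M v : fixes M v <->
  M 1 0 * v 0 0 ^+ 2 + (M 1 1 - M 0 0) * v 0 0 * v 1 0 - M 0 1 * v 1 0 ^+ 2 = 0.
Proof.
rewrite /fixes /cross !mulmx2E; split=> h; rewrite -[RHS]h; ring.
Qed.

Lemma SL2_act A B v : (A * B)%g *m v = A *m (B *m v).
Proof. by rewrite mulmxA. Qed.

Lemma SL2_act1 v : (1%g : SL2 R) *m v = v.
Proof. exact: mul1mx. Qed.

Lemma SL2_mulv_neq0 A v : v != 0 -> A *m v != 0.
Proof.
move=> v0; apply/eqP => h.
have : (A^-1)%g *m (A *m v) = v by rewrite -SL2_act mulVg SL2_act1.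
by rewrite h mulmx0 => e; rewrite -e eqxx in v0.
Qed.

Lemma SL2_cross A u v : cross (A *m u) (A *m v) = cross u v.
Proof. by rewrite cross_mulmx det_SL2 mul1r. Qed.

Lemma fixes_conj g h v : fixes (g * h * g^-1)%g v <-> fixes h ((g^-1)%g *m v).
Proof.
by rewrite /fixes -(SL2_cross g^-1%g v) -!SL2_act -!mulgA mulKg.
Qed.

Lemma nonelliptic_fixes A : 4 <= tr2 A ^+ 2 -> exists2 v, v != 0 & fixes A v.
Proof.
rewrite /tr2 => t; have d := SL2_det A.
have [h|h] := eqVneq (A 1 0) 0.
  exists (dir 0); first exact: dir_neq0.
  by apply/fixesE; rewrite !mxE /= h sin0; ring.
(* The discriminant of the quadratic equation in [fixesE]; it equals [tr2 A ^+ 2 - 4]. *)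
pose D := (A 1 1 - A 0 0) ^+ 2 + 4 * A 0 1 * A 1 0.
have D0 : 0 <= D by rewrite /D; nra.
have sD := sqr_sqrtr D0.
pose v : 'cV[R]_2 := \col_i (if i == 0 then (A 0 0 - A 1 1 + Num.sqrt D) else 2 * A 1 0).
exists v.
  apply/eqP => /(congr1 (fun w : 'cV[R]_2 => w 1 0)); rewrite !mxE /= => /eqP.
  by rewrite mulf_eq0 (negbTE h) orbF pnatr_eq0.
apply/fixesE; rewrite !mxE /=.
transitivity (A 1 0 * (Num.sqrt D ^+ 2 - D)); first by rewrite /D; ring.
by rewrite sD subrr mulr0.
Qed.

Lemma fixes_nonelliptic A v : v != 0 -> fixes A v -> 4 <= tr2 A ^+ 2.
Proof.
move=> v0 /fixesE; rewrite /tr2; have d := SL2_det A.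
set x := v 0 0; set y := v 1 0 => h.
have [y0|y0] := eqVneq y 0.
  have x0 : x != 0 by apply: contra v0 => /eqP e; apply/eqP/cv2P; rewrite mxE // -/x e.
  have a10 : A 1 0 = 0.
    move: h; rewrite y0 mulr0 expr0n /= mulr0 subr0 addr0 => /eqP.
    by rewrite mulf_eq0 expf_eq0 (negbTE x0) andbF orbF => /eqP.
  by rewrite a10 mulr0 subr0 in d; have := sqr_ge0 (A 0 0 - A 1 1); nra.
have e : ((A 0 0 + A 1 1) ^+ 2 - 4) * y ^+ 2 = (2 * A 1 0 * x + (A 1 1 - A 0 0) * y) ^+ 2.
  transitivity (((A 0 0 + A 1 1) ^+ 2 - 4 * (A 0 0 * A 1 1 - A 0 1 * A 1 0)) * y ^+ 2
     + 4 * A 1 0 * (A 1 0 * x ^+ 2 + (A 1 1 - A 0 0) * x * y - A 0 1 * y ^+ 2)).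
    by rewrite h d; ring.
  by ring.
have y2 : 0 < y ^+ 2 by rewrite exprn_even_gt0.
rewrite -subr_ge0 -(pmulr_lge0 _ y2) e; exact: sqr_ge0.
Qed.

Lemma fixes_all_scalar M : (forall v, fixes M v) -> M = (M 0 0)%:M.
Proof.
move=> H.
have h1 := (fixesE M (dir 0)).1 (H _); have h2 := (fixesE M (dir (pi / 2))).1 (H _).
have h3 := (fixesE M (dir 0 + dir (pi / 2))).1 (H _).
move: h1 h2 h3; rewrite !mxE /= cos0 sin0 cos_pihalf sin_pihalf => h1 h2 h3.
by apply: mx2P; rewrite !mxE /= mulr1n mulr0n; split; lra.
Qed.

Lemma SL2_scalar A c : (A : 'M[R]_2) = c%:M -> A = 1%g \/ A = SL2_opp 1%g.
Proof.
move=> e; have : c ^+ 2 = 1 by have := SL2_det A; rewrite e !mxE /= mulr1n mulr0n; lra.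
move/eqP; rewrite sqrf_eq1 => /orP[] /eqP c1; [left|right]; apply/val_inj => /=.
  by rewrite e c1.
by rewrite e c1 raddfN.
Qed.

(** The quadratic form [cross x (A *m x)] vanishes at [u] and [v], hence in this basis is a multiple
    of the product of the coordinates; it is identically zero only for scalar [A]. *)
Lemma fixes_third A u v w : A <> 1%g -> A <> SL2_opp 1%g ->
  cross u v != 0 -> fixes A u -> fixes A v -> fixes A w ->
  cross u w = 0 \/ cross v w = 0.
Proof.
move=> n1 n2 uv fu fv fw.
have id x : cross u v ^+ 2 * cross x (A *m x) = cross x v ^+ 2 * cross u (A *m u)
   + cross u x ^+ 2 * cross v (A *m v)
   + cross x v * cross u x * (cross u (A *m v) + cross v (A *m u)).
  by rewrite /cross !mulmx2E; ring.
have uv2 : cross u v ^+ 2 != 0 by rewrite expf_neq0.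
have idw := id w; rewrite fu fv fw !mulr0 !add0r in idw.
have : cross w v * cross u w * (cross u (A *m v) + cross v (A *m u)) == 0 by rewrite -idw.
rewrite !mulf_eq0 => /orP[/orP[] /eqP|/eqP b].
- by right; rewrite crossC; apply/eqP; rewrite oppr_eq0; apply/eqP.
- by left.
have all x : fixes A x.
  have := id x; rewrite fu fv b !mulr0 !addr0 => /eqP.
  by rewrite mulf_eq0 (negbTE uv2) /= => /eqP.
by case: (SL2_scalar (fixes_all_scalar all)).
Qed.

(** Let [C = A B - B A]. The commutator has trace [2 - \det C], so [\det C <= 0]; equality of the
    traces of [A] and [B] gives [\det C = (tr2 (A B) - 2) (tr2 (A B^-1) - 2) >= 0]. Thus [C] is
    singular, and its image is invariant since [A C = C A^-1] and likewise for [B]. *)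
Lemma common_fixed A B : A <> 1%g -> tr2 A = tr2 B -> 2 <= tr2 A ->
  2 <= tr2 (A * B)%g -> 2 <= tr2 (A * B^-1)%g -> 2 <= tr2 (A * B * A^-1 * B^-1)%g ->
  exists v, [/\ v != 0, fixes A v & fixes B v].
Proof.
move=> n1 tAB tA p q k.
have dA := SL2_det A; have dB := SL2_det B.
have [a1 a2 a3 a4] := SL2_invE4 A; have [b1 b2 b3 b4] := SL2_invE4 B.
pose C := A *m B - B *m A.
have CE i j : C i j = A i 0 * B 0 j + A i 1 * B 1 j - (B i 0 * A 0 j + B i 1 * A 1 j).
  by rewrite /C mxE mulmx2E [X in _ + X]mxE mulmx2E.
have eC : A *m B - B *m A = C by [].
clearbody C.
have zE (i : 'I_2) : (0 : 'cV[R]_2) i 0 = 0 by rewrite mxE.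
have pq : tr2 (A * B)%g + tr2 (A * B^-1)%g = tr2 A ^+ 2.
  rewrite {1}expr2 {2}tAB /tr2 !SL2_mulE b1 b2 b3 b4; ring.
have kE : tr2 (A * B * A^-1 * B^-1)%g = 2 - \det C.
  transitivity (2 * (A 0 0 * A 1 1 - A 0 1 * A 1 0) * (B 0 0 * B 1 1 - B 0 1 * B 1 0) - \det C).
    rewrite det_mx22 !CE /tr2 !SL2_mulE a1 a2 a3 a4 b1 b2 b3 b4; ring.
  by rewrite dA dB !mulr1.
have kE2 : \det C = 4 - 2 * tr2 A ^+ 2 + tr2 (A * B)%g * tr2 (A * B^-1)%g.
  transitivity (4 * (A 0 0 * A 1 1 - A 0 1 * A 1 0) * (B 0 0 * B 1 1 - B 0 1 * B 1 0)
     - tr2 A ^+ 2 * (B 0 0 * B 1 1 - B 0 1 * B 1 0) - tr2 B ^+ 2 * (A 0 0 * A 1 1 - A 0 1 * A 1 0)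
     + tr2 (A * B)%g * tr2 (A * B^-1)%g).
    rewrite det_mx22 !CE /tr2 !SL2_mulE b1 b2 b3 b4; ring.
  by rewrite dA dB -tAB; ring.
have C0 : \det C = 0 by apply/eqP; rewrite eq_le; apply/andP; split; nra.
have subE (u w : 'cV[R]_2) i : (u - w) i 0 = u i 0 - w i 0 by rewrite !mxE.
have scE c (w : 'cV[R]_2) i : (c *: w) i 0 = c * w i 0 by rewrite !mxE.
have AC v : fixes A (C *m v).
  have e : A *m (C *m v) = tr2 A *: (C *m v) - C *m (A *m v).
    by apply: cv2P; rewrite subE scE !mulmx2E !CE /tr2; ring.
  rewrite /fixes e; set z := C *m (A *m v).
  have -> : cross (C *m v) (tr2 A *: (C *m v) - z) = tr2 A * cross (C *m v) (C *m v) - cross (C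
      *m v) z.
    by rewrite /cross !mxE; ring.
  by rewrite crossvv /z cross_mulmx C0 mul0r mulr0 subr0.
have BC v : fixes B (C *m v).
  have e : B *m (C *m v) = tr2 B *: (C *m v) - C *m (B *m v).
    by apply: cv2P; rewrite subE scE !mulmx2E !CE /tr2; ring.
  rewrite /fixes e; set z := C *m (B *m v).
  have -> : cross (C *m v) (tr2 B *: (C *m v) - z) = tr2 B * cross (C *m v) (C *m v) - cross (C
      *m v) z.
    by rewrite /cross !mxE; ring.
  by rewrite crossvv /z cross_mulmx C0 mul0r mulr0 subr0.
have [h0|h0] := eqVneq (C *m dir 0) 0; last by exists (C *m dir 0).
have [h1|h1] := eqVneq (C *m dir (pi / 2)) 0; last by exists (C *m dir (pi / 2)).
(* Remaining case [C = 0]: if [B] moved a fixed direction of [A], it would carry it to another one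
   with the same eigenvalue, and [A] would be scalar. *)
have comm : A *m B = B *m A.
  have Cv v : C *m v = 0.
    have -> : v = v 0 0 *: dir 0 + v 1 0 *: dir (pi / 2).
      by apply: cv2P; rewrite !mxE /= ?cos0 ?sin0 ?cos_pihalf ?sin_pihalf; ring.
    by rewrite mulmxDr -!scalemxAr h0 h1 !scaler0 addr0.
  have H (i : 'I_2) : C i 0 = 0 /\ C i 1 = 0.
    have := congr1 (fun w : 'cV[R]_2 => w i 0) h0; have := congr1 (fun w : 'cV[R]_2 => w i 0) h1.
    by rewrite !mulmx2E !dirE0 !dirE1 cos0 sin0 cos_pihalf sin_pihalf zE; split; lra.
  have C0' : C = 0.
    by apply/matrixP => i j; rewrite [RHS]mxE; have [? ?] := H i; case: (ord2_cases j) => ->.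
  by apply/eqP; rewrite -subr_eq0 eC C0'.
have [v v0 fA] : exists2 v, v != 0 & fixes A v by apply: nonelliptic_fixes; nra.
exists v; split=> //; apply/eqP; apply/negPn/negP => nB.
have [l el] := par_scale v0 fA.
apply: n1; case: (@SL2_scalar A l) => //.
  have eB : A *m (B *m v) = l *: (B *m v) by rewrite mulmxA comm -mulmxA el scalemxAr.
  have E w : A *m w = l *: w.
    have -> : w = (cross w (B *m v) / cross v (B *m v)) *: v + (cross v w / cross v (B *m v)) *:
        (B *m v).
      exact: cross_basis.
    by rewrite mulmxDr -!scalemxAr el eB scalerDr !scalerA !(mulrC l).
  have E0 := E (dir 0); have E1 := E (dir (pi / 2)).
  have H (i : 'I_2) : A i 0 = l * (dir 0 : 'cV[R]_2) i 0 /\ A i 1 = l * (dir (pi / 2) :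
      'cV[R]_2) i 0.
    have := congr1 (fun w : 'cV[R]_2 => w i 0) E0; have := congr1 (fun w : 'cV[R]_2 => w i 0) E1.
    rewrite !mulmx2E !scE !dirE0 !dirE1 cos0 sin0 cos_pihalf sin_pihalf; split; lra.
  have [x1 x2] := H 0; have [x3 x4] := H 1.
  apply: mx2P; rewrite x1 x2 x3 x4 !mxE /= cos0 sin0 cos_pihalf sin_pihalf mulr1n mulr0n.
  by split; ring.
move=> eA; exfalso; have e0 : A 0 0 = - 1 by rewrite eA !mxE.
have e1 : A 1 1 = - 1 by rewrite eA !mxE.
by move: tA; rewrite /tr2 e0 e1; lra.
Qed.

End FixedDirections.

(** * Subgroups without elliptic elements that contain small elements *)

Section SmallElements.
Variable R : realType.
Implicit Types (A B g h : SL2 R) (M : 'M[R]_2) (u v w : 'cV[R]_2) (H : set (SL2 R)).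

Record subgroup2 H : Prop := Subgroup2 {
  sg_mul : forall A B, H A -> H B -> H (A * B)%g;
  sg_inv : forall A, H A -> H (A^-1)%g }.

(* Small elements [h] and [g h g^-1] have traces close to 2 together with all their
   short words, so the absence of elliptic elements forces these traces to be at
   least 2, and [common_fixed] applies. *)
Lemma near_trace g : \forall M \near nbhs (1%:M : 'M[R]_2), forall h, M = h :> 'M[R]_2 ->
  let k := (g * h * g^-1)%g in
  [/\ -2 < tr2 h, -2 < tr2 (h * k)%g, -2 < tr2 (h * k^-1)%g & -2 < tr2 (h * k * h^-1 * k^-1)%g].
Proof.
pose a : 'M[R]_2 := 1%:M.
have Fa : Filter (nbhs a) by exact: nbhs_filter.
pose ec (f : 'M[R]_2 -> 'M[R]_2) := forall i j, {for a, continuous (fun M => f M i j)}.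
have ec_id : ec id by move=> i j; exact: coord_continuous.
have ceq (f f' : 'M[R]_2 -> R) : f =1 f' -> {for a, continuous f} ->
    {for a, continuous f'} by move=> /funext->.
have ccst (c : R) : {for a, continuous (fun _ : 'M[R]_2 => c)} by exact: cst_continuous.
have ec_cst N : ec (fun=> N) by move=> i j; exact: ccst.
have ec_mul f f' : ec f -> ec f' -> ec (fun M => f M *m f' M).
  move=> h1 h2 i j; apply: (ceq (fun M => f M i 0 * f' M 0 j + f M i 1 * f' M 1 j)).
    by move=> M; rewrite mulmx2E.
  by apply: cvgD; apply: cvgM; [exact: h1|exact: h2|exact: h1|exact: h2].
have ec_adj f : ec f -> ec (fun M => adj2 (f M)).
  move=> h1 i j.
  have eq (b c : 'I_2) (e : R) : (forall M, adj2 M i j = e * M b c) ->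
      {for a, continuous (fun M => adj2 (f M) i j)}.
    move=> E; apply: (ceq (fun M => e * f M b c)); first by move=> M; rewrite E.
    by apply: cvgM; [exact: ccst|exact: h1].
  case: (ord2_cases i) (ord2_cases j) eq => -> [] -> eq.
  - by apply: (eq 1 1 1) => M; rewrite mxE mul1r.
  - by apply: (eq 0 1 (-1)) => M; rewrite mxE mulN1r.
  - by apply: (eq 1 0 (-1)) => M; rewrite mxE mulN1r.
  - by apply: (eq 0 0 1) => M; rewrite mxE mul1r.
have tr_near (f : 'M[R]_2 -> 'M[R]_2) : ec f -> f a = a ->
    \forall M \near nbhs (1%:M : 'M[R]_2), -2 < tr2 (f M).
  move=> cf f1.
  have ct : {for a, continuous (fun M => tr2 (f M))} by apply: cvgD; exact: cf.
  have : nbhs (tr2 (f a)) [set t : R | -2 < t].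
    by apply: open_nbhs_nbhs; split; [exact: open_gt|rewrite /= f1 /tr2 !mxE /=; lra].
  exact: ct.
pose K M : 'M[R]_2 := g *m M *m adj2 g.
have adj1 : adj2 (1%:M : 'M[R]_2) = 1%:M by have := SL2_invE (1%g : SL2 R); rewrite invg1 => <-.
have K1 : K 1%:M = 1%:M by rewrite /K mulmx1 -SL2_invE -[_ *m _]/((g * g^-1)%g : 'M[R]_2) mulgV.
have cK : ec K by apply: (ec_mul _ _ (ec_mul _ _ _ _)) => //.
near=> M.
move=> h eM; set k := (g * h * g^-1)%g.
have eK : K M = k :> 'M[R]_2 by rewrite /K eM -SL2_invE.
split.
- by rewrite -eM; near: M; apply: (tr_near id).
- have -> : tr2 (h * k)%g = tr2 (M *m K M) by rewrite eK eM.
  by near: M; apply: tr_near; [apply: ec_mul|rewrite K1 mulmx1].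
- have -> : tr2 (h * k^-1)%g = tr2 (M *m adj2 (K M)) by rewrite eK eM -SL2_invE.
  by near: M; apply: tr_near; [apply/ec_mul/ec_adj|rewrite K1 adj1 mulmx1].
- have -> : tr2 (h * k * h^-1 * k^-1)%g = tr2 (M *m K M *m adj2 M *m adj2 (K M)).
    by rewrite eK eM -!SL2_invE.
  near: M; apply: tr_near; last by rewrite K1 adj1 !mulmx1.
  by apply: (ec_mul _ _ (ec_mul _ _ (ec_mul _ _ _ _) _)) => //; apply: ec_adj.
Unshelve. all: by end_near. Qed.

Definition shares g h := exists v, [/\ v != 0, fixes h v & fixes g v].

Lemma cayley_hamilton g v : g *m (g *m v) = tr2 g *: (g *m v) - v.
Proof.
have d := SL2_det g.
have subE u w i : (u - w) i 0 = u i 0 - w i 0 by rewrite !mxE.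
have scE c w i : (c *: w) i 0 = c * w i 0 by rewrite !mxE.
have e i : (g *m (g *m v)) i 0 = tr2 g * (g *m v) i 0 - (g 0 0 * g 1 1 - g 0 1 * g 1 0) * v i 0.
  by case: (ord2_cases i) => ->; rewrite !mulmx2E /tr2; ring.
by apply: cv2P; rewrite subE scE e d mul1r.
Qed.

Section NoElliptic.
Variable H : set (SL2 R).
Hypothesis sgH : subgroup2 H.
Hypothesis nonell : forall A, H A -> 4 <= tr2 A ^+ 2.

(** [common_fixed] applies to [h] and [g^-1 h g], which have equal traces: without elliptic
    elements, every trace above [-2] is at least 2. *)
Lemma near_shares_conj g : H g ->
  \forall M \near nbhs (1%:M : 'M[R]_2), forall h, M = h :> 'M[R]_2 -> H h -> h <> 1%g ->
  exists v, [/\ v != 0, fixes h v & fixes h (g *m v)].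
Proof.
move=> Hg; apply: filterS (near_trace g^-1%g) => M nM h eM Hh h1.
have [] := nM h eM; rewrite invgK; set k := (_ * h * g)%g => t1 t2 t3 t4.
have Hk : H k by apply: sg_mul => //; apply: sg_mul => //; exact: sg_inv.
have H2 A : H A -> -2 < tr2 A -> 2 <= tr2 A by move=> /nonell; nra.
have tk : tr2 h = tr2 k.
  have d := SL2_det g; have [g1 g2 g3 g4] := SL2_invE4 g.
  transitivity ((g 0 0 * g 1 1 - g 0 1 * g 1 0) * tr2 h); first by rewrite d mul1r.
  by rewrite /k /tr2 !SL2_mulE g1 g2 g3 g4; ring.
have [v [v0 fh fk]] : exists v, [/\ v != 0, fixes h v & fixes k v].
  apply: common_fixed => //; apply: H2 => //.
  - exact: sg_mul.
  - by apply: sg_mul => //; exact: sg_inv.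
  - have mH := sg_mul sgH; have iH := sg_inv sgH.
    by apply: (mH); [apply: (mH); [exact: mH|exact: iH]|exact: iH].
exists v; split=> //; move: fk.
by rewrite /k -{2}[g]invgK => /fixes_conj; rewrite invgK.
Qed.

Lemma not_opp h : 2 <= tr2 h -> h <> SL2_opp 1%g.
Proof.
move=> t e; have e0 : h 0 0 = - 1 by rewrite e !mxE.
have e1 : h 1 1 = - 1 by rewrite e !mxE.
by move: t; rewrite /tr2 e0 e1; lra.
Qed.

(** [near_shares_conj] for [g] gives [x] and [g x] fixed by [h], and for [g^2] gives [w] and
    [g^2 w]. If [x] and [g x] differ, they are all the fixed directions of [h], so [g^2] would map
    one of them to one of them; Cayley-Hamilton and [|tr2 g| >= 2] exclude this. *)
Lemma near_shares g : H g ->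
  \forall M \near nbhs (1%:M : 'M[R]_2), forall h,
    M = h :> 'M[R]_2 -> H h -> h <> 1%g -> shares g h.
Proof.
move=> Hg; have Hgg := sg_mul sgH Hg Hg.
apply: filterS3 (near_shares_conj Hg) (near_shares_conj Hgg) (near_trace 1%g) =>
  M n1 n2 n3 h eM Hh h1.
have hN : h <> SL2_opp 1%g.
  by apply: not_opp; have [] := n3 h eM; have := nonell Hh; nra.
have [x [x0 fx fgx]] := n1 h eM Hh h1.
have [w [w0 fw fgw]] := n2 h eM Hh h1.
have [xy|xy] := eqVneq (cross x (g *m x)) 0; first by exists x.
exfalso; set y := g *m x in fgx xy.
have y0 : y != 0 by exact: SL2_mulv_neq0.
have t4 := nonell Hg; have t0 : tr2 g != 0 by apply/eqP => e; move: t4; rewrite e; lra.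
have gy : g *m y = tr2 g *: y - x by exact: cayley_hamilton.
have ggx : (g * g)%g *m x = tr2 g *: y - x by rewrite SL2_act.
have ggy : (g * g)%g *m y = (tr2 g ^+ 2 - 1) *: y - tr2 g *: x.
  by rewrite SL2_act gy mulmxDr mulmxN -scalemxAr gy -/y; apply: cv2P; rewrite !mxE; ring.
have cr a b : cross x (a *: y - b *: x) = a * cross x y by rewrite /cross !mxE; ring.
have cr' a b : cross y (a *: y - b *: x) = b * cross x y by rewrite /cross !mxE; ring.
have [e|e] := fixes_third h1 hN xy fx fgx fw.
- have [c ew] := par_scale x0 e.
  have c0 : c != 0 by apply: contra w0 => /eqP c0; rewrite ew c0 scale0r.
  have : fixes h (tr2 g *: y - 1 *: x).
    rewrite scale1r -ggx; move: fgw; rewrite ew -scalemxAr => /(fixesZ c^-1).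
    by rewrite scalerA mulVf // scale1r.
  move=> /(fixes_third h1 hN xy fx fgx)[]; rewrite ?cr ?cr' => /eqP;
    rewrite mulf_eq0 (negbTE xy) orbF.
    by rewrite (negbTE t0).
  by rewrite oner_eq0.
- have [c ew] := par_scale y0 e.
  have c0 : c != 0 by apply: contra w0 => /eqP c0; rewrite ew c0 scale0r.
  have : fixes h ((tr2 g ^+ 2 - 1) *: y - tr2 g *: x).
    rewrite -ggy; move: fgw; rewrite ew -scalemxAr => /(fixesZ c^-1).
    by rewrite scalerA mulVf // scale1r.
  move=> /(fixes_third h1 hN xy fx fgx)[]; rewrite ?cr ?cr' => /eqP;
    rewrite mulf_eq0 (negbTE xy) orbF.
    by move=> /eqP; lra.
  by rewrite (negbTE t0).
Qed.

Lemma fixes_inv g v : fixes g v -> fixes g^-1%g v.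
Proof.
have [g1 g2 g3 g4] := SL2_invE4 g.
by move=> /fixesE h; apply/fixesE; rewrite g1 g2 g3 g4; lra.
Qed.

Lemma fixes_mul g h v : v != 0 -> fixes g v -> fixes h v -> fixes (g * h)%g v.
Proof.
move=> v0 /(par_scale v0)[a ea] /(par_scale v0)[b eb].
by rewrite /fixes SL2_act eb -scalemxAr ea !crossZ crossvv !mulr0.
Qed.

(** As [h] has at most two fixed directions, the one shared with [g g'] is that of [g] or that of
    [g'], and the remaining factor fixes it too. *)
Lemma shares_pair g g' h : h <> 1%g -> h <> SL2_opp 1%g ->
  shares g h -> shares g' h -> shares (g * g')%g h ->
  exists v, [/\ v != 0, fixes h v, fixes g v & fixes g' v].
Proof.
move=> h1 hN [a [a0 ha ga]] [b [b0 hb gb]] [c [c0 hc gc]].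
have [ab|ab] := eqVneq (cross a b) 0.
  by exists b; split=> //; exact: fixes_par ga.
have [e|e] := fixes_third h1 hN ab ha hb hc.
- exists a; split=> //.
  have ec : cross c a = 0 by rewrite crossC e oppr0.
  have fa := fixes_par c0 ec gc.
  by rewrite -[g'](mulKg g); apply: fixes_mul => //; exact: fixes_inv.
- exists b; split=> //.
  have ec : cross c b = 0 by rewrite crossC e oppr0.
  have fb := fixes_par c0 ec gc.
  by rewrite -[g](mulgK g'); apply: fixes_mul => //; exact: fixes_inv.
Qed.

(* Each of finitely many elements of [H] shares a fixed direction with a small [h],
   which has at most two. *)
Theorem small_common_fixed :
  (forall U, nbhs (1%:M : 'M[R]_2) U -> exists A, [/\ H A, A <> 1%g & U A]) ->
  exists v, v != 0 /\ forall A, H A -> fixes A v.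
Proof.
move=> small.
have [g1 [Hg1 n1 n1']] : exists g, [/\ H g, g <> 1%g & g <> SL2_opp 1%g].
  have [g [Hg g1 Ug]] := small _ (near_trace 1%g).
  exists g; split=> //; apply: not_opp; have [] := Ug g erefl; have := nonell Hg; nra.
have [u u0 fu] := nonelliptic_fixes (nonell Hg1).
apply: contrapT => no.
have ex v : v != 0 -> exists2 g, H g & ~ fixes g v.
  move=> v0; apply: contrapT => h; apply: no; exists v; split=> // A HA.
  by apply: contrapT => nf; apply: h; exists A.
(* [g2] moves [u] and [g3] moves any other fixed direction of [g1], so that no direction is fixed by
   all three. *)
have [g2 Hg2 n2] := ex u u0.
have [g3 Hg3 n3] : exists2 g3, H g3 &
    forall v, v != 0 -> fixes g1 v -> cross u v != 0 -> ~ fixes g3 v.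
  have [[v [v0 fv uv]]|nv] := pselect (exists v, [/\ v != 0, fixes g1 v & cross u v != 0]).
    have [g3 Hg3 n3] := ex v v0; exists g3 => // w w0 fw uw fw3.
    have [e|e] := fixes_third n1 n1' uv fu fv fw; first by rewrite e eqxx in uw.
    by apply: n3; apply: fixes_par w0 _ fw3; rewrite crossC e oppr0.
  by exists g2 => // v v0 fv uv; case: nv; exists v.
have N g Hg := @near_shares g Hg.
have [h [Hh h1 [[[s1 s2] s3] [[[s12 s13] s23] tn]]]] := small _ (filterI
  (filterI (filterI (N _ Hg1) (N _ Hg2)) (N _ Hg3))
  (filterI (filterI (filterI (N _ (sg_mul sgH Hg1 Hg2)) (N _ (sg_mul sgH Hg1 Hg3)))
     (N _ (sg_mul sgH Hg2 Hg3))) (near_trace 1%g))).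
have hN : h <> SL2_opp 1%g.
  by apply: not_opp; have [] := tn h erefl; have := nonell Hh; nra.
have [a [a0 ha ga1 ga2]] :=
  shares_pair h1 hN (s1 h erefl Hh h1) (s2 h erefl Hh h1) (s12 h erefl Hh h1).
have [b [b0 hb gb1 gb3]] :=
  shares_pair h1 hN (s1 h erefl Hh h1) (s3 h erefl Hh h1) (s13 h erefl Hh h1).
have [c [c0 hc gc2 gc3]] :=
  shares_pair h1 hN (s2 h erefl Hh h1) (s3 h erefl Hh h1) (s23 h erefl Hh h1).
(* Two of the three directions [a], [b], [c] fixed by [h] coincide, and any two of them together
   involve all of [g1], [g2], [g3]. *)
have [w [w0 w1 w2 w3]] : exists w, [/\ w != 0, fixes g1 w, fixes g2 w & fixes g3 w].
  have [ab|ab] := eqVneq (cross a b) 0.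
    by exists b; split=> //; exact: fixes_par ga2.
  have [e|e] := fixes_third h1 hN ab ha hb hc.
    by exists a; split=> //; apply: fixes_par c0 _ gc3; rewrite crossC e oppr0.
  by exists b; split=> //; apply: fixes_par c0 _ gc2; rewrite crossC e oppr0.
have [uw|uw] := eqVneq (cross u w) 0; last exact: (n3 w).
by apply: n2; apply: fixes_par w0 _ w2; rewrite crossC uw oppr0.
Qed.

End NoElliptic.

End SmallElements.

(** * Discrete groups of triangular pairs; unipotent and elliptic matrices *)

Section TriangularPairs.
Variable R : realType.
Implicit Types (A B : SL2 R) (s t x a : R).

Lemma uni_subproof s : \det (gl2_of 1 (s / 2) 0 (s / 2)) == 1.
Proof. by rewrite det_mx22 !mxE /=; apply/eqP; field. Qed.

(* The matrix [[1, s], [0, 1]]. *)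
Definition uni s : SL2 R := MkSL2 (uni_subproof s).

Lemma uniE s : [/\ uni s 0 0 = 1, uni s 0 1 = s, uni s 1 0 = 0 & uni s 1 1 = 1].
Proof. by rewrite !mxE /=; split; field. Qed.

Lemma uniP A s : A 0 0 = 1 -> A 0 1 = s -> A 1 0 = 0 -> A = uni s.
Proof.
move=> a00 a01 a10; have d := SL2_det A; have [u1 u2 u3 u4] := uniE s.
by apply: SL2P; rewrite u1 u2 u3 u4; move: d; rewrite a00 a10; split => //; lra.
Qed.

Lemma uni0 : uni 0 = 1%g.
Proof. by have [u1 u2 u3 u4] := SL2_oneE R; apply/esym/uniP. Qed.

Lemma uniM s t : (uni s * uni t)%g = uni (s + t).
Proof.
have [u1 u2 u3 u4] := uniE s; have [v1 v2 v3 v4] := uniE t.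
by apply: uniP; rewrite !SL2_mulE ?u1 ?u2 ?u3 ?u4 ?v1 ?v2 ?v3 ?v4; ring.
Qed.

Lemma uniV s : (uni s)^-1%g = uni (- s).
Proof. by apply: (mulgI (uni s)); rewrite mulgV uniM subrr uni0. Qed.

Lemma uni_eq1 s : uni s = 1%g -> s = 0.
Proof.
by move=> e; have [_ <- _ _] := uniE s; have [_ u _ _] := SL2_oneE R; rewrite e.
Qed.

Lemma uni_conj A s : A 1 0 = 0 -> (A * uni s * A^-1)%g = uni (A 0 0 ^+ 2 * s).
Proof.
move=> a10; have d := SL2_det A; rewrite a10 mulr0 subr0 in d.
have [u1 u2 u3 u4] := uniE s; have [v1 v2 v3 v4] := SL2_invE4 A.
by apply: uniP; rewrite !SL2_mulE ?u1 ?u2 ?u3 ?u4 ?v1 ?v2 ?v3 ?v4 ?a10; lra.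
Qed.

Lemma near_uni (U : set 'M[R]_2) : nbhs (1%:M : 'M[R]_2) U -> \forall x \near (0 : R), U (uni x).
Proof.
move=> [P PU sPU].
have P01 : nbhs (0 : R) (P 0 1) by have := PU 0 1; rewrite mxE.
have PC (i : 'I_2) : P i i 1.
  by have := nbhs_singleton (PU i i); rewrite mxE eqxx.
have P10 : P 1 0 0 by have := nbhs_singleton (PU 1 0); rewrite mxE.
apply: filterS P01 => x Px; apply: sPU => i j; have [u1 u2 u3 u4] := uniE x.
by case: (ord2_cases i) (ord2_cases j) => -> [] ->; rewrite ?u1 ?u2 ?u3 ?u4.
Qed.

(** Positive diagonals single out one representative of each projective class. Discreteness is that
    of the pairs: one factor may be small as long as the other is not. *)
Record triangular_pairs (H : SL2 R -> SL2 R -> Prop) : Prop := TriangularPairs {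
  tp_mul : forall A B A' B', H A B -> H A' B' -> H (A * A')%g (B * B')%g;
  tp_inv : forall A B, H A B -> H A^-1%g B^-1%g;
  tp_upper : forall A B, H A B -> [/\ A 1 0 = 0, B 1 0 = 0, 0 < A 0 0 & 0 < B 0 0];
  tp_discrete : exists2 U, nbhs (1%:M : 'M[R]_2) U &
    forall A B, H A B -> U A -> U B -> A = 1%g /\ B = 1%g }.

Lemma triangular_pairs_swap H : triangular_pairs H -> triangular_pairs (fun A B => H B A).
Proof.
move=> [m i u [U nU dU]]; split.
- by move=> *; exact: m.
- by move=> *; exact: i.
- by move=> A B /u[].
- by exists U => // A B h UA UB; have [] := dU _ _ h UB UA.
Qed.

Section Contraction.
Variable H : SL2 R -> SL2 R -> Prop.
Hypothesis tH : triangular_pairs H.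

Lemma conj_iter A B s t n : H A B -> H (uni s) (uni t) ->
  H (uni ((A 0 0 ^+ 2) ^+ n * s)) (uni ((B 0 0 ^+ 2) ^+ n * t)).
Proof.
move=> hAB h; have [a10 b10 _ _] := tp_upper tH hAB.
elim: n => [|n IH]; first by rewrite !expr0 !mul1r.
have e (a x : R) : (a ^+ 2) ^+ n.+1 * x = a ^+ 2 * ((a ^+ 2) ^+ n * x).
  by rewrite mulrA; congr (_ * _); exact: exprS.
rewrite !e -!uni_conj //.
have mH := tp_mul tH; have iH := tp_inv tH.
by apply: (mH); [exact: mH|exact: iH].
Qed.

(** Conjugating by powers of [(A, B)] brings the unipotent pair to the identity in the limit;
    discreteness makes some conjugate, hence the pair itself, trivial. *)
Lemma contraction A B s t : H A B -> H (uni s) (uni t) ->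
  A 0 0 < 1 \/ s = 0 -> B 0 0 < 1 \/ t = 0 -> s = 0 /\ t = 0.
Proof.
move=> hAB h ca cb; have [_ _ a0 b0] := tp_upper tH hAB.
have lim (a x : R) : 0 < a -> a < 1 \/ x = 0 -> (a ^+ 2) ^+ n * x @[n --> \oo] --> (0 : R).
  move=> ap [a1|->]; last first.
    by under eq_fun do rewrite mulr0; exact: cvg_cst.
  rewrite -[0](mul0r x); apply: cvgM; last exact: cvg_cst.
  apply: cvg_expr; rewrite ger0_norm ?exprn_ge0 ?(ltW ap) //.
  by rewrite expr_lt1 // ltW.
have [U nU dU] := tp_discrete tH.
have nu := near_uni nU.
have n1 : \forall n \near \oo, U (uni ((A 0 0 ^+ 2) ^+ n * s)) by exact: (lim _ _ a0 ca _ nu).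
have n2 : \forall n \near \oo, U (uni ((B 0 0 ^+ 2) ^+ n * t)) by exact: (lim _ _ b0 cb _ nu).
have [n [h1 h2]] := filter_ex (filterI n1 n2).
have [/uni_eq1 e1 /uni_eq1 e2] := dU _ _ (conj_iter n hAB h) h1 h2.
have z (a x : R) : 0 < a -> (a ^+ 2) ^+ n * x = 0 -> x = 0.
  by move=> ap /eqP; rewrite mulf_eq0 !expf_eq0 (gt_eqF ap) !andbF /= => /eqP.
by split; [exact: z e1|exact: z e2].
Qed.

(* Conjugating by a pair that contracts both factors would give arbitrarily small
   unipotents; so one factor is contracted and the other expanded, and subtracting
   [(s, t)] from its conjugate makes the signs opposite. *)
Lemma opposite_unipotents A B s t : H A B -> H (uni s) (uni t) -> s != 0 -> A 0 0 != 1 ->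
  exists s' t', H (uni s') (uni t') /\ s' * t' < 0.
Proof.
wlog a1 : A B / A 0 0 < 1.
  move=> W hAB h s0 a1; have [_ _ a0 _] := tp_upper tH hAB.
  have [l|l] := ltP (A 0 0) 1; first exact: W hAB h s0 a1.
  have [i1 _ _ i4] := SL2_invE4 A.
  have d := SL2_det A; have [a10 _ _ _] := tp_upper tH hAB; rewrite a10 mulr0 subr0 in d.
  have l' : 1 < A 0 0 by rewrite lt_neqAle eq_sym a1.
  have l1 : (A^-1)%g 0 0 < 1 by rewrite i1; nra.
  apply: (W _ _ l1 (tp_inv tH hAB) h s0); by rewrite lt_eqF.
move=> hAB h s0 _; have [a10 b10 a0 b0] := tp_upper tH hAB.
have mH := tp_mul tH; have iH := tp_inv tH.
have [b1|b1|b1] := ltgtP (B 0 0) 1.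
- have [e _] := contraction hAB h (or_introl a1) (or_introl b1).
  by rewrite e eqxx in s0.
- have [t0|t0] := eqVneq t 0.
    have [e _] := contraction hAB h (or_introl a1) (or_intror t0).
    by rewrite e eqxx in s0.
  have [st|st] := ltP (s * t) 0; first by exists s, t.
  have st' : 0 < s * t by rewrite lt_neqAle eq_sym mulf_neq0.
  exists (A 0 0 ^+ 2 * s - s), (B 0 0 ^+ 2 * t - t); split.
    rewrite -!uniM -!uniV -!uni_conj //.
    by apply: (mH); [apply: (mH); [exact: mH|exact: iH]|exact: iH].
  have -> : (A 0 0 ^+ 2 * s - s) * (B 0 0 ^+ 2 * t - t) = (A 0 0 ^+ 2 - 1) * (B 0 0 ^+ 2 - 1) *
      (s * t) by ring.
  rewrite pmulr_llt0 //.
  have : A 0 0 ^+ 2 - 1 < 0 by nra.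
  have : 0 < B 0 0 ^+ 2 - 1 by nra.
  by move=> ? ?; rewrite pmulr_llt0.
(* For [B] of diagonal 1 conjugation keeps [t], so subtracting leaves 0 in the second coordinate
   while the first is contracted. *)
- have hd : H (uni (A 0 0 ^+ 2 * s - s)) (uni 0).
    have -> : (0 : R) = B 0 0 ^+ 2 * t - t by rewrite b1; ring.
    rewrite -!uniM -!uniV -!uni_conj //.
    by apply: (mH); [apply: (mH); [exact: mH|exact: iH]|exact: iH].
  have [e _] := contraction hAB hd (or_introl a1) (or_intror erefl).
  have : (A 0 0 ^+ 2 - 1) * s == 0 by apply/eqP; transitivity (A 0 0 ^+ 2 * s - s); [ring|exact: e].
  rewrite mulf_eq0 (negbTE s0) orbF => /eqP a2; exfalso; nra.
Qed.

End Contraction.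

Lemma upper_commutator A A' : A 1 0 = 0 -> A' 1 0 = 0 ->
  exists2 s, (A * A' * A^-1 * A'^-1)%g = uni s & A 0 0 = 1 -> A' 0 0 = 1 -> s = 0.
Proof.
move=> a10 a10'; have d := SL2_det A; have d' := SL2_det A'.
rewrite a10 mulr0 subr0 in d; rewrite a10' mulr0 subr0 in d'.
have [v1 v2 v3 v4] := SL2_invE4 A; have [w1 w2 w3 w4] := SL2_invE4 A'.
exists ((A * A' * A^-1 * A'^-1)%g 0 1).
  apply: uniP => //; rewrite !SL2_mulE ?v1 ?v2 ?v3 ?v4 ?w1 ?w2 ?w3 ?w4 ?a10 ?a10'; last by ring.
  transitivity ((A 0 0 * A 1 1) * (A' 0 0 * A' 1 1)); first by ring.
  by rewrite d d' mulr1.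
move=> a1 a1'; rewrite a1 mul1r in d; rewrite a1' mul1r in d'.
by rewrite !SL2_mulE ?v1 ?v2 ?v3 ?v4 ?w2 ?w4 ?a10 ?a10' ?d ?d' ?a1 ?a1'; ring.
Qed.

(** The commutator pair is unipotent. In a factor where it is nontrivial, one of the two matrices
    has diagonal entry other than 1, and its pair can serve as the conjugating one in
    [opposite_unipotents]. *)
Theorem noncommuting_unipotents H : triangular_pairs H ->
  (exists A B A' B', [/\ H A B, H A' B' & (A * A' * A^-1 * A'^-1)%g <> 1%g \/
     (B * B' * B^-1 * B'^-1)%g <> 1%g]) ->
  exists s t, H (uni s) (uni t) /\ s * t < 0.
Proof.
move=> tH [A [B [A' [B' [h h' nc]]]]].
have mH := tp_mul tH; have iH := tp_inv tH.
have hc : H (A * A' * A^-1 * A'^-1)%g (B * B' * B^-1 * B'^-1)%g.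
  by apply: (mH); [apply: (mH); [exact: mH|exact: iH]|exact: iH].
have [a10 b10 _ _] := tp_upper tH h; have [a10' b10' _ _] := tp_upper tH h'.
have [s es s0] := upper_commutator a10 a10'; have [t et t0] := upper_commutator b10 b10'.
rewrite es et in hc nc.
have [sz|sz] := eqVneq s 0; last first.
  have [a1|a1] := eqVneq (A 0 0) 1; last exact: (opposite_unipotents tH h hc).
  have [a1'|a1'] := eqVneq (A' 0 0) 1; last exact: (opposite_unipotents tH h' hc).
  by rewrite s0 // eqxx in sz.
have tz : t != 0.
  by apply/eqP => tz; case: nc; rewrite ?sz ?tz uni0.
have tH' := triangular_pairs_swap tH.
suff [t' [s' [hs st]]] : exists t' s', H (uni s') (uni t') /\ t' * s' < 0.
  by exists s', t'; rewrite mulrC.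
have [b1|b1] := eqVneq (B 0 0) 1; last exact: (opposite_unipotents tH' h hc).
have [b1'|b1'] := eqVneq (B' 0 0) 1; last exact: (opposite_unipotents tH' h' hc).
by rewrite t0 // eqxx in tz.
Qed.

(** The shear $(x,y)\mapsto(x+sy,y)$ tilts the upper half plane towards the positive first axis when
    [s > 0] and away from it when [s < 0]. As [f] keeps the interval from 0 to [pi], the sine of the
    displacement gives its sign. *)
Lemma uni_lift_moves s (f : circle_lift R) t : lifts_mx (uni s) f -> f 0 = 0 -> 0 < t < pi ->
  (0 < s -> f t < t) /\ (s < 0 -> t < f t).
Proof.
move=> l f0 t01; have [c c0 e] := l t.
have tg : 0 < t - 0 < pi by rewrite subr0.
have := circle_lift_gap f tg; rewrite f0 subr0 => fg.
have sft : 0 < sin (f t) by exact: sin_gt0_pi.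
have st : 0 < sin t by exact: sin_gt0_pi.
have [u1 u2 u3 u4] := uniE s.
have e1 : sin t = c * sin (f t).
  have := congr1 (fun w : 'cV[R]_2 => w 1 0) e.
  by rewrite mulmx2E u3 u4 !mxE /= mul0r add0r mul1r.
have cp : 0 < c by rewrite -(pmulr_lgt0 _ sft) -e1.
have e2 : c * sin (f t - t) = - s * sin t ^+ 2.
  rewrite -cross_dir -crossZ -e /cross !mulmx2E u1 u2 u3 u4 !dirE0 !dirE1; ring.
have st2 : 0 < sin t ^+ 2 by exact: exprn_gt0.
move: t01 fg => /andP[? ?] /andP[? ?].
split=> s0; rewrite ltNge; apply/negP => ge.
  have : 0 <= sin (f t - t) by apply: sin_ge0_pi; apply/andP; split; lra.
  by move=> h; have := mulr_ge0 (ltW cp) h; rewrite e2; nra.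
have : 0 <= sin (- (f t - t)) by apply: sin_ge0_pi; apply/andP; split; lra.
by move=> h; have := mulr_ge0 (ltW cp) h; rewrite sinN mulrN e2; nra.
Qed.

Lemma rot_subproof t : \det (gl2_of (cos t) (- sin t) 0 0) == 1.
Proof. by rewrite det_mx22 !mxE /=; have := cos2Dsin2 t => h; apply/eqP; lra. Qed.

Definition rot t : SL2 R := MkSL2 (rot_subproof t).

Lemma rot_dir t s : rot t *m dir s = dir (s + t).
Proof. by apply: cv2P; rewrite !mulmx2E !mxE /= ?cosD ?sinD; ring. Qed.

Lemma lifts_rot t : lifts_mx (rot t) (shift t).
Proof. by move=> s; exists 1; rewrite ?oner_eq0 // rot_dir scale1r. Qed.

Lemma elliptic_conj A (f : circle_lift R) : tr2 A ^+ 2 < 4 -> lifts_mx A f ->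
  exists (P : SL2 R) (h : circle_lift R) (c : R),
    lifts_mx P h /\ (h * f * h^-1)%g = shift c.
Proof.
move=> tA lf; have d := SL2_det A.
pose D := Num.sqrt (4 - tr2 A ^+ 2).
have D2 : D ^+ 2 = 4 - tr2 A ^+ 2 by rewrite sqr_sqrtr // subr_ge0 ltW.
have D0 : 0 < D by rewrite sqrtr_gt0 subr_gt0.
have a10 : A 1 0 != 0.
  by apply/eqP => e; move: tA d; rewrite /tr2 e mulr0 subr0 => h1 h2;
    have := sqr_ge0 (A 0 0 - A 1 1); nra.
(* The matrix [S] below intertwines [A] with a rotation of cosine [tr2 A / 2]; [e] is the sense of
   this rotation, and [q ^+ 2 = k] is forced by the lower left entry of [A S = S rot], given that
   [\det S = 1]. *)
pose k := `|A 1 0| * 2 / D; have k0 : 0 < k by rewrite divr_gt0 ?mulr_gt0 ?normr_gt0.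
pose e := Num.sg (A 1 0); have e2 : e * e = 1 by rewrite -expr2 sqr_sg a10.
pose q := Num.sqrt k; have q2 : q ^+ 2 = k by rewrite sqr_sqrtr // ltW.
have q0 : 0 < q by rewrite sqrtr_gt0.
pose S : 'M[R]_2 := \matrix_(i, j) if i == 0 then
  (if j == 0 then q^-1 else e * (A 0 0 - A 1 1) / (D * q)) else (if j == 0 then 0 else q).
have dS : \det S == 1 by rewrite det_mx22 !mxE /= mulr0 subr0 mulVf // gt_eqF.
pose SS := MkSL2 dS.
have S2 : `|A 1 0| = e * A 1 0 by rewrite /e -normrEsg.
have [h hl] := lifts_mx_exists (SS^-1)%g.
have n1 : (tr2 A / 2) ^+ 2 + (e * D / 2) ^+ 2 = 1.
  transitivity ((tr2 A ^+ 2 + (e * e) * D ^+ 2) / 4); first by field.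
  by rewrite e2 D2; field.
have [t [ct st]] : exists t, cos t = tr2 A / 2 /\ sin t = e * D / 2.
  pose v : 'cV[R]_2 := \col_i (if i == 0 then tr2 A / 2 else e * D / 2).
  have v0 : v != 0.
    apply/eqP => ev; have := congr1 (fun w : 'cV[R]_2 => w 0 0) ev.
    have := congr1 (fun w : 'cV[R]_2 => w 1 0) ev; rewrite !mxE /= => x1 x2.
    by move: n1; rewrite x1 x2; lra.
  have [t [c [c0 ev]]] := nonzero_dir v0.
  have x0 := congr1 (fun w : 'cV[R]_2 => w 0 0) ev.
  have x1 := congr1 (fun w : 'cV[R]_2 => w 1 0) ev; rewrite !mxE /= in x0 x1.
  have c1 : c = 1.
    have ht := cos2Dsin2 t; move: n1; rewrite x0 x1 => n1.
    have : c ^+ 2 = 1 by rewrite -n1 -[LHS]mulr1 -ht; ring.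
    by move/eqP; rewrite sqrf_eq1 => /orP[] /eqP // cN; move: c0; rewrite cN; lra.
  by exists t; rewrite x0 x1 c1 !mul1r.
have qn : q != 0 by rewrite gt_eqF.
have Dn : D != 0 by rewrite gt_eqF.
have q2' : q ^+ 2 * D = 2 * (e * A 1 0) by rewrite q2 /k S2; field.
have comm : (A * SS)%g = (SS * rot t)%g.
  apply: SL2P; rewrite !SL2_mulE.
  have s00 : SS 0 0 = q^-1 by rewrite mxE.
  have s01 : SS 0 1 = e * (A 0 0 - A 1 1) / (D * q) by rewrite mxE.
  have s10 : SS 1 0 = 0 by rewrite mxE.
  have s11 : SS 1 1 = q by rewrite mxE.
  have r00 : rot t 0 0 = cos t by rewrite mxE /= addr0.
  have r01 : rot t 0 1 = - sin t by rewrite mxE /= addr0.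
  have r10 : rot t 1 0 = sin t by rewrite mxE /= opprK add0r.
  have r11 : rot t 1 1 = cos t by rewrite mxE /= subr0.
  rewrite s00 s01 s10 s11 r00 r01 r10 r11 ct st /tr2.
  split.
  - transitivity ((A 0 0 + A 1 1 + (e * e) * (A 0 0 - A 1 1)) / (2 * q)).
      by rewrite e2; field.
    by field; rewrite qn Dn.
  - apply: (mulfI (x := 2 * e * D * q)); first by rewrite !mulf_neq0 //; apply/eqP => e0;
    move: e2; rewrite e0; lra.
    transitivity (2 * (e * e) * A 0 0 * (A 0 0 - A 1 1) + 2 * e * A 0 1 * (q ^+ 2 * D)).
      by field; rewrite qn Dn.
    transitivity (- (e * e) * D ^+ 2 + (e * e) * (A 0 0 - A 1 1) * (A 0 0 + A 1 1)); last first.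
      by field; rewrite qn Dn.
    rewrite q2' D2 /tr2.
    transitivity ((e * e) * (2 * A 0 0 * (A 0 0 - A 1 1) + 4 * A 0 1 * A 1 0)); first by ring.
    by rewrite e2; lra.
  - apply: (mulfI (x := 2 * q)); first by rewrite mulf_neq0.
    transitivity (2 * (e * e) * A 1 0); first by rewrite e2; field.
    transitivity (e * (q ^+ 2 * D)); first by rewrite q2'; ring.
    by field.
  - apply: (mulfI (x := 2 * D * q)); first by rewrite !mulf_neq0.
    transitivity (2 * (e * A 1 0) * (A 0 0 - A 1 1) + 2 * A 1 1 * (q ^+ 2 * D)).
      by field; rewrite qn Dn.
    transitivity ((A 0 0 + A 1 1) * (q ^+ 2 * D)); last by field.
    by rewrite q2'; ring.
have er : (SS^-1 * A * SS^-1^-1)%g = rot t by rewrite invgK -mulgA comm mulKg.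
have l1 : lifts_mx (SS^-1 * A * SS^-1^-1)%g (h * f * h^-1)%g.
  by apply: lifts_mx_mul; [exact: lifts_mx_mul|exact: lifts_mx_inv].
rewrite er in l1.
have [n en] := lifts_mx_unique l1 (lifts_rot t).
exists (SS^-1)%g, h, (t + n%:~R * pi); split=> //.
by rewrite en; apply: circle_liftP_eq => y; rewrite circle_lift_mulE turnE !shiftE addrA.
Qed.

End TriangularPairs.

(** * Pairs of circle actions preserving a monotone curve *)

Section CurveDynamics.
Variable R : realType.
Implicit Types (D : set (R * R)) (f g h k : circle_lift R) (a b x y : R).

Definition preserved D f g := forall a b, D (f a, g b) <-> D (a, b).

Definition swap_curve D : set (R * R) := [set z | D (z.2, z.1)].

Lemma swap_monotone D : monotone_curve D -> monotone_curve (swap_curve D).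
Proof.
move=> mD; split.
- apply: (@closed_comp _ _ (fun z : R * R => (z.2, z.1))); last exact: (mc_closed mD).
  have c1 (z : R * R) : {for z, continuous (fun w : R * R => w.2)} by exact: cvg_snd.
  have c2 (z : R * R) : {for z, continuous (fun w : R * R => w.1)} by exact: cvg_fst.
  by move=> z _; exact: (cvg_pair (c1 z) (c2 z)).
- by move=> n x y /(mc_addz mD n).
- move=> x y x' y' h h' xx; rewrite leNgt; apply/negP => yy.
  by have := mc_mono mD h' h yy; rewrite leNgt xx.
- move=> x y; rewrite /swap_curve /= => h /(mc_addz mD (-1)).
  rewrite mulN1r -[(y + pi) - pi]addrA subrr addr0 => h'.
  by apply: (mc_jump mD h'); rewrite subrK.
Qed.

Lemma swap_preserved D f g : preserved D f g -> preserved (swap_curve D) g f.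
Proof. by move=> h a b; exact: h. Qed.

Definition conj_curve h k D : set (R * R) :=
  [set z | D ((h^-1)%g z.1, (k^-1)%g z.2)].

Lemma conj_monotone h k D : monotone_curve D -> monotone_curve (conj_curve h k D).
Proof.
move=> mD; split.
- apply: (@closed_comp _ _ (fun z : R * R => ((h^-1)%g z.1, (k^-1)%g z.2)));
  last exact: (mc_closed mD).
  move=> z _.
  have c1 : {for z, continuous (fun w : R * R => (h^-1)%g w.1)}.
    by apply: (@continuous_comp _ _ _ fst); [exact: cvg_fst|exact: circle_lift_cts].
  have c2 : {for z, continuous (fun w : R * R => (k^-1)%g w.2)}.
    by apply: (@continuous_comp _ _ _ snd); [exact: cvg_snd|exact: circle_lift_cts].
  exact: (cvg_pair c1 c2).
- by move=> n x y d; have := mc_addz mD n d; rewrite -!circle_lift_addz.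
- move=> x y x' y' d d' xx; rewrite -(circle_lift_le (k^-1)%g).
  by apply: (mc_mono mD d d'); rewrite circle_lift_lt.
- by move=> x y d d'; apply: (mc_jump mD d); rewrite -circle_lift_addpi.
Qed.

Lemma conj_preserved h k D f g : preserved D f g ->
  preserved (conj_curve h k D) (h * f * h^-1)%g (k * g * k^-1)%g.
Proof.
move=> p a b.
have e (u v : circle_lift R) x : (u^-1)%g ((u * v * u^-1)%g x) = v ((u^-1)%g x).
  exact: circle_lift_mulVE.
change (D ((h^-1)%g ((h * f * h^-1)%g a), (k^-1)%g ((k * g * k^-1)%g b)) <->
  D ((h^-1)%g a, (k^-1)%g b)).
by rewrite !e; exact: p.
Qed.

Lemma preserved_mul D f g f' g' : preserved D f g -> preserved D f' g' ->
  preserved D (f * f')%g (g * g')%g.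
Proof. by move=> h h' a b; rewrite !circle_lift_mulE; split=> [/h/h'|/h'/h]. Qed.

Lemma preserved_inv D f g : preserved D f g -> preserved D f^-1%g g^-1%g.
Proof.
move=> h a b; split=> [/h|H]; first by rewrite !circle_lift_mulEV.
by apply/h; rewrite !circle_lift_mulEV.
Qed.

Section Curve.
Variable D : set (R * R).
Hypothesis mD : monotone_curve D.

Lemma preserved_turn (n : int) : preserved D (turn R n) (turn R n).
Proof.
move=> a b; rewrite !turnE; split=> [/(mc_addz mD (- n))|]; last exact: mc_addz.
by rewrite !mulrNz !mulNr !addrK.
Qed.

Lemma preserved_turn_mul (n : int) f g : preserved D f g ->
  preserved D (turn R n * f)%g (turn R n * g)%g.
Proof. exact/preserved_mul/preserved_turn. Qed.

Lemma fibre_lt a b b' : D (a, b) -> D (a, b') -> b' < b + pi.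
Proof.
move=> h h'; have p0 := @pi_gt0 R.
have h1 := mc_addz mD 1 h; rewrite !mul1r in h1.
have le : b' <= b + pi by apply: (mc_mono mD h' h1); lra.
rewrite lt_neqAle le andbT; apply/eqP => e.
by apply: (mc_jump mD h); rewrite -e.
Qed.

(** A turn brings [a'] between [a] and [a + pi] without changing [b' - a']. This bound makes the
    cochain of [curve_euler] bounded and identifies translation amounts in [preserved_shift_eq]. *)
Lemma curve_width a b a' b' : D (a, b) -> D (a', b') -> `|b' - a' - (b - a)| <= pi.
Proof.
move=> h h'; have p0 := @pi_gt0 R.
have [n /andP[n0 n1]] := mod_pi (a' - a).
have hn := mc_addz mD (- n) h'; rewrite !mulrNz !mulNr in hn.
set an := a' - _ in hn; set bn := b' - _ in hn.
have -> : b' - a' - (b - a) = (bn - b) - (an - a) by rewrite /an /bn; ring.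
have {}n0 : a <= an by rewrite /an; lra.
have {}n1 : an < a + pi by rewrite /an; lra.
have hp := mc_addz mD 1 h; rewrite !mul1r in hp.
have u : bn <= b + pi by exact: (mc_mono mD hn hp).
move: n0; rewrite le_eqVlt => /predU1P[e|n0].
  rewrite -e in hn *; have l1 := fibre_lt h hn; have l2 := fibre_lt hn h.
  by rewrite ler_norml; apply/andP; split; lra.
have l := mc_mono mD h hn n0.
by rewrite ler_norml; apply/andP; split; lra.
Qed.

(** The curve may have no point over [a0]; all heights up to [a0] replace the fibre, and they are
    still permuted by [g] when [f] fixes [a0]. *)
Definition below a0 : set R := [set b | exists2 a, a <= a0 & D (a, b)].

Lemma below_ubound a0 : D !=set0 -> has_ubound (below a0).
Proof.
move=> [[x y] h]; have p0 := @pi_gt0 R.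
have [n /andP[n0 n1]] := mod_pi (a0 - x).
have hn := mc_addz mD (n + 1) h; exists (y + (n + 1)%:~R * pi) => b [a aa h'].
apply: (mc_mono mD h' hn); apply: le_lt_trans aa _.
by rewrite intrD mulrDl mul1r; lra.
Qed.

Lemma below_nonempty a0 : D !=set0 -> below a0 !=set0.
Proof.
move=> [[x y] h]; have p0 := @pi_gt0 R.
have [n /andP[n0 n1]] := mod_pi (a0 - x).
have hn := mc_addz mD n h; exists (y + n%:~R * pi), (x + n%:~R * pi) => //; lra.
Qed.

(* The supremum is taken over a set preserved by [g], hence is fixed by [g]. *)
Lemma sup_fixed a0 f g : D !=set0 -> preserved D f g -> f a0 = a0 ->
  g (sup (below a0)) = sup (below a0).
Proof.
move=> D0 p fa; have ub := below_ubound a0 D0; have ne := below_nonempty a0 D0.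
have le f' g' : preserved D f' g' -> f' a0 = a0 -> g' (sup (below a0)) <= sup (below a0).
  move=> p' fa'; rewrite -[leRHS](circle_lift_mulEV g') circle_lift_le.
  apply: ge_sup => // b [a aa h].
  rewrite -(circle_lift_le g') circle_lift_mulEV; apply: ub_le_sup => //.
  by exists (f' a); [rewrite -fa' circle_lift_le|apply/p'].
apply/eqP; rewrite eq_le (le f g) //=.
rewrite -[leLHS](circle_lift_mulEV g) circle_lift_le; apply: le (preserved_inv p) _.
by rewrite -{1}fa circle_lift_mulVE.
Qed.

(** The fibre over [a] is compact and invariant under [g], so its extremities are fixed by [g]. They
    are then in [y0 + pi Z] and less than [pi] apart, so the fibre is a point. *)
Lemma fibre_fixed a b f g y0 : preserved D f g -> f a = a -> g y0 = y0 ->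
  (forall y, g y = y -> exists n : int, y = y0 + n%:~R * pi) ->
  D (a, b) -> exists n : int, b = y0 + n%:~R * pi.
Proof.
move=> p fa gy0 fixg h.
pose V : set R := [set y | D (a, y)].
have Vb : V b by [].
have ub : has_ubound V by exists (b + pi) => y /(fibre_lt h)/ltW.
have lb : has_lbound V by exists (b - pi) => y Vy; have := fibre_lt Vy h; lra.
have V0 : V !=set0 by exists b.
have cV : closed V.
  apply: (@closed_comp _ _ (fun y : R => (a, y))); last exact: (mc_closed mD).
  move=> y _; have c1 : {for y, continuous (fun _ : R => a)} by exact: cvg_cst.
  have c2 : {for y, continuous (fun y : R => y)} by exact: cvg_id.
  exact: (cvg_pair c1 c2).
have Vs : V (sup V) by apply: cV; exact: closure_sup.
have Vi : V (inf V).
  pose W : set R := -%R @` V.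
  have WE : W = (fun y : R => - y) @^-1` V.
    apply/seteqP; split=> [_ [y Vy <-]|y Vy]; first by rewrite /preimage /mkset opprK.
    by exists (- y); rewrite ?opprK.
  have cW : closed W.
    by rewrite WE; apply: closed_comp cV => y _; apply: cvgN; exact: cvg_id.
  have W0 : W !=set0 by exists (- b), b.
  have uW : has_ubound W by case: lb => m hm; exists (- m) => _ [y Vy <-]; rewrite lerN2; exact: hm.
  have [y Vy e] : W (sup W) by apply: cW; exact: closure_sup.
  by rewrite /inf -/W -e opprK.
have Vg y : V y <-> V (g y) by rewrite /V /= -{2}fa; split=> [/p|/p].
have Vg' y : V y -> V ((g^-1)%g y) by move=> Vy; apply/Vg; rewrite circle_lift_mulEV.
have gs : g (sup V) = sup V.
  apply/eqP; rewrite eq_le (ub_le_sup ub ((Vg _).1 Vs)) /=.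
  by rewrite -[leLHS](circle_lift_mulEV g) circle_lift_le (ub_le_sup ub (Vg' _ Vs)).
have gi : g (inf V) = inf V.
  apply/eqP; rewrite eq_le (ge_inf lb ((Vg _).1 Vi)) andbT.
  by rewrite -[leRHS](circle_lift_mulEV g) circle_lift_le (ge_inf lb (Vg' _ Vi)).
have [n en] := fixg _ gs; have [m em] := fixg _ gi.
have sb : b <= sup V by exact: ub_le_sup.
have ib : inf V <= b by exact: ge_inf.
have nm : m = n.
  have : n%:~R * pi < (m + 1)%:~R * pi :> R.
    by rewrite intrD mulrDl mul1r; have := fibre_lt Vi Vs; rewrite en em; lra.
  have : m%:~R * pi <= n%:~R * pi :> R by have := le_trans ib sb; rewrite en em; lra.
  by rewrite intpi_lt intpi_le; lia.
by exists n; apply/eqP; rewrite eq_le; move: sb ib; rewrite en em nm => -> ->.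
Qed.

End Curve.

End CurveDynamics.

(** * Actions on a curve cannot have a common fixed point *)

Section CurveActions.
Variables (R : realType) (Gam : groupType).
Implicit Types (D : set (R * R)) (f g : circle_lift R) (A B : SL2 R) (U : set 'M[R]_2).

Lemma continuous_mulmx2 (P Q : 'M[R]_2) : continuous (fun M : 'M[R]_2 => P *m M *m Q).
Proof.
move=> a V [W WV sWV]; have Fa : Filter (nbhs a) by exact: nbhs_filter.
have ca i j : {for a, continuous (fun M : 'M[R]_2 => (P *m M *m Q) i j)}.
  pose F (M : 'M[R]_2) :=
    (P i 0 * M 0 0 + P i 1 * M 1 0) * Q 0 j + (P i 0 * M 0 1 + P i 1 * M 1 1) * Q 1 j.
  have -> : (fun M : 'M[R]_2 => (P *m M *m Q) i j) = F.
    by apply/funext => M; rewrite !mulmx2E.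
  have c1 k l : {for a, continuous (fun M : 'M[R]_2 => M k l)} by exact: coord_continuous.
  have cc (c : R) : {for a, continuous (fun _ : 'M[R]_2 => c)} by exact: cst_continuous.
  by apply: cvgD; apply: cvgM; try exact: cc; apply: cvgD; apply: cvgM; try exact: cc; exact: c1.
have n i j : \forall M \near nbhs a, W i j ((P *m M *m Q) i j).
  by apply: ca; exact: WV.
suff : \forall M \near nbhs a, V (P *m M *m Q) by [].
apply: filterS (filterI (filterI (n 0 0) (n 0 1)) (filterI (n 1 0) (n 1 1))) => M.
move=> [[h1 h2] [h3 h4]]; apply: sWV => i j.
by case: (ord2_cases i) (ord2_cases j) => -> [] ->.
Qed.

Lemma near_conj (P Q : 'M[R]_2) U : P *m Q = 1%:M -> nbhs (1%:M : 'M[R]_2) U ->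
  nbhs (1%:M : 'M[R]_2) [set M | U (P *m M *m Q)].
Proof. by move=> PQ nU; apply: continuous_mulmx2; rewrite mulmx1 PQ. Qed.

(** Symmetric in the two factors, so that each result holds for both after [curve_action_swap].
    Discreteness is read on matrices near the identity, and [ca_two] asks for points that stay
    distinct modulo turns. *)
Record curve_action (rl rr : Gam -> PSL2 R) D : Prop := CurveAction {
  ca_mull : forall x y, rl (x * y)%g = (rl x * rl y)%g;
  ca_mulr : forall x y, rr (x * y)%g = (rr x * rr y)%g;
  ca_inj : forall x, rl x = 1%g -> rr x = 1%g -> x = 1%g;
  ca_discrete : exists2 U, nbhs (1%:M : 'M[R]_2) U & forall x A B,
    PSL2_of A = rl x -> PSL2_of B = rr x -> U A -> U B -> x = 1%g;
  ca_curve : monotone_curve D;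
  ca_two : exists a b a' b', [/\ D (a, b), D (a', b') &
    forall n : int, ~ (a' = a + n%:~R * pi /\ b' = b + n%:~R * pi)];
  ca_lift : forall x, exists f g, [/\ lifts (rl x) f, lifts (rr x) g & preserved D f g] }.

Lemma curve_action_swap rl rr D : curve_action rl rr D -> curve_action rr rl (swap_curve D).
Proof.
move=> [ml mr inj [U nU dU] cD [a [b [a' [b' [h h' n]]]]] l]; split=> //.
- by move=> x hr hl; exact: inj.
- by exists U => // x A B eA eB UA UB; exact: (dU x B A).
- exact: swap_monotone.
- by exists b, a, b', a'; split=> // k [e1 e2]; apply: (n k).
- by move=> x; have [f [g [lf lg p]]] := l x; exists g, f; split=> //; exact: swap_preserved.
Qed.

Lemma morph1 (r : Gam -> PSL2 R) : (forall x y, r (x * y)%g = (r x * r y)%g) -> r 1%g = 1%g.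
Proof. by move=> m; apply: (mulgI (r 1%g)); rewrite -m !mulg1. Qed.

Lemma morphV (r : Gam -> PSL2 R) : (forall x y, r (x * y)%g = (r x * r y)%g) ->
  forall x, r x^-1%g = (r x)^-1%g.
Proof. by move=> m x; apply: (mulgI (r x)); rewrite -m !mulgV morph1. Qed.

Section Conjugation.
Variable t : R.

Lemma shiftN : (shift t)^-1%g = shift (- t).
Proof.
by apply: (mulgI (shift t)); rewrite mulgV; apply: circle_liftP_eq => x;
  rewrite circle_lift_mulE !shiftE subrK.
Qed.

Lemma lifts_conj_rot A f : lifts (PSL2_of (rot t * A * (rot t)^-1)%g) f ->
  lifts_mx A ((shift t)^-1 * f * shift t)%g.
Proof.
move=> /lifts_of l.
have -> : A = ((rot t)^-1 * (rot t * A * (rot t)^-1) * rot t)%g by rewrite !mulgA mulVg mul1g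
    mulgVK.
have lt := lifts_rot t; have lV := lifts_mx_inv lt.
by apply: lifts_mx_mul => //; exact: lifts_mx_mul.
Qed.

End Conjugation.

(* The group of pairs of representatives with positive diagonal, after the
   rotations taking the fixed directions [dir a] and [dir b] to [dir 0]. *)
Definition triang_rep (rl rr : Gam -> PSL2 R) (a b : R) A B : Prop :=
  [/\ A 1 0 = 0, B 1 0 = 0, 0 < A 0 0 & 0 < B 0 0] /\
  exists x, PSL2_of (rot a * A * (rot a)^-1)%g = rl x /\
            PSL2_of (rot b * B * (rot b)^-1)%g = rr x.

Lemma triang_rep_exists (r : PSL2 R) a : (forall A, PSL2_of A = r -> fixes A (dir a)) ->
  exists A, [/\ A 1 0 = 0, 0 < A 0 0 & PSL2_of (rot a * A * (rot a)^-1)%g = r].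
Proof.
move=> fx; have [C eC] := PSL2_of_surj r.
pose A := ((rot a)^-1 * C * rot a)%g.
have eA : (rot a * A * (rot a)^-1)%g = C by rewrite /A !mulgA mulgV mul1g mulgK.
have a10 : A 1 0 = 0.
  have : fixes A (dir 0).
    rewrite /A -{2}[rot a]invgK; apply/fixes_conj.
    by rewrite invgK rot_dir add0r; exact: fx.
  move/fixesE; rewrite !mxE /= cos0 sin0 => h; lra.
clearbody A.
have d := SL2_det A; rewrite a10 mulr0 subr0 in d.
have [h|h|h] := ltgtP (A 0 0) 0.
- exists (SL2_opp A); split; rewrite ?mxE ?a10 ?oppr0 ?oppr_gt0 //.
  by rewrite SL2_mulN SL2_oppM PSL2_of_opp eA.
- by exists A; split=> //; rewrite eA.
- by move: d; rewrite h mul0r => /eqP; rewrite eq_sym oner_eq0.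
Qed.

Lemma pos_diag_eq A B : A 1 0 = 0 -> 0 < A 0 0 -> 0 < B 0 0 -> PSL2_of A = PSL2_of B -> A = B.
Proof.
move=> a10 a0 b0 /PSL2_of_eq[->//|e].
by exfalso; move: b0; rewrite e mxE oppr_gt0 ltNge (ltW a0).
Qed.

Lemma conjg_eq1 (P A : SL2 R) : PSL2_of (P * A * P^-1)%g = 1%g -> PSL2_of A = 1%g.
Proof.
rewrite !PSL2_ofM PSL2_ofV => h.
by apply: (mulgI (PSL2_of P)); apply: (mulIg (PSL2_of P)^-1%g); rewrite h mulg1 mulgV.
Qed.

Lemma triang_rep_pairs rl rr D a b : curve_action rl rr D -> triangular_pairs (triang_rep rl rr
    a b).
Proof.
move=> ca; split.
- move=> A B A' B' [[h1 h2 h3 h4] [x [ex ex']]] [[k1 k2 k3 k4] [y [ey ey']]]; split.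
    by split; rewrite SL2_mulE ?h1 ?h2 ?k1 ?k2 ?mulr0 ?mul0r ?addr0 // mulr_gt0.
  have e (P X Y : SL2 R) : (P * (X * Y) * P^-1 = (P * X * P^-1) * (P * Y * P^-1))%g.
    by rewrite !mulgA mulgVK.
  exists (x * y)%g; rewrite (ca_mull ca) (ca_mulr ca) -ex -ey -ex' -ey'.
  by rewrite -!PSL2_ofM -!e.
- move=> A B [[h1 h2 h3 h4] [x [ex ex']]]; split.
    have [i1 _ i3 _] := SL2_invE4 A; have [j1 _ j3 _] := SL2_invE4 B.
    have d := SL2_det A; have d' := SL2_det B; rewrite h1 mulr0 subr0 in d;
      rewrite h2 mulr0 subr0 in d'.
    rewrite i1 i3 j1 j3 h1 h2 oppr0; split=> //.
      by rewrite -(pmulr_rgt0 _ h3) d.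
    by rewrite -(pmulr_rgt0 _ h4) d'.
  have e (P X : SL2 R) : (P * X^-1 * P^-1 = (P * X * P^-1)^-1)%g by rewrite !invgM invgK mulgA.
  by exists x^-1%g; rewrite !e !PSL2_ofV ex ex' !morphV //;
    [exact: (ca_mulr ca)|exact: (ca_mull ca)].
- by move=> A B [[]].
- have [U nU dU] := ca_discrete ca.
  have rV (t : R) : rot t *m (rot t)^-1%g = 1%:M.
    exact: (congr1 (@SL2_mx R) (mulgV (rot t))).
  have nl := near_conj (rV a) nU; have nr := near_conj (rV b) nU.
  exists ([set M | U (rot a *m M *m (rot a)^-1%g)] `&` [set M | U (rot b *m M *m (rot b)^-1%g)]).
    exact: filterI.
  move=> A B [[h1 h2 h3 h4] [x [ex ex']]] [UA _] [_ UB].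
  have x1 := dU x _ _ ex ex' UA UB; rewrite x1 (morph1 (ca_mull ca)) in ex.
  rewrite x1 (morph1 (ca_mulr ca)) in ex'.
  have p1 : 0 < (1%g : SL2 R) 0 0 by have [-> _ _ _] := SL2_oneE R.
  by split; apply: pos_diag_eq => //; rewrite PSL2_of1; [exact: conjg_eq1 ex|exact: conjg_eq1 ex'].
Qed.

Lemma lift_normalize D (x : PSL2 R) (y : PSL2 R) a A f g : monotone_curve D ->
  PSL2_of A = x -> fixes A (dir a) -> lifts x f -> lifts y g -> preserved D f g ->
  exists f' g', [/\ lifts x f', lifts y g', preserved D f' g' & f' a = a].
Proof.
move=> mD eA fA lf lg p; rewrite -eA in lf; have lm := lifts_of lf.
have [c c0 e] := lm a.
have : cross (dir a) (dir (f a)) = 0.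
  by move: fA; rewrite /fixes e crossZ => /eqP; rewrite mulf_eq0 (negbTE c0) /= => /eqP.
move=> /dir_par[n en].
exists (turn R (- n) * f)%g, (turn R (- n) * g)%g; split.
- by rewrite -[x]mul1g -eA; apply: lifts_mul => //; exact: lifts_turn.
- by exact: lifts_turn_mul.
- exact: preserved_turn_mul.
- by rewrite circle_lift_mulE turnE en mulrNz mulNr addrK.
Qed.

Lemma lift_fixes A f a : lifts_mx A f -> f a = a -> fixes A (dir a).
Proof.
by move=> l e; have [c c0 h] := l a; rewrite /fixes h e crossZ crossvv mulr0.
Qed.

Lemma curve_nonempty rl rr D : curve_action rl rr D -> D !=set0.
Proof. by move=> ca; have [a [b [_ [_ [h _ _]]]]] := ca_two ca; exists (a, b). Qed.

Lemma lift_moves s f a y : lifts_mx (uni s) ((shift a)^-1 * f * shift a)%g -> f a = a ->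
  (forall n : int, y <> a + n%:~R * pi) ->
  (0 < s -> f y < y) /\ (s < 0 -> y < f y).
Proof.
move=> l fa ny; set k := (_ * _ * _)%g in l.
have kE z : k z = f (z + a) - a by rewrite /k shiftN.
have k0 : k 0 = 0 by rewrite kE add0r fa subrr.
have [n /andP[n0 n1]] := mod_pi (y - a).
set z := y - a - _ in n0 n1.
have z0 : 0 < z.
  by rewrite lt_neqAle n0 andbT; apply/eqP => e; apply: (ny n); move: e; rewrite /z; lra.
have z01 : 0 < z < pi by rewrite z0.
have [m1 m2] := uni_lift_moves l k0 z01.
have e : k z - z = f y - y.
  have -> : y = z + a + n%:~R * pi by rewrite /z; ring.
  by rewrite kE circle_lift_addz; ring.
by split=> /[dup] s0 => [/m1|/m2] h; rewrite -subr_gt0 -?[y - f y]opprB -?[f y - y]e; lra.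
Qed.

(* The other action fixes the supremum [b] of the part of the curve below the fixed
   point [a], and two unipotents moving their points in opposite directions force
   the curve to be the orbit of [(a, b)] under the turns. *)
Theorem no_common_fixed rl rr D v : curve_action rl rr D -> ~ abelian_group Gam ->
  v != 0 -> (forall x A, PSL2_of A = rl x -> fixes A v) -> False.
Proof.
move=> ca nab v0 fx; have mD := ca_curve ca; have D0 := curve_nonempty ca.
have [a [c [c0 ev]]] := nonzero_dir v0.
have fa x A : PSL2_of A = rl x -> fixes A (dir a).
  move=> /fx; rewrite ev => /(fixesZ c^-1); by rewrite scalerA mulVf ?gt_eqF // scale1r.
pose b := sup (below D a).
have lft x : exists f g, [/\ lifts (rl x) f, lifts (rr x) g, preserved D f g, f a = a & g b = b].
  have [f [g [lf lg p]]] := ca_lift ca x.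
  have [A eA] := PSL2_of_surj (rl x).
  have [f' [g' [lf' lg' p' fa']]] := lift_normalize mD eA (fa x A eA) lf lg p.
  by exists f', g'; split=> //; exact: sup_fixed.
have fb x B : PSL2_of B = rr x -> fixes B (dir b).
  move=> eB; have [f [g [_ lg _ _ gb]]] := lft x.
  by rewrite -eB in lg; exact: lift_fixes (lifts_of lg) gb.
have tH := triang_rep_pairs a b ca.
have rep x : exists A B, triang_rep rl rr a b A B /\
    (PSL2_of (rot a * A * (rot a)^-1)%g = rl x /\ PSL2_of (rot b * B * (rot b)^-1)%g = rr x).
  have [A [a1 a2 a3]] := triang_rep_exists (fa x).
  have [B [b1 b2 b3]] := triang_rep_exists (fb x).
  by exists A, B; split=> //; split=> //; exists x.
(* If all commutators of representing pairs were trivial, the images would commute, and so would the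
   elements of [Gam] by [ca_inj]. *)
have [s [t [[_ [x [ex ex']]] st]]] : exists s t, triang_rep rl rr a b (uni s) (uni t) /\ s * t < 0.
  apply: (noncommuting_unipotents tH); apply: contrapT => no; apply: nab => x y.
  have [A [B [h [eA eB]]]] := rep x; have [A' [B' [h' [eA' eB']]]] := rep y.
  have [cA cB] : (A * A' * A^-1 * A'^-1)%g = 1%g /\ (B * B' * B^-1 * B'^-1)%g = 1%g.
    by split; apply: contrapT => n; apply: no; exists A, B, A', B'; split=> //; [left|right].
  have cm (X Y : SL2 R) : (X * Y * X^-1 * Y^-1)%g = 1%g -> (X * Y = Y * X)%g.
    by move=> e; rewrite -[RHS]mul1g -e !mulgA mulgVK mulgVK.
  have cj (P X Y : SL2 R) : (X * Y = Y * X)%g ->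
      ((PSL2_of (P * X * P^-1)) * (PSL2_of (P * Y * P^-1)) = (PSL2_of (P * Y * P^-1)) * (PSL2_of
          (P * X * P^-1)))%g.
    by move=> e; rewrite -!PSL2_ofM !mulgA !(mulgVK P) -(mulgA P) e mulgA.
  have e1 := cj (rot a) _ _ (cm _ _ cA); have e2 := cj (rot b) _ _ (cm _ _ cB).
  rewrite eA eA' in e1; rewrite eB eB' in e2.
  have z : (x * y * (y * x)^-1)%g = 1%g.
    apply: (ca_inj ca).
      by rewrite (ca_mull ca) (morphV (ca_mull ca)) !(ca_mull ca) e1 mulgV.
    by rewrite (ca_mulr ca) (morphV (ca_mulr ca)) !(ca_mulr ca) e2 mulgV.
  by rewrite -[LHS](mulgVK (y * x)%g) z mul1g.
have [f [g [lf lg p fa' gb']]] := lft x.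
rewrite -ex in lf; rewrite -ex' in lg.
have lf0 := lifts_conj_rot lf; have lg0 := lifts_conj_rot lg.
have s0 : s != 0 by apply/eqP => e; move: st; rewrite e mul0r ltxx.
have t0 : t != 0 by apply/eqP => e; move: st; rewrite e mulr0 ltxx.
have fixE (u : R) h (c1 : R) : u != 0 -> lifts_mx (uni u) ((shift c1)^-1 * h * shift c1)%g -> h
    c1 = c1 ->
    forall y, h y = y -> exists n : int, y = c1 + n%:~R * pi.
  move=> u0 l hc y hy; apply: contrapT => n.
  have [m1 m2] : (0 < u -> h y < y) /\ (u < 0 -> y < h y).
    by apply: lift_moves l hc _ => k e; apply: n; exists k.
  have [up|un|ue] := ltgtP 0 u; last by rewrite -ue eqxx in u0.
    by have := m1 up; rewrite hy ltxx.
  by have := m2 un; rewrite hy ltxx.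
have onA y z : D (y, z) -> (exists n : int, y = a + n%:~R * pi) -> exists n : int,
  z = b + n%:~R * pi.
  move=> h [n en]; apply: (fibre_fixed mD p _ gb' (fixE _ _ _ t0 lg0 gb') h).
  by rewrite en circle_lift_addz fa'.
have onB y z : D (y, z) -> (exists n : int, z = b + n%:~R * pi) -> exists n : int,
  y = a + n%:~R * pi.
  move=> h [n en].
  have h' : swap_curve D (z, y) by [].
  apply: (fibre_fixed (swap_monotone mD) (swap_preserved p) _ fa' (fixE _ _ _ s0 lf0 fa') h').
  by rewrite en circle_lift_addz gb'.
(* Elsewhere [f] and [g] move the two coordinates strictly in opposite directions, against
   [mc_mono]. *)
have all y z : D (y, z) -> exists n : int, y = a + n%:~R * pi.
  move=> h; apply: contrapT => ny.
  have nz : ~ exists n : int, z = b + n%:~R * pi by move=> /(onB _ _ h).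
  have [f1 f2] : (0 < s -> f y < y) /\ (s < 0 -> y < f y).
    by apply: lift_moves lf0 fa' _ => k e; apply: ny; exists k.
  have [g1 g2] : (0 < t -> g z < z) /\ (t < 0 -> z < g z).
    by apply: lift_moves lg0 gb' _ => k e; apply: nz; exists k.
  have h2 : D (f y, g z) by apply/p.
  have [sp|sn|se] := ltgtP 0 s; last by rewrite -se eqxx in s0.
    have tn : t < 0 by rewrite -(pmulr_rlt0 _ sp).
    by have := mc_mono mD h2 h (f1 sp); rewrite leNgt g2.
  have tp : 0 < t by rewrite -(nmulr_rlt0 _ sn).
  by have := mc_mono mD h h2 (f2 sn); rewrite leNgt g1.
(* After a turn the two points have the same first coordinate; their second coordinates are in
   [b + pi Z] and less than [pi] apart, hence equal. *)
have [y [z [y' [z' [h h' n]]]]] := ca_two ca.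
have [i ei] := all _ _ h; have [i' ei'] := all _ _ h'.
have [j ej] := onA _ _ h (all _ _ h); have [j' ej'] := onA _ _ h' (all _ _ h').
have h2 := mc_addz mD (i - i') h'.
have ye : y' + (i - i')%:~R * pi = y by rewrite ei ei' intrB; ring.
rewrite ye in h2.
have l1 := fibre_lt mD h h2; have l2 := fibre_lt mD h2 h.
have jj : j' + (i - i') = j.
  move: l1 l2; rewrite ej ej' => l1 l2.
  have : (j' + (i - i'))%:~R * pi < (j + 1)%:~R * pi :> R by rewrite !intrD !mulrDl mul1r; lra.
  have : j%:~R * pi < (j' + (i - i') + 1)%:~R * pi :> R by rewrite !intrD !mulrDl mul1r; lra.
  by rewrite !intpi_lt; lia.
apply: (n (i' - i)); split; first by rewrite ei ei' intrB; ring.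
by rewrite ej ej' -jj !intrD !mulrNz; ring.
Qed.

End CurveActions.

(** * Irrational rotations straighten the curve *)

Section EllipticElements.
Variables (R : realType) (Gam : groupType).
Implicit Types (D : set (R * R)) (f g : circle_lift R) (A B : SL2 R) (c : R).

(** Otherwise the group $\mathbb Zc+\mathbb Z\pi$ would be cyclic, and [c] a rational multiple of
    [pi]. *)
Lemma small_combination c :
  (forall (k : nat) (l : int), (0 < k)%N -> k%:R * c <> l%:~R * pi) ->
  forall e : R, 0 < e -> exists m n : int, 0 < m%:~R * c + n%:~R * pi < e.
Proof.
move=> irr e e0; apply: contrapT => no; have p0 := @pi_gt0 R.
pose G (z : R) := exists m n : int, z = m%:~R * c + n%:~R * pi.
have Gsub (k : int) z w : G z -> G w -> G (z - k%:~R * w).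
  move=> [m [n ->]] [m' [n' ->]]; exists (m - k * m'), (n - k * n').
  by rewrite !intrB !intrM; ring.
pose S : set R := [set z | 0 < z /\ G z].
have Gpi : G pi by exists 0, 1; rewrite mul0r add0r mul1r.
have Gc : G c by exists 1, 0; rewrite mul0r addr0 mul1r.
have Se z : S z -> e <= z.
  by move=> [z0 [m [n ez]]]; rewrite leNgt; apply/negP => ze; apply: no; exists m, n;
    rewrite -ez z0.
have Spi : S pi by split.
have hS : has_inf S by split; [exists pi|exists e => z /Se].
have [x Sx xi] := inf_adherent e0 hS.
(* Distinct elements of [S] less than [e] apart would have a positive difference in the group below
   [e]; so [x] is the least element, and it generates the group. *)
have uniq y : S y -> y < inf S + e -> y = x.
  move=> Sy yi; have lx : inf S <= x by apply: ge_inf Sx; exact: hS.2.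
  have ly : inf S <= y by apply: ge_inf Sy; exact: hS.2.
  have [h|h|//] := ltgtP y x.
    have : S (x - 1%:~R * y) by split; [rewrite mul1r subr_gt0|exact: Gsub Sx.2 Sy.2].
    by move/Se; rewrite mul1r; lra.
  have : S (y - 1%:~R * x) by split; [rewrite mul1r subr_gt0|exact: Gsub Sy.2 Sx.2].
  by move/Se; rewrite mul1r; lra.
have xmin y : S y -> x <= y.
  move=> Sy; rewrite leNgt; apply/negP => yx.
  by have e1 := uniq y Sy (lt_trans yx xi); move: yx; rewrite e1 ltxx.
have x0 : 0 < x by case: Sx.
have mult z : G z -> exists k : int, z = k%:~R * x.
  move=> Gz; exists (Num.floor (z / x)); set k := Num.floor _.
  have /andP[l1 l2] := floor_itv (z / x); rewrite -/k in l1 l2.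
  rewrite intrD in l2.
  have d0 : 0 <= z - k%:~R * x by rewrite subr_ge0 -ler_pdivlMr.
  have d1 : z - k%:~R * x < x.
    by rewrite ltrBlDl -[X in _ + X]mul1r -mulrDl -ltr_pdivrMr.
  apply/eqP; rewrite -subr_eq0 eq_le d0 andbT leNgt; apply/negP => d2.
  have : S (z - k%:~R * x) by split=> //; exact: Gsub Gz Sx.2.
  by move/xmin; rewrite leNgt d1.
have [k ek] := mult _ Gpi; have [l el] := mult _ Gc.
have k0 : 0 < k.
  by have := p0; rewrite ek pmulr_lgt0 // -[0]/(0%:~R) ltr_int.
apply: (irr `|k|%N l); first by lia.
have -> : (`|k|%N)%:R = k%:~R :> R by rewrite -[in RHS](gtz0_abs k0).
by rewrite ek el; ring.
Qed.

Section Translations.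
Variables (D : set (R * R)) (c : R).
Hypothesis mD : monotone_curve D.
Hypothesis pD : preserved D (shift c) (shift c).
Hypothesis irr : forall (k : nat) (l : int), (0 < k)%N -> k%:R * c <> l%:~R * pi.

Lemma preserved_shiftz (m : int) a b : D (a, b) -> D (a + m%:~R * c, b + m%:~R * c).
Proof.
have pos (n : nat) x y : D (x, y) -> D (x + n%:R * c, y + n%:R * c).
  elim: n x y => [|n IH] x y; first by rewrite !mul0r !addr0.
  by move=> /IH/pD; rewrite !shiftE -natr1 !mulrDl !mul1r !addrA.
have neg (n : nat) x y : D (x, y) -> D (x - n%:R * c, y - n%:R * c).
  elim: n x y => [|n IH] x y; first by rewrite !mul0r !subr0.
  move=> /IH h; apply/pD; rewrite !shiftE -natr1.
  by move: h; congr (D (_, _)); ring.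
case: m => n; first exact: pos.
rewrite NegzE mulrNz !mulNr; exact: neg.
Qed.

Lemma dense_orbit (u e : R) : 0 < e -> exists m n : int, u - e < m%:~R * c + n%:~R * pi < u.
Proof.
move=> e0; have [m [n /andP[d0 d1]]] := small_combination irr (divr_gt0 e0 (ltr0n _ 2)).
set d := m%:~R * c + n%:~R * pi in d0 d1.
have ed : m%:~R * c + n%:~R * pi = d by [].
clearbody d; pose k := Num.floor ((u - e / 2) / d).
have /andP[l1 l2] := floor_itv ((u - e / 2) / d); rewrite -/k in l1 l2.
rewrite intrD in l2.
have h1 : k%:~R * d <= u - e / 2 by rewrite -ler_pdivlMr.
have h2 : u - e / 2 < k%:~R * d + d.
  by have := l2; rewrite ltr_pdivrMr // mulrDl mul1r.
exists (k * m), (k * n).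
have -> : (k * m)%:~R * c + (k * n)%:~R * pi = k%:~R * d by rewrite !intrM -ed; ring.
by apply/andP; split; lra.
Qed.

Lemma orbit_point (m n : int) a b : D (a, b) ->
  D (a + (m%:~R * c + n%:~R * pi), b + (m%:~R * c + n%:~R * pi)).
Proof. by move=> /(preserved_shiftz m)/(mc_addz mD n); rewrite -!addrA. Qed.

(** Dense diagonal translates of one point come arbitrarily close to the other from the left, where
    monotonicity compares the heights. *)
Lemma constant_shift a b a' b' : D (a, b) -> D (a', b') -> b - a = b' - a'.
Proof.
have le x y x' y' : D (x, y) -> D (x', y') -> y - x <= y' - x'.
  move=> h h'; apply/ler_addgt0Pr => e e0.
  have [m [n /andP[d0 d1]]] := dense_orbit (x' - x) e0.
  have hn := orbit_point m n h; set d := m%:~R * c + n%:~R * pi in d0 d1 hn.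
  have : y + d <= y' by apply: (mc_mono mD hn h'); lra.
  lra.
by move=> h h'; apply/eqP; rewrite eq_le !le.
Qed.

Lemma full_graph a b x : D (a, b) -> D (x, x + (b - a)).
Proof.
move=> h; pose X : set R := [set y | D (y, y + (b - a))].
have cX : closed X.
  apply: (@closed_comp _ _ (fun y : R => (y, y + (b - a)))); last exact: (mc_closed mD).
  move=> y _; have c1 : {for y, continuous (fun y : R => y)} by exact: cvg_id.
  have c2 : {for y, continuous (fun y : R => y + (b - a))}.
    by apply: cvgD; [exact: cvg_id|exact: cvg_cst].
  exact: (cvg_pair c1 c2).
apply: cX => U /nbhs_ballP[e /= e0 sU].
have [m [n /andP[d0 d1]]] := dense_orbit (x - a) e0.
exists (a + (m%:~R * c + n%:~R * pi)); split.
  rewrite /X /mkset; have -> : a + (m%:~R * c + n%:~R * pi) + (b - a) = b + (m%:~R * c + n%:~R *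
      pi) by ring.
  exact: orbit_point.
by apply: sU; rewrite /ball /= ltr_distl; apply/andP; split; lra.
Qed.

End Translations.

Lemma shift_iter (c : R) (n : nat) t : (shift c ^+ n)%g t = t + n%:R * c.
Proof.
elim: n t => [|n IH] t; first by rewrite mul0r addr0.
by rewrite expgS circle_lift_mulE IH shiftE -natr1; ring.
Qed.

(** The iterates of one point drift from the diagonal by [n (c' - c)], while [curve_width] bounds
    the drift: the translation numbers agree. *)
Lemma preserved_shift_eq D (c c' : R) : monotone_curve D -> D !=set0 ->
  preserved D (shift c) (shift c') -> c' = c.
Proof.
move=> mD [[a b] h] p; have p0 := @pi_gt0 R.
have it (n : nat) : D (a + n%:R * c, b + n%:R * c').
  elim: n => [|n IH]; first by rewrite !mul0r !addr0.
  have /p := IH; rewrite !shiftE -natr1; congr (D (_, _)); ring.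
have bd (n : nat) : n%:R * `|c' - c| <= pi.
  have := curve_width mD h (it n).
  by rewrite -[n%:R in X in _ -> X]ger0_norm // -normrM; congr (`|_| <= _); ring.
apply/eqP; rewrite -subr_eq0 -normr_le0 leNgt; apply/negP => d0.
have := bd (Num.bound (pi / `|c' - c|)); rewrite leNgt => /negP; apply.
rewrite -ltr_pdivrMr //; apply: archi_boundP.
by apply: divr_ge0; apply: ltW.
Qed.

(* Both lifts of [x] are conjugate to one translation [shift c], with [c / pi]
   irrational as [Gam] is torsion free; the conjugated curve is then invariant under
   a dense group of translations, hence is a line [z.2 = z.1 + d]. *)
Theorem elliptic_conjugate (rl rr : Gam -> PSL2 R) D x A0 :
  torsion_free Gam -> curve_action rl rr D -> PSL2_of A0 = rl x -> tr2 A0 ^+ 2 < 4 ->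
  exists Q : SL2 R, forall y A, PSL2_of A = rl y -> PSL2_of (Q * A * Q^-1)%g = rr y.
Proof.
move=> tf ca eA0 tA0; have mD := ca_curve ca; have D0 := curve_nonempty ca.
have [f [g [lf lg p]]] := ca_lift ca x.
rewrite -eA0 in lf; have lfm := lifts_of lf.
have [B0 eB0] := PSL2_of_surj (rr x).
rewrite -eB0 in lg; have lgm := lifts_of lg.
have nofix_f n a : (turn R n * f)%g a <> a.
  move=> fa; have l : lifts (PSL2_of A0) (turn R n * f)%g.
    by exact: lifts_turn_mul.
  have := fixes_nonelliptic (dir_neq0 a) (lift_fixes (lifts_of l) fa).
  by rewrite leNgt tA0.
(* A fixed point of a lift of [B0] would give, by [sup_fixed] on the swapped curve, one of a lift of
   the elliptic [A0]. *)
have tB0 : tr2 B0 ^+ 2 < 4.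
  rewrite ltNge; apply/negP => /nonelliptic_fixes[v v0 fv].
  have [b [k [k0 ev]]] := nonzero_dir v0.
  have fb : fixes B0 (dir b) by move: fv; rewrite ev => /(fixesZ k^-1);
    rewrite scalerA mulVf ?gt_eqF // scale1r.
  have [d d0 e] := lgm b.
  have : cross (dir b) (dir (g b)) = 0.
    by move: fb; rewrite /fixes e crossZ => /eqP; rewrite mulf_eq0 (negbTE d0) /= => /eqP.
  move=> /dir_par[n en].
  have p' := swap_preserved (preserved_turn_mul mD (- n) p).
  have sD0 : swap_curve D !=set0 by case: D0 => -[a b'] h; exists (b', a).
  have gb : (turn R (- n) * g)%g b = b by rewrite circle_lift_mulE turnE en mulrNz mulNr addrK.
  exact: nofix_f (sup_fixed (swap_monotone mD) sD0 p' gb).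
have [P [h [c [lP ef]]]] := elliptic_conj tA0 lfm.
have [P' [h' [c' [lP' eg]]]] := elliptic_conj tB0 lgm.
pose E := conj_curve h h' D.
have mE : monotone_curve E by exact: conj_monotone.
have cp y z : preserved D y z -> preserved E (h * y * h^-1)%g (h' * z * h'^-1)%g by exact:
    conj_preserved.
have [[a0 b0] E0] : E !=set0.
  case: D0 => -[a b] d; exists (h a, h' b).
  by rewrite /E /conj_curve /mkset !circle_lift_mulVE.
have pE := cp _ _ p; rewrite ef eg in pE.
have cc : c' = c by apply: preserved_shift_eq mE _ pE; exists (a0, b0).
rewrite cc in pE eg.
(* If [k c] is a multiple of [pi], then [x ^+ k] acts trivially in both factors, so [x = 1] as there
   is no torsion, and [A0] would have trace 2 or -2. *)
have irr (k : nat) (l : int) : (0 < k)%N -> k%:R * c <> l%:~R * pi.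
  move=> k0 e.
  have it (w z : circle_lift R) : (w * z * w^-1)%g = shift c -> (z ^+ k)%g = turn R l.
    move=> ez; have ekz : (w * (z ^+ k) * w^-1 = shift c ^+ k)%g.
      rewrite -ez; elim: (k) => [|n IH]; first by rewrite !expg0 mulg1 mulgV.
      by rewrite !expgS -IH !mulgA mulgVK.
    have -> : (z ^+ k = w^-1 * (w * (z ^+ k) * w^-1) * w)%g by rewrite !mulgA mulVg mul1g mulgVK.
    rewrite ekz.
    have -> : (shift c ^+ k)%g = turn R l by apply: circle_liftP_eq => t; rewrite shift_iter e.
    by rewrite -mulgA turnC mulKg.
  have lk (r : PSL2 R) (z : circle_lift R) : lifts r z -> (z ^+ k)%g = turn R l -> (r ^+ k)%g = 1%g.
    move=> lz ez; have lzk : lifts (r ^+ k)%g (z ^+ k)%g.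
      elim: (k) => [|n IH]; first by rewrite !expg0; have := lifts_turn R 0; rewrite turn0.
      by rewrite !expgS; exact: lifts_mul.
    by rewrite ez in lzk; exact: lifts_fun lzk (lifts_turn R l).
  have mk (r : Gam -> PSL2 R) (m : forall y z,
    r (y * z)%g = (r y * r z)%g) : r (x ^+ k)%g = (r x ^+ k)%g.
    by elim: (k) => [|n IH]; rewrite ?expg0 ?morph1 // !expgS m IH.
  have xk : (x ^+ k)%g = 1%g.
    apply: (ca_inj ca).
      by rewrite (mk _ (ca_mull ca)) -eA0; exact: lk lf (it _ _ ef).
    by rewrite (mk _ (ca_mulr ca)) -eB0; exact: lk lg (it _ _ eg).
  have x1 := tf _ _ k0 xk.
  move: eA0; rewrite x1 (morph1 (ca_mull ca)) -PSL2_of1 => /PSL2_of_eq[] eA.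
    have [i1 _ _ i4] := SL2_oneE R; move: tA0.
    by rewrite /tr2 -eA i1 i4; lra.
  have [i1 _ _ i4] := SL2_oneE R; move: tA0.
  have -> : A0 = SL2_opp 1%g by rewrite eA SL2_oppK.
  by rewrite /tr2 !mxE /=; lra.
pose d := b0 - a0.
pose K := (h'^-1 * shift d * h)%g.
have lK : lifts_mx (P'^-1 * rot d * P)%g K.
  have lV := lifts_mx_inv lP'; have lr := lifts_rot d.
  by apply: lifts_mx_mul => //; exact: lifts_mx_mul.
exists (P'^-1 * rot d * P)%g => y A eA.
have [f1 [g1 [lf1 lg1 p1]]] := ca_lift ca y.
have pE1 := cp _ _ p1.
(* The conjugated curve [E] is the graph of [shift d], and a pair preserving a graph is conjugate by
   it. *)
have eg1 : g1 = (K * f1 * K^-1)%g.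
  have e : (h' * g1 * h'^-1 = shift d * (h * f1 * h^-1) * (shift d)^-1)%g.
    apply: circle_liftP_eq => z; set t := ((shift d)^-1)%g z.
    have zt : z = t + d by rewrite -(circle_lift_mulEV (shift d) z).
    have Et := full_graph mE pE irr t E0; rewrite -/d in Et.
    have := (pE1 _ _).2 Et => Et'.
    have := constant_shift mE pE irr E0 Et'; rewrite -/d => ed.
    rewrite zt; have -> : (shift d * (h * f1 * h^-1) * (shift d)^-1)%g (t + d) = (h * f1 *
        h^-1)%g t + d.
      by rewrite -zt circle_lift_mulE -/t circle_lift_mulE shiftE.
    have aux (u v w : R) : w = u - v -> u = v + w by move=> ->; ring.
    exact: aux ed.
  have -> : g1 = (h'^-1 * (h' * g1 * h'^-1) * h')%g by rewrite !mulgA mulVg mul1g mulgVK.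
  by rewrite e /K !invgM !invgK !mulgA.
rewrite -eA in lf1.
have l1 : lifts (PSL2_of ((P'^-1 * rot d * P) * A * (P'^-1 * rot d * P)^-1)%g) g1.
  rewrite eg1; apply: ofP_lifts; have lV := lifts_mx_inv lK; have lA := lifts_of lf1.
  by apply: lifts_mx_mul => //; exact: lifts_mx_mul.
exact: lifts_fun l1 lg1.
Qed.

End EllipticElements.

(** * Faithfulness and discreteness of one factor *)

Section LeftDiscrete.
Variables (R : realType) (Gam : groupType).
Implicit Types (D : set (R * R)) (A B C : SL2 R) (rl rr : Gam -> PSL2 R).

(* If [rl x = 1], the pair [(1, g)] is preserved for some lift [g] of [rr x], so
   [g] and all its conjugates fix a supremum [b]: the orbit of [dir b] consists
   of fixed points of [rr x], of which there are at most two. *)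
Theorem left_injective rl rr D x : torsion_free Gam -> ~ abelian_group Gam ->
  curve_action rl rr D -> rl x = 1%g -> x = 1%g.
Proof.
move=> tf nab ca x1; apply: contrapT => nx; have mD := ca_curve ca.
have D0 := curve_nonempty ca; have [[a0 b0] d0] := D0.
have [f [g [lf lg p]]] := ca_lift ca x.
have [k ef] : exists k, f = turn R k.
  rewrite x1 in lf; have [k e] := lifts_uniq lf (lifts_turn R 0).
  by exists k; rewrite e turn0 mulg1.
have p1 : preserved D 1%g (turn R (- k) * g)%g.
  by have := preserved_turn_mul mD (- k) p; rewrite ef -turnD addNr turn0.
set g1 := (_ * g)%g in p1.
have lg1 : lifts (rr x) g1.
  by exact: lifts_turn_mul.
clearbody g1; have [B eB] := PSL2_of_surj (rr x).
have nB : PSL2_of B <> 1%g by rewrite eB => h; apply: nx; exact: (ca_inj ca x1 h).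
have B1 : B <> 1%g by move=> e; apply: nB; rewrite e.
have BN : B <> SL2_opp 1%g by move=> e; apply: nB; rewrite e PSL2_of_opp.
rewrite -eB in lg1; have lB := lifts_of lg1.
pose b := sup (below D a0).
have fB y C : PSL2_of C = rr y -> fixes B (C *m dir b).
  move=> eC; have [fy [gy [_ lgy py]]] := ca_lift ca y.
  rewrite -eC in lgy; have [c c0 ec] := lifts_of lgy b.
  have q : preserved D 1%g (gy^-1 * g1 * gy)%g.
    have := preserved_mul (preserved_mul (preserved_inv py) p1) py.
    by rewrite mulg1 mulVg.
  have := sup_fixed mD (a0 := a0) D0 q erefl; rewrite -/b => gb.
  have {}gb : g1 (gy b) = gy b by rewrite -{2}gb !circle_lift_mulE circle_lift_mulEV.
  by rewrite ec; apply: fixesZ; exact: lift_fixes lB gb.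
have sca := curve_action_swap ca.
apply: (no_common_fixed sca nab (dir_neq0 b)) => y C eC.
apply: contrapT => nC; have cC : cross (dir b) (C *m dir b) != 0 by apply/eqP.
have eCC : PSL2_of (C * C)%g = rr (y * y)%g by rewrite PSL2_ofM (ca_mulr ca) eC.
have fb : fixes B (dir b).
  have := @fB 1%g 1%g; rewrite SL2_act1; apply.
  by rewrite (morph1 (ca_mulr ca)).
(* [B] fixes the directions [b], [C b] and [C C b], so the last coincides with one of the others. It
   is not [C b]; being [b], it makes the trace of [C] vanish by Cayley-Hamilton, and [C] is
   elliptic. *)
have [h|h] := fixes_third B1 BN cC fb (fB _ _ eC) (fB _ _ eCC); last first.
  by move: h; rewrite SL2_act SL2_cross => h; rewrite h eqxx in cC.
have tC : tr2 C ^+ 2 < 4.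
  have : tr2 C * cross (dir b) (C *m dir b) = 0.
    move: h; rewrite SL2_act cayley_hamilton => <-.
    by rewrite /cross !mxE; ring.
  by move/eqP; rewrite mulf_eq0 (negbTE cC) orbF => /eqP ->; rewrite expr0n /= ltr0n.
(* Now the two factors are conjugate, so [rr x] is trivial along with [rl x]. *)
have [Q hQ] := elliptic_conjugate tf sca eC tC.
by apply: nB; apply: (@conjg_eq1 _ Q); rewrite (hQ x B eB).
Qed.

(** With an elliptic element the factors are conjugate, so a small left matrix comes with a small
    right one and discreteness of the pairs applies. Without one, arbitrarily small elements would
    give a common fixed direction. *)
Theorem left_discrete rl rr D : torsion_free Gam -> ~ abelian_group Gam ->
  curve_action rl rr D -> exists2 U, nbhs (1%:M : 'M[R]_2) U &
  forall x A, PSL2_of A = rl x -> U A -> x = 1%g.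
Proof.
move=> tf nab ca; have [U nU dU] := ca_discrete ca.
pose H : set (SL2 R) := [set A | exists x, PSL2_of A = rl x].
have [[A0 [[x0 e0] t0]]|nell] := pselect (exists A, H A /\ tr2 A ^+ 2 < 4).
  have [Q hQ] := elliptic_conjugate tf ca e0 t0.
  have QV : Q *m (Q^-1)%g = 1%:M by exact: (congr1 (@SL2_mx R) (mulgV Q)).
  exists (U `&` [set M | U (Q *m M *m (Q^-1)%g)]); first by apply: filterI => //; exact: near_conj.
  by move=> x A eA [UA UQ]; exact: (dU x A (Q * A * Q^-1)%g eA (hQ x A eA) UA UQ).
have sH : subgroup2 H.
  split=> [A B [x ex] [y ey]|A [x ex]].
    by exists (x * y)%g; rewrite PSL2_ofM ex ey (ca_mull ca).
  by exists x^-1%g; rewrite PSL2_ofV ex (morphV (ca_mull ca)).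
have nH A : H A -> 4 <= tr2 A ^+ 2.
  by move=> hA; rewrite leNgt; apply/negP => t; apply: nell; exists A.
have [small|] := pselect (forall V, nbhs (1%:M : 'M[R]_2) V -> exists A, [/\ H A, A <> 1%g & V A]).
  have [v [v0 fv]] := small_common_fixed sH nH small.
  by exfalso; apply: (no_common_fixed ca nab v0) => x A eA; apply: fv; exists x.
move=> /existsNP[V] /not_implyP[nV no]; exists V => // x A eA VA.
have A1 : A = 1%g by apply: contrapT => A1; apply: no; exists A; split=> //; exists x.
by apply: (left_injective tf nab ca); rewrite -eA A1.
Qed.

End LeftDiscrete.

(** * Discreteness *)

Section Discreteness.
Variables (R : realType) (Gam : groupType).
Implicit Types (A B C : SL2 R) (r : Gam -> PSL2 R).

(** The saturation of [V] is the union of [V] and [- V]. The sign is written as a product with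
    scalar matrices so that [continuous_mulmx2] applies. *)
Lemma PSL2_open (V : set 'M[R]_2) : open V ->
  open ([set p | exists2 A : SL2 R, PSL2_of A = p & V A] : set (PSL2 R)).
Proof.
move=> oV.
change (open ([set B : SL2 R | exists2 A : SL2 R, PSL2_of A = PSL2_of B & V A])).
have -> : [set B : SL2 R | exists2 A : SL2 R, PSL2_of A = PSL2_of B & V A] =
    (fun B : SL2 R => (B : 'M[R]_2)) @^-1` (V `|` (fun M : 'M[R]_2 =>
      1%:M *m M *m (-1)%:M) @^-1` V).
  have e B : 1%:M *m B *m (-1)%:M = SL2_opp B :> 'M[R]_2.
    by rewrite mul1mx mul_mx_scalar scaleN1r.
  apply/seteqP; split=> B.
    by move=> [A /PSL2_of_eq[->|->] VA]; [left|right; rewrite /preimage /mkset e SL2_oppK].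
  by case=> [VB|]; [exists B|rewrite /preimage /mkset e => VB; exists (SL2_opp B);
    rewrite ?PSL2_of_opp].
exists (V `|` (fun M : 'M[R]_2 => 1%:M *m M *m (-1)%:M) @^-1` V) => //.
apply: openU => //; apply: open_comp oV => M _; exact: continuous_mulmx2.
Qed.

Lemma small_faithful_discrete r (U : set 'M[R]_2) : (forall x y, r (x * y)%g = (r x * r y)%g) ->
  nbhs (1%:M : 'M[R]_2) U -> (forall x A, PSL2_of A = r x -> U A -> x = 1%g) ->
  injective r /\ discrete_subset (range r).
Proof.
move=> m nU hU.
have inj x y : r x = r y -> x = y.
  move=> e; have : (x^-1 * y)%g = 1%g.
    by apply: (hU _ 1%g); [rewrite m (morphV m) e mulVg|exact: nbhs_singleton nU].
  by move=> h; rewrite -[LHS]mulg1 -h mulVKg.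
split=> // _ [x _ <-]; split; first by rewrite inE; exists x.
have [A0 e0] := PSL2_of_surj (r x).
pose V := (fun M : 'M[R]_2 => (A0^-1)%g *m M *m 1%:M) @^-1` U^°.
have oV : open V.
  by apply: open_comp; [move=> M _; exact: continuous_mulmx2|exact: open_interior].
have VA A : V A -> U (A0^-1 * A)%g by rewrite /V /preimage /mkset mulmx1 => /interior_subset.
have V0 : V A0.
  rewrite /V /preimage /mkset mulmx1.
  by have -> : (A0^-1)%g *m A0 = 1%:M :> 'M[R]_2 by exact: (congr1 (@SL2_mx R) (mulVg A0)).
exists [set p | exists2 A : SL2 R, PSL2_of A = p & V A].
  by apply: open_nbhs_nbhs; split; [exact: PSL2_open|exists A0].
apply/seteqP; split=> [p [[A eA vA] [y _ ey]]|_ ->]; last by split; [exists A0|exists x].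
have : (x^-1 * y)%g = 1%g.
  by apply: (hU _ (A0^-1 * A)%g); [rewrite PSL2_ofM PSL2_ofV e0 eA -ey m (morphV m)|exact: VA].
by move=> h; rewrite /= -ey -[x]mulg1 -h mulVKg.
Qed.

Lemma PSL2_near1 (V : set (PSL2 R)) : nbhs (1%g : PSL2 R) V ->
  exists2 U, nbhs (1%:M : 'M[R]_2) U & forall A : SL2 R, U A -> V (PSL2_of A).
Proof.
rewrite nbhsE => -[W [oW W1] sWV].
have [U oU eU] : open ([set B : SL2 R | W (PSL2_of B)]) := oW.
have E B : U (B : 'M[R]_2) <-> W (PSL2_of B).
  change ((((fun B : SL2 R => (B : 'M[R]_2)) @^-1` U) B) <-> W (PSL2_of B)).
  by move/seteqP: eU => [h1 h2]; split=> [/h1|/h2].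
exists U; first by apply: open_nbhs_nbhs; split=> //; apply/(E 1%g).
by move=> A /E; exact: sWV.
Qed.

Lemma faithful_discrete_small r : (forall x y, r (x * y)%g = (r x * r y)%g) ->
  injective r -> discrete_subset (range r) ->
  exists2 U, nbhs (1%:M : 'M[R]_2) U & forall x A, PSL2_of A = r x -> U A -> x = 1%g.
Proof.
move=> m inj d; have [_ [V nV eV]] : isolated (range r) 1%g.
  by apply: d; exists 1%g; rewrite // morph1.
have [U nU hU] := PSL2_near1 nV; exists U => // x A eA UA; apply: inj.
have : (V `&` range r) (r x) by split; [rewrite -eA; exact: hU|exists x].
by rewrite eV morph1.
Qed.

End Discreteness.

Section PairDiscreteness.
Variables (R : realType) (Gam : groupType) (rho : {multiplicative Gam -> (PSL2 R * PSL2 R)%type}).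

Lemma rhoM x y : rho (x * y)%g = (rho x * rho y)%g.
Proof. exact: gmulfM. Qed.

Lemma pair_discrete_small : injective rho -> discrete_subset (range rho) ->
  exists2 U, nbhs (1%:M : 'M[R]_2) U & forall x A B,
    PSL2_of A = (rho x).1 -> PSL2_of B = (rho x).2 -> U A -> U B -> x = 1%g.
Proof.
move=> inj d; have r1 : rho 1%g = 1%g by by apply: (mulgI (rho 1%g)); rewrite -rhoM !mulg1.
have [_ [V [[V1 V2] [n1 n2] sV] eV]] : isolated (range rho) 1%g by apply: d; exists 1%g.
have [U1 nU1 hU1] := PSL2_near1 n1; have [U2 nU2 hU2] := PSL2_near1 n2.
exists (U1 `&` U2); first exact: filterI.
move=> x A B eA eB [UA _] [_ UB]; apply: inj; rewrite r1.
have : (V `&` range rho) (rho x).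
  split; last by exists x.
  by apply: sV; split; rewrite /= -?eA -?eB; [exact: hU1|exact: hU2].
by rewrite eV.
Qed.

Lemma fst_discrete : injective (fst \o rho) -> discrete_subset (range (fst \o rho)) ->
  discrete_subset (range rho).
Proof.
move=> inj d _ [x _ <-]; split; first by rewrite inE; exists x.
have [_ [V nV eV]] : isolated (range (fst \o rho)) (rho x).1 by apply: d; exists x.
exists (V `*` setT); first by exists (V, setT); [split=> //; exact: filterT|].
apply/seteqP; split=> [p [[Vy _] [y _ ey]]|_ ->]; last first.
  split; last by exists x.
  by split=> //; apply: nbhs_singleton.
rewrite -ey in Vy *; suff : (fst \o rho) y = (fst \o rho) x by move=> /inj ->.
have : (V `&` range (fst \o rho)) (rho y).1 by split=> //; exists y.
by rewrite eV.
Qed.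

End PairDiscreteness.

(** * The bounded Euler class *)

Section EulerClass.
Variables (R : realType) (Gam : groupType).
Implicit Types (D : set (R * R)) (f g : circle_lift R) (r : {multiplicative Gam -> PSL2 R}).

Lemma standard_liftP (x : PSL2 R) :
  lifts x (standard_lift x) /\ 0 <= standard_lift x 0 < pi.
Proof.
have [f lf] := lifts_exists x; have [k hk] := mod_pi (f 0).
have h : [set g : circle_lift R | lifts x g /\ 0 <= g 0 < pi] (turn R (- k) * f)%g.
  split; last by rewrite circle_lift_mulE turnE mulrNz mulNr.
  by exact: lifts_turn_mul.
exact: (xgetPex _ (ex_intro _ _ h)).
Qed.

Lemma standard_lift_near (x : PSL2 R) t : `|standard_lift x t - t| <= 2 * pi.
Proof.
have [_ /andP[s0 s1]] := standard_liftP x; have p0 := @pi_gt0 R.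
have [k /andP[k0 k1]] := mod_pi t; set s := standard_lift x in s0 s1 *.
have e : s t = s (t - k%:~R * pi) + k%:~R * pi by rewrite -circle_lift_addz subrK.
have l1 : s 0 <= s (t - k%:~R * pi) by rewrite circle_lift_le.
have l2 : s (t - k%:~R * pi) < s 0 + pi by rewrite -circle_lift_addpi circle_lift_lt add0r.
by rewrite ler_norml; apply/andP; split; lra.
Qed.

Lemma euler_cocycleP r x y : (standard_lift (r x) * standard_lift (r y) =
  turn R (euler_cocycle r x y) * standard_lift (r (x * y)%g))%g.
Proof.
have [l1 _] := standard_liftP (r x); have [l2 _] := standard_liftP (r y).
have [l3 _] := standard_liftP (r (x * y)%g); rewrite gmulfM in l3.
have [k ek] := lifts_uniq (lifts_mul l1 l2) l3.
apply: circle_liftP_eq => t; rewrite [RHS]circle_lift_mulE turnE.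
apply: (@xgetPex _ 0 [set n : int | forall t, (standard_lift (r x) * standard_lift (r y))%g t
  = standard_lift (r (x * y)%g) t + n%:~R * pi]).
by exists k => u; rewrite ek gmulfM.
Qed.

Lemma euler_cocycle_bounded r : bounded_cocycle2 (euler_cocycle r).
Proof.
have p0 := @pi_gt0 R; split.
  exists 2 => x y.
  have := congr1 (fun f : circle_lift R => f 0) (euler_cocycleP r x y).
  rewrite !circle_lift_mulE turnE => e.
  have [_ /andP[a0 a1]] := standard_liftP (r x); have [_ /andP[b0 b1]] := standard_liftP (r y).
  have [_ /andP[c0 c1]] := standard_liftP (r (x * y)%g).
  move: e; set s := standard_lift (r x) in a0 a1 *; set v := standard_lift (r y) 0 in b0 b1 *.
  move=> e; have l1 : s 0 <= s v by rewrite circle_lift_le.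
  have l2 : s v < s 0 + pi by rewrite -circle_lift_addpi circle_lift_lt add0r.
  have : (-2)%:~R * pi <= (euler_cocycle r x y)%:~R * pi :> R by lra.
  have : (euler_cocycle r x y)%:~R * pi <= 2%:~R * pi :> R by lra.
  by rewrite !intpi_le; lia.
move=> x y z; rewrite /coboundary2; set s := fun x => standard_lift (r x).
have E u v : (s u * s v = turn R (euler_cocycle r u v) * s (u * v))%g by exact: euler_cocycleP.
have e1 : (s x * s y * s z = turn R (euler_cocycle r x y + euler_cocycle r (x * y)%g z) * s (x *
    y * z))%g.
  by rewrite E -mulgA E mulgA -turnD.
have e2 : (s x * (s y * s z) = turn R (euler_cocycle r y z + euler_cocycle r x (y * z)%g) * s (x
    * (y * z)))%g.
  by rewrite E mulgA -turnC -mulgA E mulgA -turnD.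
by have := e1; rewrite -mulgA e2 mulgA => /mulIg/turn_inj; lia.
Qed.

Lemma bounded_euler_class_eq (rl rr : {multiplicative Gam -> PSL2 R}) :
  bounded_euler_class rl = bounded_euler_class rr <->
  exists2 b, bounded_cochain1 b &
    forall x y, euler_cocycle rl x y - euler_cocycle rr x y = coboundary1 b x y.
Proof.
split=> [e|[b [M bM] hb]].
  have : bounded_euler_class rl (euler_cocycle rl).
    split; first exact: euler_cocycle_bounded.
    by exists (fun=> 0); [exists 0|move=> x y; rewrite /coboundary1; lia].
  by rewrite e => -[_].
apply/seteqP; split=> c [bc [b' [M' bM'] hb']]; split=> //.
  exists (fun x => b' x + b x); first by exists (M' + M) => x; have := bM x; have := bM' x; lia.
  by move=> x y; have := hb x y; have := hb' x y; rewrite /coboundary1; lia.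
exists (fun x => b' x - b x); first by exists (M' + M) => x; have := bM x; have := bM' x; lia.
by move=> x y; have := hb x y; have := hb' x y; rewrite /coboundary1; lia.
Qed.

Lemma turn_mul2 (k l : int) f g :
  (turn R k * f * (turn R l * g) = turn R (k + l) * (f * g))%g.
Proof. by rewrite turnD !mulgA -(mulgA _ f (turn R l)) -(turnC l f) !mulgA. Qed.

Theorem curve_euler (rl rr : {multiplicative Gam -> PSL2 R}) D :
  curve_action rl rr D -> bounded_euler_class rl = bounded_euler_class rr.
Proof.
move=> ca; have mD := ca_curve ca; have D0 := curve_nonempty ca; have p0 := @pi_gt0 R.
have ex x : exists b, preserved D (standard_lift (rl x)) (turn R b * standard_lift (rr x))%g.
  have [f [g [lf lg p]]] := ca_lift ca x.
  have [k ek] := lifts_uniq (standard_liftP (rl x)).1 lf.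
  have [l el] := lifts_uniq lg (standard_liftP (rr x)).1.
  by exists (k + l); rewrite ek turnD -mulgA -el; exact: preserved_turn_mul.
have [b hb] := choice ex; apply/bounded_euler_class_eq; exists b.
  (* One [pi] from the width of the curve and [2 * pi] from the displacement of each of the two
     standard lifts. *)
  exists 5 => x; have [[u v] d] := D0.
  have := curve_width mD d ((hb x u v).2 d); rewrite circle_lift_mulE turnE.
  have := standard_lift_near (rl x) u; have := standard_lift_near (rr x) v.
  rewrite !ler_norml => /andP[h1 h2] /andP[h3 h4] /andP[h5 h6].
  have : (-5)%:~R * pi <= (b x)%:~R * pi :> R by lra.
  have : (b x)%:~R * pi <= 5%:~R * pi :> R by lra.
  by rewrite !intpi_le; lia.
(* The pairs for [x] and [y], multiplied and divided by the pair for [x * y], leave a pair of turns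
   preserving the curve; their equality is the coboundary relation. *)
move=> x y; have p := preserved_mul (hb x) (hb y); have q := preserved_inv (hb (x * y)%g).
have := preserved_mul p q.
set el := euler_cocycle rl x y; set er := euler_cocycle rr x y.
have -> : (standard_lift (rl x) * standard_lift (rl y) * (standard_lift (rl (x * y)))^-1)%g =
    shift (el%:~R * pi).
  by rewrite euler_cocycleP mulgK.
have -> : (turn R (b x) * standard_lift (rr x) * (turn R (b y) * standard_lift (rr y)) *
    (turn R (b (x * y)) * standard_lift (rr (x * y)))^-1)%g = shift ((b x + b y + er - b (x *
        y)%g)%:~R * pi).
  rewrite turn_mul2 euler_cocycleP mulgA -turnD invgM mulgA mulgK -turnN -turnD //.
move=> /(preserved_shift_eq mD D0)/(mulIf (lt0r_neq0 p0))/intr_inj; rewrite /coboundary1; lia.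
Qed.

End EulerClass.

(** * Admissible representations *)

Section Isometries.
Variable R : realType.
Local Notation cover := (PSL2_cover R).
Implicit Types (F : cover * cover) (z : cover).

(** Commuting with the rotations makes [z] a translation; commuting with a parabolic lift whose
    fixed points lie in [pi Z] makes its amount a multiple of [pi]. *)
Lemma center_turn z : Defs.center z -> exists k : int, z = turn R k :> circle_lift R.
Proof.
move=> cz.
have comm (x : PSL2 R) (f : circle_lift R) t : lifts x f -> z (f t) = f (z t).
  move=> l; have [F <-] := cover_of_lift l.
  by have /(congr1 (fun G : cover => G t)) := cz F.
have zs t : z t = z 0 + t.
  by have := comm _ _ 0 (ofP_lifts (lifts_rot t)); rewrite !shiftE add0r.
have [h lh] := lifts_exists (PSL2_of (uni (1 : R))).
have [u1 u2 u3 u4] := uniE (1 : R).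
have f0 : fixes (uni (1 : R)) (dir 0).
  by apply/fixesE; rewrite u1 u2 u3 u4 dirE0 dirE1 cos0 sin0; ring.
have [m em] : exists m : int, h 0 = 0 + m%:~R * pi.
  have [c c0 e] := lifts_of lh 0; apply: dir_par.
  by move: f0; rewrite /fixes e crossZ => /eqP; rewrite mulf_eq0 (negbTE c0) /= => /eqP.
pose h' := (turn R (- m) * h)%g.
have lh' : lifts (PSL2_of (uni (1 : R))) h'.
  by exact: lifts_turn_mul.
have h0 : h' 0 = 0 by rewrite circle_lift_mulE turnE em mulrNz mulNr add0r subrr.
have hz : h' (z 0) = z 0 by rewrite -(comm _ _ 0 lh') h0.
have := lift_fixes (lifts_of lh') hz; move/fixesE.
rewrite u1 u2 u3 u4 dirE0 dirE1 subrr !mul0r ?add0r mul1r ?sub0r => /eqP.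
rewrite oppr_eq0 sqrf_eq0 => /eqP/sin_eq0[k ek].
by exists k; apply: circle_liftP_eq => t; rewrite zs turnE ek addrC.
Qed.

Lemma turn_center (k : int) : exists2 z : cover, Defs.center z & z = turn R k :> circle_lift R.
Proof.
have [z ez] := cover_of_lift (lifts_turn R k); exists z => // F.
apply: coverP => t; rewrite -[(z * F)%g t]/(z (F t)) -[(F * z)%g t]/(F (z t)).
by rewrite ez !turnE circle_lift_addz.
Qed.

Lemma AdS_isom_ofM F F' : AdS_isom_of (F * F')%g = (AdS_isom_of F * AdS_isom_of F')%g.
Proof. exact/esym/(@quotient_mulE _ (diag_center_normal R)). Qed.

Lemma AdS_isom_of_eq F F' : AdS_isom_of F = AdS_isom_of F' <->
  exists k : int, F.1 = (turn R k * F'.1)%g :> circle_lift R /\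
                  F.2 = (turn R k * F'.2)%g :> circle_lift R.
Proof.
have E := @coset_eqP _ (diag_center_normal R) F' F.
split=> [h|[k [e1 e2]]].
  have [z cz ez] : diag_center (F'^-1 * F)%g.
    by apply: (elimT E); apply/eqP/esym; exact: h.
  have [k ek] := center_turn cz; exists k.
  have {}ez : F = (F' * (z, z))%g by rewrite -ez mulVKg.
  rewrite ez; split; rewrite -[LHS]/(_ * (z : circle_lift R))%g ek; exact/esym/turnC.
have [z cz ez] := turn_center k.
apply/eqP; rewrite eq_sym; apply/E; exists z => //.
apply: (mulgI F'); rewrite mulVKg; case: F F' e1 e2 {E} => [F1 F2] [F1' F2'] /= e1 e2.
congr pair; apply: val_inj => /=.
  by rewrite e1 turnC -ez.
by rewrite e2 turnC -ez.
Qed.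

End Isometries.

Section AdmissibleCurve.
Variables (R : realType) (Gam : groupType) (rho : {multiplicative Gam -> (PSL2 R * PSL2 R)%type}).

Theorem admissible_curve : admissible rho -> exists D,
  curve_action (fun x => (rho x).1) (fun x => (rho x).2) D.
Proof.
move=> [inj disc [rhot [L [lft [[LE cL aL gL] [[q [r [Lq Lr qr]]] pres]]]]]].
have mD := chart_curve LE cL aL gL; exists (chart L); split=> //.
- by move=> x y; rewrite rhoM.
- by move=> x y; rewrite rhoM.
- move=> x h1 h2; apply: inj.
  have -> : rho 1%g = 1%g by apply: (mulgI (rho 1%g)); rewrite -rhoM !mulg1.
  by rewrite [LHS]surjective_pairing h1 h2.
- exact: pair_discrete_small.
- have [a [b eq]] := ein_surj (LE _ Lq); have [a' [b' er]] := ein_surj (LE _ Lr).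
  exists a, b, a', b'; rewrite /chart /= -eq -er; split=> // n [ea eb].
  by apply: qr; rewrite eq er ea eb ein_addz.
move=> x; have [F [eF l1 l2]] := lft x.
have [Phi [F' eF' hF'] PL] := pres x.
have := chart_preserves LE hF' PL => p.
exists F.1, F.2; split=> // a b.
(* The pair that acts and the pair that lifts [rho x] represent one isometry, so they differ by a
   common turn, which preserves the curve. *)
have [k [e1 e2]] := (AdS_isom_of_eq F' F).1 (etrans eF' (esym eF)).
have {}p := preserved_turn_mul mD (- k) (p : preserved (chart L) F'.1 F'.2).
have := p a b; rewrite e1 e2 !mulgA -turnD addNr turn0 !mul1g; exact.
Qed.

End AdmissibleCurve.

(** * From equal Euler classes to an invariant curve *)

Section Semiconjugacy.
Variables (R : realType) (Gam : groupType).
Implicit Types (D : set (R * R)) (f g : circle_lift R) (x y : Gam) (s t a b : R).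

Lemma closure_stable (G : set (R * R)) (f g : R -> R) : continuous f -> continuous g ->
  (forall a b, G (a, b) -> G (f a, g b)) ->
  forall a b, closure G (a, b) -> closure G (f a, g b).
Proof.
move=> cf cg h a b cl B nB.
have c1 : {for (a, b), continuous (fun w : R * R => f w.1)}.
  by apply: (@continuous_comp _ _ _ fst); [exact: cvg_fst|exact: cf].
have c2 : {for (a, b), continuous (fun w : R * R => g w.2)}.
  by apply: (@continuous_comp _ _ _ snd); [exact: cvg_snd|exact: cg].
have c : {for (a, b), continuous (fun w : R * R => (f w.1, g w.2))} by exact: (cvg_pair c1 c2).
have [[a' b'] [/h Gh Bh]] := cl _ (c _ nB).
by exists (f a', g b').
Qed.

Variables (FL FR : Gam -> circle_lift R) (n : Gam -> Gam -> int) (M : R).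
Hypothesis mulL : forall x y, (FL x * FL y = turn R (n x y) * FL (x * y))%g.
Hypothesis mulR : forall x y, (FR x * FR y = turn R (n x y) * FR (x * y))%g.
Hypothesis bound : forall x t, ((FR x)^-1 * FL x)%g t <= t + M.

Let S t : set R := [set s | exists x, s = ((FR x)^-1 * FL x)%g t].

(* Ghys's semiconjugacy between two actions with the same bounded Euler class. *)
Definition semiconj t : R := sup (S t).

Let S_ub t : has_ubound (S t).
Proof. by exists (t + M) => _ [x ->]. Qed.

Let S_le x t : ((FR x)^-1 * FL x)%g t <= semiconj t.
Proof. by apply: ub_le_sup; [exact: S_ub|exists x]. Qed.

Let S_ge t c : (forall x, ((FR x)^-1 * FL x)%g t <= c) -> semiconj t <= c.
Proof. by move=> h; apply: ge_sup => [|_ [x ->]//]; exists (((FR 1)^-1 * FL 1)%g t), 1%g. Qed.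

Lemma semiconj_le s t : s <= t -> semiconj s <= semiconj t.
Proof.
by move=> st; apply: S_ge => x; apply: le_trans (S_le x t); rewrite circle_lift_le.
Qed.

Lemma semiconj_addpi t : semiconj (t + pi) = semiconj t + pi.
Proof.
apply/eqP; rewrite eq_le; apply/andP; split.
  by apply: S_ge => x; rewrite circle_lift_addpi lerD2r.
rewrite -lerBrDr; apply: S_ge => x.
by rewrite lerBrDr -circle_lift_addpi.
Qed.

Lemma semiconj_addz t (k : int) : semiconj (t + k%:~R * pi) = semiconj t + k%:~R * pi.
Proof.
have pos (m : nat) s : semiconj (s + m%:R * pi) = semiconj s + m%:R * pi.
  elim: m => [|m IH]; first by rewrite !mul0r !addr0.
  by rewrite -natr1 mulrDl mul1r addrA semiconj_addpi IH -addrA.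
case: k => m; first exact: pos.
rewrite NegzE mulrNz mulNr; have := pos m.+1 (t - m.+1%:~R * pi).
by rewrite subrK => ->; rewrite addrK.
Qed.

(** Replacing [y] by [y * x] reindexes the family whose supremum is taken; the common cocycle
    cancels because turns are central. *)
Lemma semiconj_equiv x t : semiconj (FL x t) = FR x (semiconj t).
Proof.
have E y u : ((FR y)^-1 * FL y)%g (FL x u) = FR x (((FR (y * x))^-1 * FL (y * x))%g u).
  change (((FR y)^-1 * FL y * FL x)%g u = (FR x * ((FR (y * x))^-1 * FL (y * x)))%g u).
  have eR : FR x = ((FR y)^-1 * turn R (n y x) * FR (y * x))%g by rewrite -mulgA -mulR mulKg.
  by rewrite {1}eR -mulgA mulL !mulgA mulgK.
apply/eqP; rewrite eq_le; apply/andP; split.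
  by apply: S_ge => y; rewrite E circle_lift_le.
rewrite -[leRHS](circle_lift_mulEV (FR x)) circle_lift_le; apply: S_ge => y.
rewrite -(circle_lift_le (FR x)) circle_lift_mulEV.
by have := E (y * x^-1)%g t; rewrite mulgVK => <-.
Qed.

Definition semiconj_curve : set (R * R) := closure [set z | z.2 = semiconj z.1].

Lemma semiconj_curve_graph t : semiconj_curve (t, semiconj t).
Proof. exact: subset_closure. Qed.

Lemma semiconj_preserved x : preserved semiconj_curve (FL x) (FR x).
Proof.
have fwd y a b : semiconj_curve (a, b) -> semiconj_curve (FL y a, FR y b).
  apply: closure_stable; try exact: circle_lift_cts.
  by move=> u v /= ->; rewrite semiconj_equiv.
have bwd a b : semiconj_curve (a, b) -> semiconj_curve (((FL x)^-1)%g a, ((FR x)^-1)%g b).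
  apply: closure_stable; try exact: circle_lift_cts.
  move=> u v /= ->; apply: (circle_lift_inj (f := FR x)).
  by rewrite circle_lift_mulEV -semiconj_equiv circle_lift_mulEV.
move=> a b; split; last exact: fwd.
by move=> /bwd; rewrite !circle_lift_mulVE.
Qed.

Lemma semiconj_curve_addz (k : int) a b :
  semiconj_curve (a, b) -> semiconj_curve (a + k%:~R * pi, b + k%:~R * pi).
Proof.
rewrite -!turnE; apply: closure_stable; try exact: circle_lift_cts.
by move=> u v /= ->; exact/esym/semiconj_addz.
Qed.

Lemma semiconj_curve_near a b e : 0 < e -> semiconj_curve (a, b) ->
  exists t, `|a - t| < e /\ `|b - semiconj t| < e.
Proof.
move=> e0 cl; have [[t s] [/= -> [h1 h2]]] := cl _ (nbhsx_ballx (a, b) e e0).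
by exists t.
Qed.

Lemma semiconj_curve_mono a b a' b' : semiconj_curve (a, b) -> semiconj_curve (a', b') ->
  a < a' -> b <= b'.
Proof.
move=> h h' aa; rewrite leNgt; apply/negP => bb.
pose e := Num.min ((a' - a) / 2) ((b - b') / 2).
have e0 : 0 < e by rewrite lt_min; apply/andP; split; lra.
have [e1 e2] : e <= (a' - a) / 2 /\ e <= (b - b') / 2 by rewrite /e !ge_min !lexx orbT.
have [t [t1 t2]] := semiconj_curve_near e0 h; have [t' [t1' t2']] := semiconj_curve_near e0 h'.
move: t1 t2 t1' t2'; rewrite !ltr_norml => /andP[k1 k2] /andP[k3 k4] /andP[k5 k6] /andP[k7 k8].
have : semiconj t <= semiconj t' by apply: semiconj_le; lra.
by move: (semiconj t) (semiconj t') k3 k4 k7 k8 => u v; lra.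
Qed.

(* A vertical segment of length [pi] makes the semiconjugacy constant modulo [pi]
   outside [a + pi Z]; its value is then fixed. *)
Lemma semiconj_jump a b : semiconj_curve (a, b) -> semiconj_curve (a, b + pi) ->
  forall x, exists k : int, FR x b = b + k%:~R * pi.
Proof.
move=> h h' x; have p0 := @pi_gt0 R.
(* The graph is squeezed between the points [(a, b + pi)] and [(a + pi, b + pi)] of the curve. *)
have val t : a < t < a + pi -> semiconj t = b + pi.
  move=> /andP[t1 t2]; apply/eqP; rewrite eq_le; apply/andP; split.
    have := semiconj_curve_addz (k := 1) h; rewrite mul1r => h1.
    exact: semiconj_curve_mono (semiconj_curve_graph (t := t)) h1 t2.
  exact: semiconj_curve_mono h' (semiconj_curve_graph (t := t)) t1.
have vals t : (forall k : int, t <> a + k%:~R * pi) -> exists k : int, semiconj t = b + k%:~R * pi.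
  move=> nt; have [k /andP[k0 k1]] := mod_pi (t - a).
  exists (k + 1); have -> : t = (t - k%:~R * pi) + k%:~R * pi by rewrite subrK.
  rewrite semiconj_addz val; first by rewrite intrD; ring.
  apply/andP; split; last lra.
  rewrite lt_neqAle; apply/andP; split; last lra.
  by apply/eqP => e; apply: (nt k); rewrite e subrK.
(* [FL x] cannot send two distinct points less than [pi] apart into [a + pi Z], so one of
   [a + pi / 3] and [a + pi / 2] qualifies. *)
have pick : exists t, a < t < a + pi /\ forall k : int, FL x t <> a + k%:~R * pi.
  have good u v : a < u < a + pi -> a < v < a + pi -> u < v ->
      (exists k : int, FL x u = a + k%:~R * pi) -> forall k : int, FL x v <> a + k%:~R * pi.
    move=> /andP[u1 u2] /andP[v1 v2] uv [k ek] l el.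
    have l1 : FL x u < FL x v by rewrite circle_lift_lt.
    have l2 : FL x v < FL x u + pi by rewrite -circle_lift_addpi circle_lift_lt; lra.
    have : k%:~R * pi < l%:~R * pi :> R by lra.
    have : l%:~R * pi < (k + 1)%:~R * pi :> R by rewrite intrD mulrDl mul1r; lra.
    by rewrite !intpi_lt; lia.
  have [ex|no] := pselect (exists k : int, FL x (a + pi / 3) = a + k%:~R * pi).
    exists (a + pi / 2); split; first by apply/andP; split; lra.
    by apply: (good (a + pi / 3)) => //; try (apply/andP; split); lra.
  exists (a + pi / 3); split; first by apply/andP; split; lra.
  by move=> k ek; apply: no; exists k.
have [t [t1 /vals[k ek]]] := pick.
exists (k - 1); rewrite semiconj_equiv (val t t1) circle_lift_addpi in ek.
by rewrite intrB mulrBl mul1r; lra.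
Qed.

End Semiconjugacy.

(** * Lifts with a common Euler cocycle *)

Section Converse.
Variables (R : realType) (Gam : groupType).
Implicit Types (D : set (R * R)) (r rl rr : {multiplicative Gam -> PSL2 R}).

(** Lets [no_common_fixed] apply to a single faithful discrete representation. *)
Lemma diagonal_action r : faithful_discrete r -> curve_action r r [set z | z.1 = z.2].
Proof.
move=> [inj disc]; have p0 := @pi_gt0 R; have mr x y : r (x * y)%g = (r x * r y)%g by exact: gmulfM.
split=> //.
- by move=> x h _; apply: inj; rewrite h morph1.
- have [U nU hU] := faithful_discrete_small mr inj disc.
  by exists U => // x A B eA _ UA _; exact: hU eA UA.
- split.
  + have -> : [set z : R * R | z.1 = z.2] = (fun z : R * R => z.1 - z.2) @^-1` [set 0].
      apply/seteqP; split=> z; rewrite /preimage /mkset; first by move=> ->; rewrite subrr.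
      by move/eqP; rewrite subr_eq0 => /eqP.
    apply: (@closed_comp _ _ (fun z : R * R => z.1 - z.2)); last exact: closed_eq.
    by move=> z _; apply: cvgB; [exact: cvg_fst|exact: cvg_snd].
  + by rewrite /mkset => n x y /= ->.
  + by rewrite /mkset => x y x' y' /= -> -> /ltW.
  + by rewrite /mkset => x y /= -> /eqP; rewrite -subr_eq0 opprD addrA subrr sub0r oppr_eq0 gt_eqF.
- exists 0, 0, (pi / 2), (pi / 2); split=> // n [e _].
  have : 0%:~R * pi < n%:~R * pi :> R by rewrite mul0r; lra.
  have : n%:~R * pi < 1%:~R * pi :> R by rewrite mul1r; lra.
  by rewrite !intpi_lt; lia.
move=> x; have [f lf] := lifts_exists (r x); exists f, f; split=> // a b /=.
by split=> [/circle_lift_inj|->].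
Qed.

Lemma no_global_fixed r t : ~ abelian_group Gam -> faithful_discrete r ->
  ~ forall x, exists2 f : circle_lift R, lifts (r x) f &
      exists k : int, f t = t + k%:~R * pi.
Proof.
move=> nab fd h; apply: (no_common_fixed (diagonal_action fd) nab (dir_neq0 t)) => x A eA.
have [f lf [k fk]] := h x; rewrite -eA in lf; have [c c0 e] := lifts_of lf t.
rewrite /fixes e crossZ fk cross_dir addrAC subrr add0r.
have -> : sin (k%:~R * pi) = cross (dir (0 : R)) (dir (0 + k%:~R * pi)).
  by rewrite cross_dir subr0 add0r.
by rewrite dir_addz crossZ crossvv !mulr0.
Qed.

Lemma semiconj_monotone (FL FR : Gam -> circle_lift R) n M :
  (forall x y, (FL x * FL y = turn R (n x y) * FL (x * y))%g) ->
  (forall x y, (FR x * FR y = turn R (n x y) * FR (x * y))%g) ->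
  (forall x t, ((FR x)^-1 * FL x)%g t <= t + M) ->
  (forall b, ~ forall x, exists k : int, FR x b = b + k%:~R * pi) ->
  monotone_curve (semiconj_curve FL FR).
Proof.
move=> mL mR bd nf; split.
- exact: closed_closure.
- by move=> k a b h; exact: (semiconj_curve_addz bd h).
- by move=> a b a' b' h h'; exact: (semiconj_curve_mono bd h h').
- by move=> a b h h'; exact: (nf b (semiconj_jump mL mR bd h h')).
Qed.

Lemma equal_euler_lifts rl rr : bounded_euler_class rl = bounded_euler_class rr ->
  exists (FL FR : Gam -> circle_lift R) n M,
  [/\ forall x, lifts (rl x) (FL x) /\ lifts (rr x) (FR x),
      forall x y, (FL x * FL y = turn R (n x y) * FL (x * y))%g,
      forall x y, (FR x * FR y = turn R (n x y) * FR (x * y))%g &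
      forall x t, ((FR x)^-1 * FL x)%g t <= t + M].
Proof.
move=> /bounded_euler_class_eq[b [M bM] hb]; have p0 := @pi_gt0 R.
exists (fun x => standard_lift (rl x)), (fun x => turn R (b x) * standard_lift (rr x))%g.
(* Correcting the right lifts by [b] gives them the left cocycle. The bound adds [2 * pi] for each
   standard lift and [M] turns for [b]. *)
exists (euler_cocycle rl), (4 * pi + M%:~R * pi); split.
- move=> x; split; first by have [] := standard_liftP (rl x).
  by apply: lifts_turn_mul; have [] := standard_liftP (rr x).
- by move=> x y; rewrite euler_cocycleP.
- move=> x y; rewrite turn_mul2 euler_cocycleP !mulgA -!turnD.
  by congr (turn R _ * _)%g; have := hb x y; rewrite /coboundary1; lia.
move=> x t; rewrite -(circle_lift_le (turn R (b x) * standard_lift (rr x))%g).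
rewrite [leLHS]circle_lift_mulEV [leRHS]circle_lift_mulE turnE.
have := standard_lift_near (rl x) t.
have := standard_lift_near (rr x) (t + (4 * pi + M%:~R * pi)).
rewrite !ler_norml => /andP[h1 h2] /andP[h3 h4].
have : - M%:~R * pi <= (b x)%:~R * pi :> R.
  by rewrite -mulrNz intpi_le; have := bM x; lia.
lra.
Qed.

Lemma multiplicative_exists (H : groupType) (f : Gam -> H) :
  (forall x y, f (x * y)%g = (f x * f y)%g) -> exists g : {multiplicative Gam -> H}, g =1 f.
Proof.
move=> fM; pose m := isMultiplicative.Build Gam H f fM.
pose g : {multiplicative Gam -> H} := HB.pack f m.
by exists g.
Qed.

End Converse.

Section EqualEuler.
Variables (R : realType) (Gam : groupType) (rho : {multiplicative Gam -> (PSL2 R * PSL2 R)%type}).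

Theorem equal_euler_admissible : ~ abelian_group Gam -> injective rho ->
  faithful_discrete (fst \o rho) -> faithful_discrete (snd \o rho) ->
  bounded_euler_class (fst \o rho) = bounded_euler_class (snd \o rho) -> admissible rho.
Proof.
move=> nab inj dl dr /equal_euler_lifts[FL [FR [n [M [lft mL mR bd]]]]]; have p0 := @pi_gt0 R.
(* A vertical segment of length [pi] would produce a point of the circle fixed by the whole right
   factor. *)
have mD : monotone_curve (semiconj_curve FL FR).
  apply: semiconj_monotone mL mR bd _ => b h.
  by apply: (no_global_fixed (t := b) nab dr) => x; exists (FR x) => //; have [] := lft x.
have exL x : exists F : PSL2_cover R, F = FL x :> circle_lift R.
  by apply: (cover_of_lift (x := (rho x).1)); have [] := lft x.
have exR x : exists F : PSL2_cover R, F = FR x :> circle_lift R.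
  by apply: (cover_of_lift (x := (rho x).2)); have [] := lft x.
have [CL eL] := choice exL; have [CR eR] := choice exR.
have [rhot ert] : exists rhot : {multiplicative Gam -> AdS_isom R},
    rhot =1 (fun x => AdS_isom_of (CL x, CR x)).
  apply: multiplicative_exists => x y; rewrite -AdS_isom_ofM; apply/esym/AdS_isom_of_eq.
  exists (n x y); split.
    by rewrite -[LHS]/(((CL x : circle_lift R) * CL y)%g) !eL.
  by rewrite -[LHS]/(((CR x : circle_lift R) * CR y)%g) !eR.
split=> //; first by have [] := dl; exact: fst_discrete.
exists rhot, (cochart (semiconj_curve FL FR)); split.
  move=> x; exists (CL x, CR x); rewrite ert; split=> //=.
    by rewrite eL; have [] := lft x.
  by rewrite eR; have [] := lft x.
split.
  split; [|exact: cochart_closed|exact: cochart_achronal|exact: cochart_generic].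
  by move=> _ [z _ ->]; exact: ein_cover.
split.
  exists (ein 0 (semiconj FL FR 0)), (ein (pi / 2) (semiconj FL FR (pi / 2))); split.
  - by exists (0, semiconj FL FR 0) => //; exact: semiconj_curve_graph.
  - by exists (pi / 2, semiconj FL FR (pi / 2)) => //; exact: semiconj_curve_graph.
  move=> /ein_inj[k [e _]].
  have : 0%:~R * pi < k%:~R * pi :> R by rewrite mul0r; lra.
  have : k%:~R * pi < 1%:~R * pi :> R by rewrite mul1r; lra.
  by rewrite !intpi_lt; lia.
move=> x; exists (translate (CL x, CR x)).
  by exists (CL x, CR x); [rewrite ert|exact: translate_extends].
by apply: cochart_preserves => a b /=; rewrite eL eR; exact: (semiconj_preserved mL mR bd).
Qed.

End EqualEuler.

Theorem theorem10p11 (R : realType) (Gam : groupType)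
    (rho : {multiplicative Gam -> (PSL2 R * PSL2 R)%type})
    (nonabelian : ~ abelian_group Gam) (notorsion : torsion_free Gam)
    (faithful : injective rho) :
  admissible rho <->
  [/\ faithful_discrete (fst \o rho), faithful_discrete (snd \o rho)
    & bounded_euler_class (fst \o rho) = bounded_euler_class (snd \o rho)].
Proof.
split=> [|[dl dr e]]; last exact: equal_euler_admissible.
move=> /admissible_curve[D ca]; split.
- have [U nU hU] := left_discrete notorsion nonabelian ca.
  exact: (small_faithful_discrete (ca_mull ca) nU hU).
- have ca' := curve_action_swap ca.
  have [U nU hU] := left_discrete notorsion nonabelian ca'.
  exact: (small_faithful_discrete (ca_mulr ca) nU hU).
- exact: (curve_euler (rl := (fst \o rho)) (rr := (snd \o rho)) ca).
Qed.
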